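(* Let $g>0$, let $k_0>0$ be a given wave number, and set $M^*=4g$ and $M^*(k_0)=M^*+4k_0^2$. Then at $(v,M)=(0,M^*(k_0))$ a subcritical pitchfork bifurcation occurs, and the corresponding local bifurcation branch can be extended to a global bifurcation curve, i.e. a continuous curve $$\{(v(s),M(s)) : s\in\mathbb{R}\}\subset \mathcal{U}\times\mathbb{R},$$ where $$\mathcal{U}=\Bigl\{v\in H^2_{\mathrm{per}} : v \text{ even},\ \int_{-\pi/k_0}^{\pi/k_0} v\,\mathrm{d}x=0,\ v>-1\Bigr\},$$ such that for every $s\in\mathbb{R}$ the function $h=1+v(s)$ is a $\tfrac{2\pi}{k_0}$-periodic stationary solution of the thermocapillary thin-film equation $$\partial_t h+\partial_x\Bigl(h^3(\partial_x^3h-g\,\partial_xh)+M\frac{h^2}{(1+h)^2}\partial_xh\Bigr)=0$$ with $M=M(s)$. For every $p\in[1,\infty)$ the set $\{v(s):s\in\mathbb{R}\}$ is bounded in $W^{2,p}_{\mathrm{per}}$, and the curve does not return to the trivial curve $\{(0,M):M\in\mathbb{R}\}$, i.e. $v(s)\neq 0$ for $s\neq0$. Moreover, film rupture occurs, that is, $$\inf_{s\in\mathbb{R}}\ \min_{x\in[-\frac{\pi}{k_0},\frac{\pi}{k_0}]}v(s)(x)=-1.$$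
   Context: $H^2_{\mathrm{per}}$ and $W^{2,p}_{\mathrm{per}}$ denote the spaces of $\tfrac{2\pi}{k_0}$-periodic functions in $H^2_{\mathrm{loc}}(\mathbb{R})$, respectively $W^{2,p}_{\mathrm{loc}}(\mathbb{R})$, normed by the corresponding norm on $(-\tfrac{\pi}{k_0},\tfrac{\pi}{k_0})$; $\mathcal U$ carries the $H^2_{\mathrm{per}}$-topology. Stationary solutions are found as zeros of $F(v,M)=\partial_x^2v-gv+M\bigl(\tfrac{1}{2+v}+\log\tfrac{1+v}{2+v}\bigr)-MK(v)$, where $K(v)=\tfrac{k_0}{2\pi}\int_{-\pi/k_0}^{\pi/k_0}\bigl(\tfrac{1}{2+v}+\log\tfrac{1+v}{2+v}\bigr)\mathrm{d}x$; if $v\in\mathcal U$ and $F(v,M)=0$, then $h=1+v$ is a positive stationary solution of the thin-film equation. One has $F(0,M)=0$ for all $M$. ''A subcritical pitchfork bifurcation occurs at $(0,M^*(k_0))$'' means: there are $\varepsilon>0$ and a local curve $s\mapsto(v(s),M(s))\in\mathcal U\times\mathbb R$, $s\in(-\varepsilon,\varepsilon)$, of solutions of $F(v,M)=0$ with $(v(0),M(0))=(0,M^*(k_0))$, $v(s)=s\cos(k_0x)+O(s^2)$ in $H^2_{\mathrm{per}}$ (so $v(s)\ne0$ for $s\neq 0$), $\dot M(0)=0$ and $\ddot M(0)<0$. ''Extended'' means that the global curve coincides with this local curve for $s$ near $0$. *)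

(* Defs.v *)
From HB Require Import structures.
From mathcomp Require Import all_boot all_order all_algebra.
From mathcomp Require Import all_classical all_reals all_analysis.

Set Implicit Arguments.
Unset Strict Implicit.
Unset Printing Implicit Defensive.

Import Order.TTheory GRing.Theory Num.Theory.
Import numFieldNormedType.Exports.

Local Open Scope ring_scope.
Local Open Scope classical_set_scope.

Definition test_function {R : realType} (phi : R -> R) : Prop :=
  (forall n x, derivable (derive1n n phi) x 1) /\
  compact (closure [set x | phi x != 0]).

Definition weak_derivative {R : realType} (n : nat) (u w : R -> R) : Prop :=
  [/\ locally_integrable setT u, locally_integrable setT w &
    forall phi : R -> R, test_function phi ->
      \int[lebesgue_measure]_x (u x * derive1n n phi x) =
      (-1) ^+ n * \int[lebesgue_measure]_x (w x * phi x)].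

(* Weak derivatives are unique up to a null set; every use below depends only
   on the almost-everywhere class. *)
Definition wderiv {R : realType} (n : nat) (u : R -> R) : R -> R :=
  get [set w | weak_derivative n u w].

Definition Lp_loc {R : realType} (p : R) (f : R -> R) : Prop :=
  measurable_fun setT f /\
  forall K : set R, compact K ->
    (\int[lebesgue_measure]_(x in K) (`|f x| `^ p)%:E < +oo)%E.

Definition W2_loc {R : realType} (p : R) (u : R -> R) : Prop :=
  forall n : nat, (n <= 2)%N ->
    exists2 w : R -> R, weak_derivative n u w & Lp_loc p w.

(* Elements are represented by their continuous representative. *)
Definition W2_per {R : realType} (p k0 : R) (u : R -> R) : Prop :=
  [/\ continuous u, periodic u (2 * pi / k0) & W2_loc p u].

(* The norm of W^{2,p}(-pi/k0, pi/k0). *)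
Definition W2_norm {R : realType} (p k0 : R) (u : R -> R) : \bar R :=
  let mu := @lebesgue_measure R in
  ((\int[mu]_(x in `](- (pi / k0))%R, (pi / k0)%R[) (`|u x| `^ p)%:E
    + \int[mu]_(x in `](- (pi / k0))%R, (pi / k0)%R[) (`|wderiv 1 u x| `^ p)%:E
    + \int[mu]_(x in `](- (pi / k0))%R, (pi / k0)%R[) (`|wderiv 2 u x| `^ p)%:E) `^ p^-1)%E.

Definition H2_per {R : realType} (k0 : R) (u : R -> R) : Prop := W2_per 2 k0 u.

Definition H2_norm {R : realType} (k0 : R) (u : R -> R) : \bar R :=
  W2_norm 2 k0 u.

Definition U {R : realType} (k0 : R) : set (R -> R) :=
  [set v | [/\ H2_per k0 v,
    (forall x, v (- x) = v x),
    \int[lebesgue_measure]_(x in `[- (pi / k0), pi / k0]) v x = 0 &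
    (forall x, -1 < v x)]].

Definition nonlin {R : realType} (y : R) : R :=
  (2 + y)^-1 + ln ((1 + y) / (2 + y)).

Definition K {R : realType} (k0 : R) (v : R -> R) : R :=
  k0 / (2 * pi) *
  \int[lebesgue_measure]_(x in `[- (pi / k0), pi / k0]) nonlin (v x).

Definition F {R : realType} (g k0 : R) (v : R -> R) (M : R) : R -> R :=
  fun x => wderiv 2 v x - g * v x + M * nonlin (v x) - M * K k0 v.

(* F v M = 0 as an element of L^2. *)
Definition F_zero {R : realType} (g k0 : R) (v : R -> R) (M : R) : Prop :=
  {ae lebesgue_measure, forall x, F g k0 v M x = 0}.

Definition flux {R : realType} (g M : R) (h : R -> R) : R -> R :=
  fun x => h x ^+ 3 * (derive1n 3 h x - g * derive1 h x)
           + M * (h x ^+ 2 / (1 + h x) ^+ 2) * derive1 h x.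

(* Positive classical solutions; the arguments of h are time and space. *)
Definition thin_film_solution {R : realType} (g M : R) (h : R -> R -> R) : Prop :=
  forall t x : R,
    [/\ 0 < h t x,
        derivable (h ^~ x) t 1,
        (forall n : nat, (n <= 2)%N -> derivable (derive1n n (h t)) x 1),
        derivable (flux g M (h t)) x 1 &
        derive1 (h ^~ x) t + derive1 (flux g M (h t)) x = 0].

Definition stationary_solution {R : realType} (g M : R) (h : R -> R) : Prop :=
  thin_film_solution g M (fun _ x => h x).

Definition Mstar {R : realType} (g : R) : R := 4 * g.

Definition Mstar_k {R : realType} (g k0 : R) : R := Mstar g + 4 * k0 ^+ 2.

(* Continuity on the open set of parameters A, for the topology of
   H^2_per x R. *)
Definition continuous_curve {R : realType} (k0 : R) (A : set R)
    (v : R -> R -> R) (M : R -> R) : Prop :=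
  forall s : R, A s ->
    [/\ U k0 (v s),
        H2_norm k0 (v t \- v s) @[t --> s] --> 0%E &
        M t @[t --> s] --> M s].

Definition subcritical_pitchfork {R : realType} (g k0 eps : R)
    (v : R -> R -> R) (M : R -> R) : Prop :=
  let A := [set s : R | `|s| < eps] in
  [/\ 0 < eps,
      continuous_curve k0 A v M /\ (forall s, A s -> F_zero g k0 (v s) (M s)),
      v 0 = cst 0 /\ M 0 = Mstar_k g k0,
      (exists C : R, \forall s \near (0 : R),
         (H2_norm k0 (fun x => v s x - s * cos (k0 * x))%R <= (C * s ^+ 2)%:E)%E)
      /\ (forall s, A s -> s != 0 -> v s <> cst 0) &
      [/\ forall s, A s -> derivable M s 1,
          derive1 M 0 = 0,
          derivable (derive1 M) 0 1 &
          derive1n 2 M 0 < 0]].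

(* Main.v *)
(** The stationary equation is a planar Hamiltonian system, and its closed orbits
    are obtained by quadrature. Write h = (1 + z) / T with z ranging over [-e, e].
    Since the potential minus its interpolation at z = -e and z = e is divisible
    by e^2 - z^2, conservation of energy reads z'^2 = (e^2 - z^2) Q(z) with
    Q = M T J - g and J an explicit positive integral, and z = e cos(Theta) turns
    it into Theta' = sqrt(Q(e cos(Theta))), which has no turning points. For each
    signed amplitude e in ]-1, 1[ the minimum q of Q is determined by the period,
    then T by the mean of h (both by monotonicity) and M by q and T, everything
    continuously in e. The minimum of 1 + v is at most 1 - e, whence rupture as e
    tends to 1, and the logarithmic singularity that appears there is
    p-integrable uniformly in e, which gives the bounds in W^{2,p}.

    Near e = 0, symmetrization in z shows that the constraints depend on e only
    through E = e^2. They have first-order expansions in (E, T - 1, M T - M_0)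
    whose remainders are small also for differences of values; hence
    M = M_0 - c E + O(E^2) with c = M_0 (M_0 / (24 k0^2) + 11/16) > 0, where
    M_0 = 4 g + 4 k0^2, and M is strictly decreasing in E. So e can be
    reparametrized to have M = M_0 - c s^2 exactly for small s, which is the
    subcritical pitchfork. *)
Require Import Defs.
From HB Require Import structures.
From mathcomp Require Import all_boot all_order all_algebra.
From mathcomp Require Import all_classical all_reals all_analysis.
From mathcomp Require Import measurable_realfun.
From mathcomp Require Import ring lra.

Set Implicit Arguments.
Unset Strict Implicit.
Unset Printing Implicit Defensive.

Import Order.TTheory GRing.Theory Num.Theory.
Import numFieldNormedType.Exports.

Local Open Scope ring_scope.
Local Open Scope classical_set_scope.

(** * Integrals of continuous functions over segments *)

Section segment_integrals.
Context {R : realType}.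
Notation mu := (@lebesgue_measure R).
Implicit Types (f g F : R -> R) (a b c x y : R).

(** The pair ([e], [T]) records the extrema (1 - e) / T and (1 + e) / T of h: [e] is a relative
    amplitude, so rupture sits exactly at |e| = 1, while the scale [T] is left to be fixed by the
    mean. Taking the minimum of [Q] as the remaining unknown makes [Q] positive for every [q > 0];
    no admissibility condition has to be carried along, and the two constraints can be solved one
    after the other. The period decreases in [q] already pointwise under the integral. Monotonicity
    of the mean in [T] is the delicate point, since [q] varies with [T]: it comes from a single
    crossing of two profiles of [Q] ([J_cross], [Q_cross], [N_antitone]). Changing the sign of [e]
    shifts the orbit by half a period, which is why both halves of the pitchfork come from one
    formula. At rupture only ln(1 + v) in the second derivative becomes unbounded; its integrability
    rests on a lower bound for the phase speed on the side z <= 0, a consequence of the prescribed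
    period ([w_le_left]). *)

Lemma in_continuous_within a b f :
  {in `[a, b]%R, continuous f} -> {within `[a, b], continuous f}.
Proof.
move=> cf; apply: continuous_in_subspaceT => x; rewrite inE => xab.
exact: cf.
Qed.

Lemma seg_integrable a b f : {in `[a, b]%R, continuous f} ->
  mu.-integrable `[a, b] (EFin \o f).
Proof.
move=> cf; apply: continuous_compact_integrable; first exact: segment_compact.
exact: in_continuous_within.
Qed.

Lemma seg_intD a b f g :
  {in `[a, b]%R, continuous f} -> {in `[a, b]%R, continuous g} ->
  \int[mu]_(x in `[a, b]) (f x + g x) =
  \int[mu]_(x in `[a, b]) f x + \int[mu]_(x in `[a, b]) g x.
Proof. by move=> cf cg; apply: RintegralD => //; exact: seg_integrable. Qed.

Lemma seg_intB a b f g :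
  {in `[a, b]%R, continuous f} -> {in `[a, b]%R, continuous g} ->
  \int[mu]_(x in `[a, b]) (f x - g x) =
  \int[mu]_(x in `[a, b]) f x - \int[mu]_(x in `[a, b]) g x.
Proof. by move=> cf cg; apply: RintegralB => //; exact: seg_integrable. Qed.

Lemma seg_intZl a b f c : {in `[a, b]%R, continuous f} ->
  \int[mu]_(x in `[a, b]) (c * f x) = c * \int[mu]_(x in `[a, b]) f x.
Proof. by move=> cf; apply: RintegralZl => //; exact: seg_integrable. Qed.

Lemma seg_int_cst a b c : a <= b -> \int[mu]_(x in `[a, b]) c = c * (b - a).
Proof.
move=> ab; rewrite Rintegral_cst//= lebesgue_measure_itv/= lte_fin.
move: ab; rewrite le_eqVlt => /predU1P[->|->//]; by rewrite ltxx subrr.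
Qed.

Lemma seg_int_le a b f g :
  {in `[a, b]%R, continuous f} -> {in `[a, b]%R, continuous g} ->
  {in `[a, b]%R, forall x, f x <= g x} ->
  \int[mu]_(x in `[a, b]) f x <= \int[mu]_(x in `[a, b]) g x.
Proof. by move=> cf cg fg; apply: le_Rintegral => //; exact: seg_integrable. Qed.

Lemma eq_seg_int a b f g : {in `[a, b]%R, f =1 g} ->
  \int[mu]_(x in `[a, b]) f x = \int[mu]_(x in `[a, b]) g x.
Proof. by move=> fg; apply: eq_Rintegral => x; rewrite inE; exact: fg. Qed.

Lemma seg_int_lt a b f g : a < b ->
  {in `[a, b]%R, continuous f} -> {in `[a, b]%R, continuous g} ->
  {in `[a, b]%R, forall x, f x < g x} ->
  \int[mu]_(x in `[a, b]) f x < \int[mu]_(x in `[a, b]) g x.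
Proof.
move=> ab cf cg fg.
have ch : {in `[a, b]%R, continuous (fun x => g x - f x)}.
  by move=> x xab; apply: continuousB; [exact: cg|exact: cf].
have [c cab cmin] := EVT_min (ltW ab) (in_continuous_within ch).
rewrite -subr_gt0 -seg_intB//.
apply: (@lt_le_trans _ _ ((g c - f c) * (b - a))).
  by rewrite mulr_gt0 ?subr_gt0// fg.
rewrite -(seg_int_cst _ (ltW ab)); apply: seg_int_le => //.
by move=> x _; exact: cvg_cst.
Qed.

Lemma seg_int_norm_le a b f c : a <= b -> {in `[a, b]%R, continuous f} ->
  {in `[a, b]%R, forall x, `|f x| <= c} ->
  `|\int[mu]_(x in `[a, b]) f x| <= c * (b - a).
Proof.
move=> ab cf fc; have cN : {in `[a, b]%R, continuous (fun x => `|f x|)}.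
  by move=> x xab; apply: cvg_norm; exact: cf.
apply: le_trans (le_normr_Rintegral _ (seg_integrable cf)) _ => //.
rewrite -seg_int_cst//; apply: seg_int_le => // x _; exact: cvg_cst.
Qed.

Lemma is_derive_continuous f x l : is_derive x 1 f l -> {for x, continuous f}.
Proof.
by move=> [d _]; apply/differentiable_continuous/derivable1_diffP.
Qed.

Lemma seg_FTC2 a b f F : a <= b -> {in `[a, b]%R, continuous f} ->
  {in `[a, b]%R, forall x, is_derive x 1 F (f x)} ->
  \int[mu]_(x in `[a, b]) f x = F b - F a.
Proof.
rewrite le_eqVlt => /predU1P[<-|ab] cf dF.
  by rewrite set_itv1 Rintegral_set1 subrr.
rewrite /Rintegral (continuous_FTC2 ab (in_continuous_within cf) (F := F))//.
- have cF : {in `[a, b]%R, continuous F}.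
    by move=> x /dF; exact: is_derive_continuous.
  split.
  + move=> x xab; have [] := dF x => //.
    by move: xab; rewrite !in_itv/= => /andP[? ?]; rewrite !ltW.
  + by apply: cvg_at_right_filter; apply: cF; rewrite in_itv/= lexx ltW.
  + by apply: cvg_at_left_filter; apply: cF; rewrite in_itv/= lexx ltW.
- move=> x xab; rewrite derive1E; apply: derive_val; apply: dF.
  by move: xab; rewrite !in_itv/= => /andP[? ?]; rewrite !ltW.
Qed.

Lemma seg_int_split a b c f : a <= b -> b <= c ->
  {in `[a, c]%R, continuous f} ->
  \int[mu]_(x in `[a, c]) f x =
  \int[mu]_(x in `[a, b]) f x + \int[mu]_(x in `[b, c]) f x.
Proof.
move=> ab bc cf; have fi := seg_integrable cf.
have -> : \int[mu]_(x in `[b, c]) f x = \int[mu]_(x in `]b, c]) f x.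
  rewrite Rintegral_itv_obnd_cbnd//; apply: integrableS fi => //.
  by apply: subset_itvr; rewrite bnd_simp.
by rewrite -(Rintegral_itvB fi) ?bnd_simp//; ring.
Qed.

(** An integral from a fixed base point is an antiderivative only to its right. Here the base point
    [n x] moves with [x], and subtracting the value at 0 removes the dependence on it ([GB]). *)
Lemma antiderivative_exists f : continuous f ->
  exists F : R -> R, F 0 = 0 /\ forall x, is_derive x 1 F (f x).
Proof.
move=> cf.
have cf' a b : {in `[a, b]%R, continuous f} by move=> x _; exact: cf.
pose G a x := \int[mu]_(t in `[a, x]) f t.
have dG a x : a < x -> is_derive x 1 (G a) (f x).
  move=> ax; have [] := @continuous_FTC1_closed R f a x (x + 1) _ _ ax (cf x).
  - by rewrite ltrDl.
  - exact: seg_integrable.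
  by move=> d1 d2; apply: DeriveDef; [exact: d1|rewrite -derive1E; exact: d2].
have GB a b x : b <= a -> a <= 0 -> a <= x -> G b x - G b 0 = G a x - G a 0.
  move=> ba a0 ax.
  have E y : a <= y -> G b y = G b a + G a y.
    by move=> ay; rewrite /G (seg_int_split ba ay).
  by rewrite (E x)// (E 0)//; ring.
pose n x := - (`|x| + 1).
exists (fun x => G (n x) x - G (n x) 0); split; first by rewrite subrr.
move=> x.
(* One unit further left, this base point serves all [y] within distance 1 of [x]. *)
have : is_derive x 1 (fun y => G (n x - 1) y - G (n x - 1) 0) (f x).
  rewrite -[f x]subr0; apply: is_deriveB; apply: dG.
  rewrite /n; have := ler_norm (- x); rewrite normrN; lra.
apply: near_eq_is_derive.
near=> y; apply: GB; rewrite /n; last 2 first.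
- have := normr_ge0 y; lra.
- have := ler_norm (- y); rewrite normrN; lra.
have : `|y - x| <= 1.
  rewrite distrC; near: y.
  by apply: (@cvgr_dist_le _ _ _ _ _ id x) => //; exact: cvg_id.
by have := ler_normD (y - x) x; rewrite subrK; lra.
Unshelve. all: by end_near. Qed.

Lemma derive_mvt_le a b f df c : a <= b ->
  {in `[a, b]%R, forall x, is_derive x 1 f (df x)} ->
  {in `[a, b]%R, forall x, `|df x| <= c} ->
  `|f b - f a| <= c * (b - a).
Proof.
move=> ab d dc.
have [||x xab ->] := MVT_segment ab (f := f) (df := df).
- by move=> x xab; apply: d; exact: subset_itv_oo_cc xab.
- by apply: in_continuous_within => x /d; exact: is_derive_continuous.
by rewrite normrM (ger0_norm (_ : 0 <= b - a)) ?subr_ge0// ler_wpM2r ?subr_ge0// dc.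
Qed.

Lemma seg_int_scale T f : 0 < T -> {in `[0, T]%R, continuous f} ->
  \int[mu]_(s in `[0, T]) f s = \int[mu]_(t in `[0, 1]) (T * f (T * t)).
Proof.
move=> T0 cf; rewrite /Rintegral.
have dM (x : R) : is_derive x 1 (fun t : R => T * t) T.
  by apply: is_derive_eq; rewrite /GRing.scale/= mulr1.
have E : (fun t : R => T * t)^`() = cst T.
  by apply/funext => x; rewrite derive1E; exact: derive_val.
have := @integration_by_substitution_increasing R (fun t => T * t) f 0 1.
rewrite mulr0 mulr1 => ->//.
- by congr fine; apply: eq_integral => x _ /=; rewrite E /cst/= mulrC.
- by move=> x y _ _ xy; rewrite ltr_pM2l.
- by rewrite E => x _; exact: cvg_cst.
- by rewrite E; exact: is_cvg_cst.
- by rewrite E; exact: is_cvg_cst.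
- split.
  + by move=> x _; have [] := dM x.
  + by apply: cvg_at_right_filter; have := is_derive_continuous (dM 0).
  + by apply: cvg_at_left_filter; have := is_derive_continuous (dM 1).
- exact: in_continuous_within.
Qed.

Lemma seg_int_reflect c f : 0 <= c -> continuous f ->
  \int[mu]_(t in `[0, c]) f (c - t) = \int[mu]_(t in `[0, c]) f t.
Proof.
move=> c0 cf; have [F [_ dF]] := antiderivative_exists cf.
rewrite (@seg_FTC2 0 c f F)//.
rewrite (@seg_FTC2 0 c _ (fun t => - F (c - t)))//.
- by rewrite subrr subr0; ring.
- move=> x _; apply: (@continuous_comp _ _ _ (fun t : R => c - t) f).
    by apply: continuousB; [exact: cvg_cst|exact: cvg_id].
  exact: cf.
- move=> x _; rewrite -[f _]opprK.
  apply: is_deriveN; rewrite -mulrN1.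
  apply: (@is_derive1_comp _ F (fun t : R => c - t)).
  rewrite -[X in is_derive _ _ _ X]sub0r; apply: is_deriveB.
Qed.

(** Tube lemma: joint continuity along the slice at [x0] and compactness of the segment give
    closeness uniform in [t]. Continuity of integrals in their parameters, and of the branch in
    [H2_norm], rests on it. *)
Lemma uniform_on_segment (X : topologicalType) (G : X -> R -> R) (x0 : X) a b (eps : R) :
  0 < eps ->
  {in `[a, b]%R, forall t, (G p.1 p.2) @[p --> (x0, t)] --> G x0 t} ->
  \forall x \near x0, {in `[a, b]%R, forall t, `|G x t - G x0 t| < eps}.
Proof.
move=> e0 cG.
have K := (compact_near_coveringP _).1 (@segment_compact R a b).
suff H : forall t, `[a, b] t ->
    \forall t' \near t & x \near nbhs x0, `|G x t' - G x0 t'| < eps.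
  have := K _ (nbhs x0) _ (nbhs_filter x0) H.
  by apply: filterS => x h t; exact: h.
move=> t tab.
have e20 : 0 < eps / 2 by rewrite divr_gt0.
have /cvgrPdist_lt/(_ _ e20) := cG _ tab.
move=> H; have [[A B] /= [nA nB] AB] := H.
exists (B, A) => //= -[t' x] /= [Bt Ax].
have h1 := AB (x, t') (conj Ax Bt).
have h2 := AB (x0, t') (conj (nbhs_singleton nA) Bt).
rewrite /= in h1 h2.
have -> : G x t' - G x0 t' = (G x0 t - G x0 t') - (G x0 t - G x t') by ring.
rewrite (le_lt_trans (ler_normB _ _))//; lra.
Qed.

Lemma seg_int_continuous (X : topologicalType) (G : X -> R -> R) (x0 : X) a b :
  a <= b ->
  {in `[a, b]%R, forall t, (G p.1 p.2) @[p --> (x0, t)] --> G x0 t} ->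
  (\forall x \near x0, {in `[a, b]%R, continuous (G x)}) ->
  (\int[mu]_(t in `[a, b]) G x t) @[x --> x0] -->
    \int[mu]_(t in `[a, b]) G x0 t.
Proof.
move=> ab cG ncG; apply/cvgrPdist_lt => eps e0.
pose d := eps / (b - a + 1).
have ba0 : 0 < b - a + 1 by lra.
have d0 : 0 < d by rewrite divr_gt0.
have cG0 := nbhs_singleton ncG.
near=> x.
have cGx : {in `[a, b]%R, continuous (G x)} by near: x.
rewrite distrC -seg_intB//.
apply: (@le_lt_trans _ _ (d * (b - a))).
  apply: seg_int_norm_le => //.
    by move=> t tab; apply: continuousB; [exact: cGx|exact: cG0].
  have : {in `[a, b]%R, forall t, `|G x t - G x0 t| < d}.
    by near: x; exact: uniform_on_segment.
  by move=> h t /h/ltW.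
rewrite /d mulrAC ltr_pdivrMr// ltr_pM2l//; lra.
Unshelve. all: by end_near. Qed.

(** Explicit quadratic remainders serve where the rules of calculus do not apply directly: under the
    integral sign, at the flat points of the bump functions, and for [M] at the bifurcation
    point. *)
Lemma is_derive_quadratic f x (l C r : R) : 0 < r ->
  (forall y, `|y - x| < r -> `|f y - f x - (y - x) * l| <= C * (y - x) ^+ 2) ->
  is_derive x 1 f l.
Proof.
move=> r0 H; have C0 : 0 <= C.
  have := H (x + r / 2); rewrite addrAC subrr add0r gtr0_norm ?divr_gt0// => h.
  have := h ltac:(lra); move=> /(le_trans (normr_ge0 _)).
  by rewrite pmulr_lge0// exprn_gt0// divr_gt0.
have L : h^-1 *: ((f \o shift x) (h *: (1 : R)) - f x) @[h --> 0^'] --> l.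
  apply/cvgrPdist_le => e e0; near=> h.
  have h0 : h != 0 by near: h; exact: nbhs_dnbhs_neq.
  have hr : `|h| < r by near: h; apply: dnbhs0_lt.
  have hC : `|h| <= e / (C + 1) by near: h; apply: dnbhs0_le; rewrite divr_gt0//; lra.
  rewrite /= /GRing.scale/= mulr1.
  have -> : l - h^-1 * (f (h + x) - f x) =
      - (h^-1 * (f (h + x) - f x - (h + x - x) * l)) by rewrite addrK; field.
  rewrite normrN normrM normfV ler_pdivrMl ?normr_gt0//.
  have := H (h + x); rewrite addrK => /(_ hr)/le_trans; apply.
  rewrite -[h ^+ 2]ger0_norm ?sqr_ge0// normrX expr2 mulrA mulrAC mulrC ler_wpM2l//.
  rewrite mulrC; apply: le_trans (ler_wpM2r C0 hC) _.
  rewrite mulrAC ler_pdivrMr; last lra.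
  rewrite ler_wpM2l//; first exact: ltW; lra.
apply: DeriveDef; last exact: cvg_lim L.
by apply/cvg_ex; exists l.
Unshelve. all: by end_near. Qed.

Lemma is_derive_seg_int (G D : R -> R -> R) a b x (C r : R) : a <= b -> 0 < r ->
  (forall y, `|y - x| < r -> {in `[a, b]%R, continuous (G y)}) ->
  {in `[a, b]%R, continuous (D x)} ->
  (forall y, `|y - x| < r -> {in `[a, b]%R, forall t,
    `|G y t - G x t - (y - x) * D x t| <= C * (y - x) ^+ 2}) ->
  is_derive x 1 (fun y => \int[mu]_(t in `[a, b]) G y t)
    (\int[mu]_(t in `[a, b]) D x t).
Proof.
move=> ab r0 cG cD H.
apply: (@is_derive_quadratic _ _ _ (C * (b - a)) r) => // y yr.
have cx : {in `[a, b]%R, continuous (G x)} by apply: cG; rewrite subrr normr0.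
have cDB : {in `[a, b]%R, continuous (fun t => (y - x) * D x t)}.
  by move=> t tab; apply: cvgM; [exact: cvg_cst|exact: cD].
have cGB : {in `[a, b]%R, continuous (fun t => G y t - G x t)}.
  by move=> t tab; apply: continuousB; [exact: cG|exact: cx].
rewrite -seg_intB//; last exact: cG.
rewrite -seg_intZl// -seg_intB// mulrAC.
apply: seg_int_norm_le => //; last exact: H.
by move=> t tab; apply: cvgB; [exact: cGB|exact: cDB].
Qed.

(** Continuity of an implicitly defined root without derivatives: the strict signs of [G x0] at
    [y x0 - d] and [y x0 + d] persist for nearby [x], and monotonicity in the second argument traps
    [y x] between them. *)
Lemma implicit_monotone_continuous (X : topologicalType) (G : X -> R -> R)
    (y : X -> R) (x0 : X) :
  0 < y x0 -> G x0 (y x0) = 0 ->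
  (\forall x \near x0, 0 < y x /\ G x (y x) = 0) ->
  (\forall x \near x0, forall u v, 0 < u -> u < v -> G x u < G x v) ->
  (forall u, 0 < u -> (G x u) @[x --> x0] --> G x0 u) ->
  y x @[x --> x0] --> y x0.
Proof.
move=> y0 G0 nG nmono cG; apply/cvgrPdist_lt => e e0.
have mono0 := nbhs_singleton nmono.
(* The second bound keeps [y x0 - d] positive, where monotonicity is available. *)
pose d := Num.min (e / 2) (y x0 / 2).
have d0 : 0 < d by rewrite lt_min !divr_gt0.
have de : d <= e / 2 by rewrite ge_min lexx.
have dy : d <= y x0 / 2 by rewrite ge_min lexx orbT.
have lo0 : 0 < y x0 - d by lra.
have hi0 : 0 < y x0 + d by lra.
have Glo : G x0 (y x0 - d) < 0 by rewrite -G0; apply: mono0 => //; lra.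
have Ghi : 0 < G x0 (y x0 + d) by rewrite -G0; apply: mono0 => //; lra.
near=> x.
have [yx Gx] : 0 < y x /\ G x (y x) = 0 by near: x.
have mono : forall u v, 0 < u -> u < v -> G x u < G x v by near: x.
have lo : G x (y x0 - d) < 0.
  by near: x; have := cvgr_lt _ (cG _ lo0); apply.
have hi : 0 < G x (y x0 + d).
  by near: x; have := cvgr_gt _ (cG _ hi0); apply.
have h1 : y x0 - d < y x.
  rewrite ltNge; apply/negP; rewrite le_eqVlt => /predU1P[h|/(mono _ _ yx)].
    by move: lo; rewrite -h Gx ltxx.
  by rewrite Gx; move=> h; have := lt_trans h lo; rewrite ltxx.
have h2 : y x < y x0 + d.
  rewrite ltNge; apply/negP; rewrite le_eqVlt => /predU1P[h|/(mono _ _ hi0)].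
    by move: hi; rewrite h Gx ltxx.
  by rewrite Gx; move=> h; have := lt_trans h hi; rewrite ltxx.
rewrite ltr_norml; lra.
Unshelve. all: by end_near. Qed.

End segment_integrals.

(** * Limits of composed real expressions *)

Lemma cvg_pr1 (Y : Type) (F : set_system Y) (A B : topologicalType)
    (f : Y -> A * B) (a : A) (b : B) : f y @[y --> F] --> (a, b) -> (f y).1 @[y --> F] --> a.
Proof. by move=> fl; apply: cvg_comp fl _; exact: cvg_fst. Qed.

Lemma cvg_pr2 (Y : Type) (F : set_system Y) (A B : topologicalType)
    (f : Y -> A * B) (a : A) (b : B) : f y @[y --> F] --> (a, b) -> (f y).2 @[y --> F] --> b.
Proof. by move=> fl; apply: cvg_comp fl _; exact: cvg_snd. Qed.

Lemma cvg_to_pair (Y : Type) (F : set_system Y) (A B : topologicalType)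
    (f : Y -> A) (g : Y -> B) (a : A) (b : B) : Filter F ->
  f y @[y --> F] --> a -> g y @[y --> F] --> b ->
  (f y, g y) @[y --> F] --> (a, b).
Proof. by move=> FF fa gb; exact: (cvg_pair fa gb). Qed.

Lemma inv_le (R : realFieldType) (x y : R) : 0 < x -> x <= y -> y^-1 <= x^-1.
Proof. by move=> x0 xy; rewrite lef_pV2 ?posrE//; exact: lt_le_trans xy. Qed.

Section real_limits.
Context {R : realType} {Y : Type} {F : set_system Y} {FF : Filter F}.
Implicit Types (f g : Y -> R) (a b : R).

Lemma cvR_D f g a b : f y @[y --> F] --> a -> g y @[y --> F] --> b ->
  f y + g y @[y --> F] --> a + b.
Proof. exact: cvgD. Qed.

Lemma cvR_M f g a b : f y @[y --> F] --> a -> g y @[y --> F] --> b ->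
  f y * g y @[y --> F] --> a * b.
Proof. exact: cvgM. Qed.

Lemma cvR_N f a : f y @[y --> F] --> a -> - f y @[y --> F] --> - a.
Proof. exact: cvgN. Qed.

Lemma cvR_V f a : a != 0 -> f y @[y --> F] --> a ->
  (f y)^-1 @[y --> F] --> a^-1.
Proof. exact: cvgV. Qed.

Lemma cvR_norm f a : f y @[y --> F] --> a -> `|f y| @[y --> F] --> `|a|.
Proof. exact: cvg_norm. Qed.

Lemma cvR_cos f a : f y @[y --> F] --> a -> cos (f y) @[y --> F] --> cos a.
Proof. by move=> h; apply: cvg_comp h _; exact: continuous_cos. Qed.

Lemma cvR_sin f a : f y @[y --> F] --> a -> sin (f y) @[y --> F] --> sin a.
Proof. by move=> h; apply: cvg_comp h _; exact: continuous_sin. Qed.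

Lemma cvR_sqrt f a : f y @[y --> F] --> a ->
  Num.sqrt (f y) @[y --> F] --> Num.sqrt a.
Proof. by move=> h; apply: cvg_comp h _; exact: sqrt_continuous. Qed.

Lemma cvR_ln f a : 0 < a -> f y @[y --> F] --> a -> ln (f y) @[y --> F] --> ln a.
Proof. by move=> a0 h; apply: cvg_comp h _; exact: continuous_ln. Qed.

End real_limits.

(** Dispatches on the head symbol of the function under the filter. Limits of opaque subterms are
    taken from the context; what [cvg_arith] leaves open are the nonvanishing and positivity
    conditions of inverses and logarithms. *)
Ltac cvg_step :=
  lazymatch goal with
  | |- cvg_to (nbhs (fmap ?G _)) _ =>
    lazymatch G with
    | (fun _ => ?c) => exact: cvg_cst
    | (fun y => y) => exact: cvg_id
    | (fun y => @Algebra.add _ (@?f y) (@?g y)) => apply: (@cvR_D _ _ _ _ f g)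
    | (fun y => @Algebra.opp _ (@?f y)) => apply: (@cvR_N _ _ _ _ f)
    | (fun y => @GRing.mul _ (@?f y) (@?g y)) => apply: (@cvR_M _ _ _ _ f g)
    | (@GRing.mul _ ?c) => apply: (@cvR_M _ _ _ _ (fun _ => c) (fun y => y))
    | (fun y => @GRing.inv _ (@?f y)) => apply: (@cvR_V _ _ _ _ f)
    | (fun y => @Num.norm _ _ (@?f y)) => apply: (@cvR_norm _ _ _ _ f)
    | (fun y => cos (@?f y)) => apply: (@cvR_cos _ _ _ f)
    | (fun y => sin (@?f y)) => apply: (@cvR_sin _ _ _ f)
    | (fun y => Num.sqrt (@?f y)) => apply: (@cvR_sqrt _ _ _ f)
    | (fun y => ln (@?f y)) => apply: (@cvR_ln _ _ _ f)
    | @cos _ => exact: continuous_cos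
    | @sin _ => exact: continuous_sin
    | (fun y => fst (@?f y)) => eapply (@cvg_pr1 _ _ _ _ f)
    | (fun y => snd (@?f y)) => eapply (@cvg_pr2 _ _ _ _ f)
    | _ => assumption
    end
  end.
Ltac cvg_arith := rewrite /prop_for /continuous_at; repeat cvg_step.

(** * The quadrature kernel *)

Section J.
Context {R : realType}.
Notation mu := (@lebesgue_measure R).
Implicit Types (e T z t : R).

(* With [h = (1 + z) / T] and [z] oscillating between [- e] and [e], the energy
   equation reads [z'^2 = (e^2 - z^2) * Q z], [Q z = M * T * J e T z - g]. *)
Definition Jk e T z t : R :=
  2 * (T * T) * t / (((1 + T * t) * (1 + T * t) - e * e) * (1 + z + T * t)).

Definition J e T z : R := \int[mu]_(t in `[0, 1]) Jk e T z t.

Lemma Jk_den1 e T t : `|e| < 1 -> 0 < T -> 0 <= t ->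
  0 < (1 + T * t) * (1 + T * t) - e * e.
Proof.
rewrite ltr_norml => /andP[e1 e2] T0 t0.
have Tt : 0 <= T * t by rewrite mulr_ge0// ltW.
have -> : (1 + T * t) * (1 + T * t) - e * e =
  (1 + T * t - e) * (1 + T * t + e) by ring.
by rewrite mulr_gt0//; lra.
Qed.

Lemma Jk_den2 T z t : -1 < z -> 0 < T -> 0 <= t -> 0 < 1 + z + T * t.
Proof.
move=> z1 T0 t0; have Tt : 0 <= T * t by rewrite mulr_ge0// ltW.
lra.
Qed.

Lemma Jk_cvg (Y : topologicalType) (y0 : Y) (fe fT fz ft : Y -> R) e T z t :
  `|e| < 1 -> 0 < T -> -1 < z -> 0 <= t ->
  fe y @[y --> y0] --> e -> fT y @[y --> y0] --> T ->
  fz y @[y --> y0] --> z -> ft y @[y --> y0] --> t ->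
  Jk (fe y) (fT y) (fz y) (ft y) @[y --> y0] --> Jk e T z t.
Proof.
move=> e1 T0 z1 t0 he hT hz ht; rewrite /Jk; cvg_arith.
by apply: lt0r_neq0; rewrite mulr_gt0 ?Jk_den1 ?Jk_den2.
Qed.

Lemma Jk_continuous e T z : `|e| < 1 -> 0 < T -> -1 < z ->
  {in `[0, 1]%R, continuous (Jk e T z)}.
Proof.
move=> e1 T0 z1 t; rewrite in_itv/= => /andP[t0 _].
by apply: Jk_cvg => //; cvg_arith.
Qed.

Lemma J_cvg (Y : topologicalType) (y0 : Y) (fe fT fz : Y -> R) e T z :
  `|e| < 1 -> 0 < T -> -1 < z ->
  fe y @[y --> y0] --> e -> fT y @[y --> y0] --> T -> fz y @[y --> y0] --> z ->
  J (fe y) (fT y) (fz y) @[y --> y0] --> J e T z.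
Proof.
move=> e1 T0 z1 he hT hz.
pose G (p : R * R * R) t := Jk p.1.1 p.1.2 p.2 t.
have cJ : (\int[mu]_(t in `[0, 1]) G p t) @[p --> (e, T, z)] -->
    \int[mu]_(t in `[0, 1]) G (e, T, z) t.
  apply: seg_int_continuous => //.
    move=> t; rewrite in_itv/= => /andP[t0 _].
    rewrite /G/=; apply: Jk_cvg => //; cvg_arith.
  near=> p; apply: Jk_continuous.
  - near: p; have h : `|p.1.1| @[p --> (e, T, z)] --> `|e| by cvg_arith.
    exact: (cvgr_lt _ h).
  - near: p; have h : p.1.2 @[p --> (e, T, z)] --> T by cvg_arith.
    exact: (cvgr_gt _ h).
  - near: p; have h : p.2 @[p --> (e, T, z)] --> z by cvg_arith.
    exact: (cvgr_gt _ h).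
have h : (fe y, fT y, fz y) @[y --> y0] --> (e, T, z).
  by apply: cvg_to_pair => //; exact: cvg_to_pair.
exact: cvg_comp h cJ.
Unshelve. all: by end_near. Qed.

Lemma J_ltr e T z z' : `|e| < 1 -> 0 < T -> -1 < z -> z <= z' ->
  J e T z' <= J e T z.
Proof.
move=> e1 T0 z1 zz'; have z1' := lt_le_trans z1 zz'.
apply: seg_int_le; [exact: Jk_continuous|exact: Jk_continuous|].
move=> t; rewrite in_itv/= => /andP[t0 _].
have d1 := Jk_den1 e1 T0 t0; have d2 := Jk_den2 z1 T0 t0.
have d2' := Jk_den2 z1' T0 t0.
rewrite /Jk ler_wpM2l//; first by rewrite !mulr_ge0// ltW.
by rewrite lef_pV2 ?posrE ?mulr_gt0// ler_pM2l//; lra.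
Qed.

Lemma int_id01 : \int[mu]_(t in `[0, 1]) (2 * t) = 1.
Proof.
rewrite (@seg_FTC2 R 0 1 _ (fun t => t * t))//.
- by rewrite mulr1 mulr0 subr0.
- by move=> t _; cvg_arith.
- move=> t _; apply: is_derive_eq; rewrite /GRing.scale/=; ring.
Qed.

Lemma J_ge e T z : `|e| < 1 -> 0 < T -> -1 < z ->
  T * T / ((1 + T) * (1 + T) * (1 + z + T)) <= J e T z.
Proof.
move=> e1 T0 z1.
have c0 : 0 < (1 + T) * (1 + T) * (1 + z + T) by rewrite !mulr_gt0//; lra.
have cl : {in `[0, 1]%R, continuous (fun t => 2 * t : R)}.
  by move=> t _; cvg_arith.
set c := leLHS; have -> : c = \int[mu]_(t in `[0, 1]) (c * (2 * t)).
  by rewrite seg_intZl// int_id01 mulr1.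
apply: seg_int_le; [by move=> t _; cvg_arith|exact: Jk_continuous|].
move=> t; rewrite in_itv/= => /andP[t0 t1].
have d1 := Jk_den1 e1 T0 t0; have d2 := Jk_den2 z1 T0 t0.
have Tt : 0 <= T * t by rewrite mulr_ge0// ltW.
have tT : T * t <= T by rewrite -[leRHS]mulr1 ler_pM2l.
have -> : c * (2 * t) =
  2 * (T * T) * t / ((1 + T) * (1 + T) * (1 + z + T)) by rewrite /c; ring.
rewrite /Jk ler_wpM2l//; first by rewrite !mulr_ge0// ltW.
apply: inv_le; first by rewrite mulr_gt0.
apply: ler_pM; [exact: ltW|exact: ltW| |lra].
have ee : 0 <= e * e by rewrite -expr2 sqr_ge0.
have : (1 + T * t) * (1 + T * t) <= (1 + T) * (1 + T) by apply: ler_pM; lra.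
lra.
Qed.

Lemma J_gt0 e T z : `|e| < 1 -> 0 < T -> -1 < z -> 0 < J e T z.
Proof.
move=> e1 T0 z1; apply: lt_le_trans (J_ge e1 T0 z1).
by rewrite divr_gt0// !mulr_gt0//; lra.
Qed.

(** The kernels at [z] and [z'] have ratio 1 + (z' - z) / (1 + z + T t), largest at t = 0. This
    limits how far [Q] rises above its minimum ([Q_ub]). *)
Lemma J_ratio_le e T z z' : `|e| < 1 -> 0 < T -> -1 < z -> z <= z' ->
  J e T z <= (1 + (z' - z) / (1 + z)) * J e T z'.
Proof.
move=> e1 T0 z1 zz'; have z1' := lt_le_trans z1 zz'.
rewrite -seg_intZl; last exact: Jk_continuous.
apply: seg_int_le; [exact: Jk_continuous| |].
  by move=> t t01; apply: cvgM; [exact: cvg_cst|exact: Jk_continuous].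
move=> t; rewrite in_itv/= => /andP[t0 t1].
have d1 := Jk_den1 e1 T0 t0; have d2 := Jk_den2 z1 T0 t0.
have d2' := Jk_den2 z1' T0 t0.
have Tt : 0 <= T * t by rewrite mulr_ge0// ltW.
have -> : Jk e T z t = (1 + (z' - z) / (1 + z + T * t)) * Jk e T z' t.
  rewrite /Jk; field; rewrite !lt0r_neq0//.
rewrite ler_wpM2r//.
  by rewrite /Jk !mulr_ge0// ?invr_ge0 ?mulr_ge0// ltW.
rewrite lerD2l ler_wpM2l//; first lra.
by rewrite lef_pV2 ?posrE//; lra.
Qed.

(** The substitution s = T t moves [T] from the integrand to the upper bound, so that values of [J]
    for T' < T differ by an integral over [T', T]. *)
Lemma J_scale e T z : `|e| < 1 -> 0 < T -> -1 < z ->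
  J e T z = \int[mu]_(s in `[0, T])
    (2 * s / (((1 + s) * (1 + s) - e * e) * (1 + z + s))).
Proof.
move=> e1 T0 z1; rewrite [RHS](@seg_int_scale _ T)//.
  apply: eq_seg_int => t; rewrite in_itv/= => /andP[t0 t1].
  have d1 := Jk_den1 e1 T0 t0; have d2 := Jk_den2 z1 T0 t0.
  by rewrite /Jk; field; rewrite !lt0r_neq0.
move=> s; rewrite in_itv/= => /andP[s0 _].
cvg_arith; apply: lt0r_neq0; rewrite mulr_gt0//.
  by have := Jk_den1 e1 ltr01 s0; rewrite mul1r.
by have := Jk_den2 z1 ltr01 s0; rewrite mul1r.
Qed.

(* [J e T' z / J e T z] is nonincreasing in [z] for [T' < T]: the extra part
   [T', T] of the integration domain carries larger [s], where the kernel
   [1 / (1 + z + s)] depends less on [z]. *)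
Lemma J_cross e T' T z z' : `|e| < 1 -> 0 < T' -> T' <= T -> -1 < z ->
  z <= z' -> J e T' z' * J e T z <= J e T' z * J e T z'.
Proof.
move=> e1 T0' TT' z1 zz'; have z1' := lt_le_trans z1 zz'.
have T0 := lt_le_trans T0' TT'.
pose k z s := 2 * s / (((1 + s) * (1 + s) - e * e) * (1 + z + s)).
have kc y a b : -1 < y -> 0 <= a -> {in `[a, b]%R, continuous (k y)}.
  move=> y1 a0 s; rewrite in_itv/= => /andP[/(le_trans a0) s0 _].
  rewrite /k; cvg_arith; apply: lt0r_neq0; rewrite mulr_gt0//.
    by have := Jk_den1 e1 ltr01 s0; rewrite mul1r.
  by have := Jk_den2 y1 ltr01 s0; rewrite mul1r.
pose K y := \int[mu]_(s in `[T', T]) k y s.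
have JS y : -1 < y -> J e T y = J e T' y + K y.
  move=> y1; rewrite !J_scale// (seg_int_split (ltW T0') TT')//.
  exact: (kc y 0 T y1).
(* The ratio of the kernels at z' and z, (1 + z + s) / (1 + z' + s), increases with s; [r] is its
   value at s = T', where the two ranges meet. *)
pose r := (1 + z + T') / (1 + z' + T').
have k0 y s : -1 < y -> 0 <= s -> 0 <= k y s.
  move=> y1 s0; rewrite /k !mulr_ge0// invr_ge0 mulr_ge0//.
    by have := Jk_den1 e1 ltr01 s0; rewrite mul1r => /ltW.
  by have := Jk_den2 y1 ltr01 s0; rewrite mul1r => /ltW.
have kr s : 0 <= s -> k z' s = (1 + z + s) / (1 + z' + s) * k z s.
  move=> s0; rewrite /k; field.
  have := Jk_den1 e1 ltr01 s0; have := Jk_den2 z1 ltr01 s0.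
  have := Jk_den2 z1' ltr01 s0; rewrite mul1r => a b c.
  by rewrite !lt0r_neq0.
have K1 : r * K z <= K z'.
  rewrite -seg_intZl; last by apply: kc => //; exact: ltW.
  apply: seg_int_le; [|by apply: kc => //; exact: ltW|].
    move=> s sT; apply: cvgM; first exact: cvg_cst.
    by apply: (kc z T' T) => //; exact: ltW.
  move=> s; rewrite in_itv/= => /andP[sT _].
  have s0 : 0 <= s by rewrite (le_trans (ltW T0')).
  rewrite kr// ler_wpM2r ?k0// /r ler_pdivrMr; last lra.
  rewrite mulrAC ler_pdivlMr; last lra.
  have := mulr_ge0 (_ : 0 <= z' - z) (_ : 0 <= s - T'); rewrite !subr_ge0.
  by move=> /(_ zz' sT); lra.
have J1 : J e T' z' <= r * J e T' z.
  rewrite !J_scale// -seg_intZl; last by apply: kc.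
  apply: seg_int_le; [by apply: kc| |].
    by move=> s sT; apply: cvgM; [exact: cvg_cst|exact: (kc z 0 T')].
  move=> s; rewrite in_itv/= => /andP[s0 sT].
  rewrite -![2 * s / _]/(k _ s) kr// ler_wpM2r ?k0// /r ler_pdivrMr; last lra.
  rewrite mulrAC ler_pdivlMr; last lra.
  have := mulr_ge0 (_ : 0 <= z' - z) (_ : 0 <= T' - s); rewrite !subr_ge0.
  by move=> /(_ zz' sT); lra.
have Kz0 : 0 <= K z.
  apply: Rintegral_ge0 => s /=; rewrite in_itv/= => /andP[sT _].
  by apply: k0 => //; rewrite (le_trans (ltW T0')).
have Jz0 := ltW (J_gt0 e1 T0' z1).
rewrite !JS// !mulrDr; apply: lerD; first by rewrite mulrC.
apply: (@le_trans _ _ (r * J e T' z * K z)); first by rewrite ler_wpM2r.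
by rewrite mulrAC mulrC ler_wpM2l.
Qed.

Definition dJ e T z : R := \int[mu]_(t in `[0, 1])
  (- (Jk e T z t / (1 + z + T * t))).

Lemma J_derive e T z : `|e| < 1 -> 0 < T -> -1 < z ->
  is_derive z 1 (J e T) (dJ e T z).
Proof.
move=> e1 T0 z1; have [r rE] : exists r, r = (1 + z) / 2 by exists ((1 + z) / 2).
have r0 : 0 < r by lra.
pose C := 2 * (T * T) / ((1 - e * e) * (r * r * r)).
have e20 : 0 < 1 - e * e.
  by have := Jk_den1 e1 T0 (lexx 0); rewrite mulr0 addr0 mulr1.
apply: (@is_derive_seg_int _ (Jk e T)
  (fun z t => - (Jk e T z t / (1 + z + T * t))) 0 1 z C r) => //.
- move=> y; rewrite ltr_norml => /andP[y1 _]; apply: Jk_continuous => //.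
  lra.
- move=> t; rewrite in_itv/= => /andP[t0 t1].
  apply: cvgN; apply: cvgM.
    by apply: (Jk_continuous e1 T0 z1); rewrite in_itv/= t0.
  by cvg_arith; rewrite lt0r_neq0// Jk_den2.
move=> y yr t; rewrite in_itv/= => /andP[t0 t1].
have yr' : r < 1 + y by move: yr; rewrite ltr_norml; lra.
have d1 := Jk_den1 e1 T0 t0; have d2 := Jk_den2 z1 T0 t0.
have Tt : 0 <= T * t by rewrite mulr_ge0// ltW.
have d3 : 0 < 1 + y + T * t by lra.
have -> : Jk e T y t - Jk e T z t - (y - z) * - (Jk e T z t / (1 + z + T * t)) =
  2 * (T * T) * t / (((1 + T * t) * (1 + T * t) - e * e) *
   ((1 + z + T * t) * (1 + z + T * t) * (1 + y + T * t))) * (y - z) ^+ 2.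
  by rewrite /Jk; field; rewrite !lt0r_neq0.
rewrite normrM (ger0_norm (sqr_ge0 _)) ler_wpM2r ?sqr_ge0// ger0_norm; last first.
  by rewrite divr_ge0// !mulr_ge0// ltW.
rewrite /C; apply: ler_pM.
- by rewrite !mulr_ge0// ltW.
- by rewrite invr_ge0 !mulr_ge0// ltW.
- by rewrite -[leRHS]mulr1 ler_wpM2l// !mulr_ge0// ltW.
apply: inv_le; first by rewrite !mulr_gt0.
have rr : r * r <= (1 + z + T * t) * (1 + z + T * t) by apply: ler_pM; lra.
apply: ler_pM; [exact: ltW| |by have := mulr_ge0 Tt Tt; lra|].
  by rewrite !mulr_ge0// ltW.
by apply: ler_pM => //; [rewrite mulr_ge0// ltW|exact: ltW|lra].
Qed.

Lemma int_log T u : 0 < T -> 0 < u ->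
  \int[mu]_(t in `[0, 1]) (T * T * t / (u + T * t)) = T + u * ln (u / (u + T)).
Proof.
move=> T0 u0.
have pos t : 0 <= t -> 0 < u + T * t.
  by move=> t0; have := mulr_ge0 (ltW T0) t0; lra.
rewrite (@seg_FTC2 R 0 1 _ (fun t => T * t - u * ln (u + T * t)) ler01).
- rewrite !mulr0 !mulr1 addr0 ln_div ?posrE//; [ring|lra].
- move=> t; rewrite in_itv/= => /andP[t0 t1].
  by cvg_arith; rewrite lt0r_neq0 ?pos.
- move=> t; rewrite in_itv/= => /andP[t0 t1].
  have d0 := pos _ t0.
  have dl : is_derive t 1 (fun t => ln (u + T * t)) ((u + T * t)^-1 * T).
    apply: (@is_derive1_comp _ (@ln R) (fun t : R => u + T * t)).
      exact: is_derive1_ln.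
    apply: is_derive_eq; rewrite /GRing.scale/=; ring.
  apply: is_derive_eq; rewrite /GRing.scale/=; field; by rewrite lt0r_neq0.
Qed.

(* Partial fractions: the left-hand side is the error of interpolating
   [u |-> T + u * ln (u / (u + T))] linearly at [1 - e] and [1 + e]. *)
Lemma J_interpolation e T : `|e| < 1 -> 0 < T ->
  exists al be : R, forall z, -1 < z ->
  (z * z - e * e) * J e T z / 2 =
  T + (1 + z) * ln ((1 + z) / (1 + z + T)) - al - be * z.
Proof.
move=> e1 T0.
pose A t := T * T * t * (1 + T * t) / ((1 + T * t) * (1 + T * t) - e * e).
pose B t := - (T * T * t / ((1 + T * t) * (1 + T * t) - e * e)).
exists (\int[mu]_(t in `[0, 1]) A t), (\int[mu]_(t in `[0, 1]) B t) => z z1.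
have d1 t (t0 : 0 <= t) := Jk_den1 e1 T0 t0.
have d2 t (t0 : 0 <= t) := Jk_den2 z1 T0 t0.
have cA : {in `[0, 1]%R, continuous A}.
  by move=> t; rewrite in_itv/= => /andP[t0 _]; rewrite /A; cvg_arith;
    rewrite lt0r_neq0 ?d1.
have cB : {in `[0, 1]%R, continuous B}.
  by move=> t; rewrite in_itv/= => /andP[t0 _]; rewrite /B; cvg_arith;
    rewrite lt0r_neq0 ?d1.
have cC : {in `[0, 1]%R, continuous (fun t => T * T * t / (1 + z + T * t))}.
  by move=> t; rewrite in_itv/= => /andP[t0 _]; cvg_arith;
    rewrite lt0r_neq0 ?d2.
have cJ := Jk_continuous e1 T0 z1.
rewrite -int_log//; last lra.
rewrite [\int[mu]_(t in _) B t * z]mulrC -(seg_intZl z cB) -(seg_intB cC cA).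
have cCA : {in `[0, 1]%R, continuous (fun t => T * T * t / (1 + z + T * t) - A t)}.
  by move=> t t01; apply: cvgB; [exact: cC|exact: cA].
have czB : {in `[0, 1]%R, continuous (fun t => z * B t)}.
  by move=> t t01; apply: cvgM; [exact: cvg_cst|exact: cB].
rewrite -(seg_intB cCA czB).
rewrite mulrAC -seg_intZl//; apply: eq_seg_int => t; rewrite in_itv/=.
move=> /andP[t0 _]; have h1 := d1 _ t0; have h2 := d2 _ t0.
by rewrite /Jk /A /B; field; rewrite !lt0r_neq0.
Qed.

(** The bound does not degenerate as |e| tends to 1. The denominator factors as (1 - |e| + T t)(1 +
    |e| + T t)(1 + z + T t), and up to 4 T the numerator is the product of T t, (|e| - z) / 2 and
    |e| + z, each at most its counterpart. *)
Lemma J_energy_bound e T z : `|e| < 1 -> 0 < T -> `|z| <= `|e| ->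
  (e * e - z * z) * J e T z <= 4 * T.
Proof.
move=> e1 T0 ze.
have a0 := normr_ge0 e.
have := ze; rewrite ler_norml => /andP[ze1 ze2].
have z1 : -1 < z by lra.
have ee : e * e = `|e| * `|e| by rewrite -!expr2 real_normK ?num_real.
have -> : 4 * T = 4 * T * (1 - 0) by ring.
rewrite -[leRHS](@seg_int_cst _ 0 1)// -seg_intZl; last exact: Jk_continuous.
apply: seg_int_le => //.
- by move=> t t01; apply: cvgM; [exact: cvg_cst|exact: (Jk_continuous e1 T0 z1)].
- by move=> t _; exact: cvg_cst.
move=> t; rewrite in_itv/= => /andP[t0 t1].
have d1 := Jk_den1 e1 T0 t0; have d2 := Jk_den2 z1 T0 t0.
have Tt : 0 <= T * t by rewrite mulr_ge0// ltW.
rewrite /Jk ee in d1 *.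
rewrite mulrA ler_pdivrMr ?mulr_gt0//.
have -> : (1 + T * t) * (1 + T * t) - `|e| * `|e| =
  (1 - `|e| + T * t) * (1 + `|e| + T * t) by ring.
have -> : (`|e| * `|e| - z * z) * (2 * (T * T) * t) =
  4 * T * ((T * t) * (((`|e| - z) / 2) * (`|e| + z))) by field.
rewrite ler_wpM2l//; first lra.
rewrite -[leRHS]mulrA; apply: ler_pM => //; [|lra|].
  by rewrite !mulr_ge0//; lra.
by apply: ler_pM; lra.
Qed.

End J.

(** * Period *)

Section period.
Context {R : realType}.
Notation mu := (@lebesgue_measure R).
Variables (g k0 : R).
Hypotheses (hg : 0 < g) (hk0 : 0 < k0).
Implicit Types (e T q z t : R).

(* Normalized so that [q] is the minimum of [Q] on [- |e|, |e|]. *)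
Definition Q e T q z : R := (g + q) * (J e T z * (J e T `|e|)^-1) - g.
Definition W e T q z : R := (Num.sqrt (Q e T q z))^-1.

Lemma abs_z_gtN1 e z : `|e| < 1 -> `|z| <= `|e| -> -1 < z.
Proof. by move=> e1; rewrite ler_norml => /andP[]; lra. Qed.

Lemma abs_e_gtN1 e : -1 < `|e|.
Proof. by have := normr_ge0 e; lra. Qed.

Lemma abs_ecos e t : `|e * cos t| <= `|e|.
Proof.
rewrite normrM -[leRHS]mulr1 ler_wpM2l// ler_norml.
by rewrite cos_geN1 cos_le1.
Qed.

Lemma Q_ge e T q z : `|e| < 1 -> 0 < T -> 0 < q -> `|z| <= `|e| ->
  q <= Q e T q z.
Proof.
move=> e1 T0 q0 ze; have z1 := abs_z_gtN1 e1 ze.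
have J0 := J_gt0 e1 T0 (abs_e_gtN1 e).
have : 1 <= J e T z * (J e T `|e|)^-1.
  rewrite ler_pdivlMr// mul1r J_ltr//.
  by move: ze; rewrite ler_norml => /andP[].
have gq : 0 < g + q by rewrite addr_gt0.
rewrite -(ler_pM2l gq) mulr1 /Q; lra.
Qed.

Lemma Q_gt0 e T q z : `|e| < 1 -> 0 < T -> 0 < q -> `|z| <= `|e| ->
  0 < Q e T q z.
Proof. by move=> e1 T0 q0 ze; exact: lt_le_trans q0 (Q_ge e1 T0 q0 ze). Qed.

Lemma Q_lt e T q q' z : `|e| < 1 -> 0 < T -> `|z| <= `|e| -> q < q' ->
  Q e T q z < Q e T q' z.
Proof.
move=> e1 T0 ze qq'; have z1 := abs_z_gtN1 e1 ze.
have J0 := J_gt0 e1 T0 (abs_e_gtN1 e).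
have : 0 < J e T z * (J e T `|e|)^-1 by rewrite divr_gt0// J_gt0.
by move=> c0; rewrite /Q ltrD2r ltr_pM2r// ltrD2l.
Qed.

Lemma Q_decr e T q z z' : `|e| < 1 -> 0 < T -> 0 < q -> -1 < z -> z <= z' ->
  Q e T q z' <= Q e T q z.
Proof.
move=> e1 T0 q0 z1 zz'.
have J0 := J_gt0 e1 T0 (abs_e_gtN1 e).
rewrite /Q lerD2r ler_pM2l ?addr_gt0// ler_pM2r ?invr_gt0//.
exact: J_ltr.
Qed.

Lemma Q_cvg (Y : topologicalType) (y0 : Y) (fe fT fq fz : Y -> R) e T q z :
  `|e| < 1 -> 0 < T -> -1 < z ->
  fe y @[y --> y0] --> e -> fT y @[y --> y0] --> T ->
  fq y @[y --> y0] --> q -> fz y @[y --> y0] --> z ->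
  Q (fe y) (fT y) (fq y) (fz y) @[y --> y0] --> Q e T q z.
Proof.
move=> e1 T0 z1 he hT hq hz; rewrite /Q.
have h1 := J_cvg e1 T0 z1 he hT hz.
have h2 : J (fe y) (fT y) `|fe y| @[y --> y0] --> J e T `|e|.
  by apply: J_cvg => //; [exact: abs_e_gtN1|exact: cvR_norm].
cvg_arith; exact: lt0r_neq0 (J_gt0 e1 T0 (abs_e_gtN1 e)).
Qed.

Lemma W_gt0 e T q z : `|e| < 1 -> 0 < T -> 0 < q -> `|z| <= `|e| ->
  0 < W e T q z.
Proof. by move=> e1 T0 q0 ze; rewrite invr_gt0 sqrtr_gt0 Q_gt0. Qed.

Lemma W_cvg (Y : topologicalType) (y0 : Y) (fe fT fq fz : Y -> R) e T q z :
  `|e| < 1 -> 0 < T -> 0 < q -> `|z| <= `|e| ->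
  fe y @[y --> y0] --> e -> fT y @[y --> y0] --> T ->
  fq y @[y --> y0] --> q -> fz y @[y --> y0] --> z ->
  W (fe y) (fT y) (fq y) (fz y) @[y --> y0] --> W e T q z.
Proof.
move=> e1 T0 q0 ze he hT hq hz; rewrite /W.
have h := Q_cvg e1 T0 (abs_z_gtN1 e1 ze) he hT hq hz.
by cvg_arith; rewrite lt0r_neq0// sqrtr_gt0 Q_gt0.
Qed.

Lemma W_le e T q q' z : `|e| < 1 -> 0 < T -> 0 < q -> `|z| <= `|e| ->
  q < q' -> W e T q' z < W e T q z.
Proof.
move=> e1 T0 q0 ze qq'; have q0' := lt_trans q0 qq'.
rewrite ltf_pV2 ?posrE ?sqrtr_gt0 ?Q_gt0//.
by rewrite ltr_sqrt ?Q_gt0// Q_lt.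
Qed.

Lemma W_incr e T q z z' : `|e| < 1 -> 0 < T -> 0 < q -> `|z| <= `|e| ->
  `|z'| <= `|e| -> z <= z' -> W e T q z <= W e T q z'.
Proof.
move=> e1 T0 q0 ze ze' zz'; apply: inv_le; first by rewrite sqrtr_gt0 Q_gt0.
by rewrite ler_wsqrtr// Q_decr// (abs_z_gtN1 e1 ze).
Qed.

Lemma Wcos_continuous e T q : `|e| < 1 -> 0 < T -> 0 < q ->
  continuous (fun t => W e T q (e * cos t)).
Proof.
move=> e1 T0 q0 t; apply: W_cvg => //; [exact: abs_ecos|exact: cvg_cst..|].
by cvg_arith.
Qed.

Definition P e T q : R := \int[mu]_(t in `[0, pi]) W e T q (e * cos t).

Lemma P_cvg (Y : topologicalType) (y0 : Y) (fe fT fq : Y -> R) e T q :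
  `|e| < 1 -> 0 < T -> 0 < q ->
  fe y @[y --> y0] --> e -> fT y @[y --> y0] --> T -> fq y @[y --> y0] --> q ->
  P (fe y) (fT y) (fq y) @[y --> y0] --> P e T q.
Proof.
move=> e1 T0 q0 he hT hq.
pose G (p : R * R * R) t := W p.1.1 p.1.2 p.2 (p.1.1 * cos t).
have cG : (\int[mu]_(t in `[0, pi]) G p t) @[p --> (e, T, q)] -->
    \int[mu]_(t in `[0, pi]) G (e, T, q) t.
  apply: seg_int_continuous; first exact: pi_ge0.
    move=> t _; rewrite /G/=; apply: W_cvg => //; first exact: abs_ecos.
    all: cvg_arith.
  near=> p => t _; apply: Wcos_continuous.
  - near: p; have h : `|p.1.1| @[p --> (e, T, q)] --> `|e| by cvg_arith.
    exact: (cvgr_lt _ h).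
  - near: p; have h : p.1.2 @[p --> (e, T, q)] --> T by cvg_arith.
    exact: (cvgr_gt _ h).
  - near: p; have h : p.2 @[p --> (e, T, q)] --> q by cvg_arith.
    exact: (cvgr_gt _ h).
have h : (fe y, fT y, fq y) @[y --> y0] --> (e, T, q).
  by apply: cvg_to_pair => //; exact: cvg_to_pair.
exact: cvg_comp h cG.
Unshelve. all: by end_near. Qed.

Lemma P_lt e T q q' : `|e| < 1 -> 0 < T -> 0 < q -> q < q' -> P e T q' < P e T q.
Proof.
move=> e1 T0 q0 qq'; have q0' := lt_trans q0 qq'.
apply: seg_int_lt; [exact: pi_gt0| | |].
- by move=> t _; exact: Wcos_continuous.
- by move=> t _; exact: Wcos_continuous.
- by move=> t _; apply: W_le => //; exact: abs_ecos.
Qed.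

Lemma JN e T z : J (- e) T z = J e T z.
Proof. by apply: eq_seg_int => t _; rewrite /Jk mulrNN. Qed.

Lemma WN e T q z : W (- e) T q z = W e T q z.
Proof. by rewrite /W /Q normrN !JN. Qed.

(** Replacing t by pi - t exchanges the orbits of [e] and [- e]. *)
Lemma PN e T q : `|e| < 1 -> 0 < T -> 0 < q -> P (- e) T q = P e T q.
Proof.
move=> e1 T0 q0; rewrite /P -seg_int_reflect; last 2 first.
- exact: pi_ge0.
- by apply: Wcos_continuous => //; rewrite normrN.
apply: eq_seg_int => t _.
by rewrite WN cosB cospi sinpi; congr W; ring.
Qed.

Lemma P_ub e T q : `|e| < 1 -> 0 < T -> 0 < q -> P e T q <= pi / Num.sqrt q.
Proof.
move=> e1 T0 q0; apply: le_trans (ler_norm _) _.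
rewrite mulrC -[X in _ * X]subr0; apply: seg_int_norm_le; first exact: pi_ge0.
  by move=> t _; exact: Wcos_continuous.
move=> t _; rewrite ger0_norm; last by rewrite ltW// W_gt0// abs_ecos.
apply: inv_le; first by rewrite sqrtr_gt0.
by rewrite ler_wsqrtr// Q_ge// abs_ecos.
Qed.

Lemma sin_norm_le (x : R) : 0 <= x -> `|sin x| <= x.
Proof.
move=> x0; have := @derive_mvt_le R 0 x sin cos 1 x0.
rewrite sin0 subr0 mul1r subr0; apply.
- by move=> y _; exact: is_derive_sin.
- by move=> y _; rewrite ler_norml cos_geN1 cos_le1.
Qed.

Lemma cos_lb (x : R) : 0 <= x -> 1 - cos x <= x * x.
Proof.
move=> x0; have := @derive_mvt_le R 0 x cos (fun y => - sin y) x x0.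
rewrite cos0 subr0 distrC => h; apply: le_trans (ler_norm _) _; apply: h.
- by move=> y _; exact: is_derive_cos.
- move=> y; rewrite in_itv/= normrN => /andP[y0 yx].
  exact: le_trans (sin_norm_le y0) yx.
Qed.

Lemma Q_ub e T q z : `|e| < 1 -> 0 < T -> 0 < q -> `|z| <= `|e| ->
  Q e T q z <= q + (g + q) / (1 - `|e|) * (`|e| - z).
Proof.
move=> e1 T0 q0 ze; have z1 := abs_z_gtN1 e1 ze.
have J0 := J_gt0 e1 T0 (abs_e_gtN1 e).
have := ze; rewrite ler_norml => /andP[ze1 ze2].
have gq : 0 < g + q by rewrite addr_gt0.
have h : J e T z * (J e T `|e|)^-1 <= 1 + (`|e| - z) / (1 - `|e|).
  rewrite ler_pdivrMr//; apply: le_trans (J_ratio_le e1 T0 z1 ze2) _.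
  rewrite ler_pM2r// lerD2l ler_wpM2l//; first lra.
  by apply: inv_le; lra.
rewrite /Q; have := ler_wpM2l (ltW gq) h.
have -> : (g + q) * (1 + (`|e| - z) / (1 - `|e|)) =
  g + q + (g + q) / (1 - `|e|) * (`|e| - z) by ring.
lra.
Qed.

(* As [q -> 0] the orbit approaches a homoclinic one and the period diverges
   logarithmically. *)
Lemma P_large e T l : `|e| < 1 -> 0 < T ->
  exists2 q, 0 < q & l < P e T q.
Proof.
wlog e0 : e / 0 <= e.
  move=> h e1 T0; have [/h|/ltW e0] := leP 0 e; first exact.
  have [|||q q0] := h (- e); rewrite ?normrN ?oppr_ge0//.
  by rewrite PN// => lP; exists q.
move=> e1 T0; have ae : `|e| = e by rewrite ger0_norm.
rewrite ae in e1.
(* For q = r^2 with r <= 1, [Q_ub] gives Q <= r^2 + C t^2 <= (r + c t)^2 along the orbit, so the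
   period is at least the integral of 1 / (r + c t), which is ln((r + c pi) / r) / c. *)
pose C := (g + 1) / (1 - e).
have C0 : 0 < C by rewrite divr_gt0//; [rewrite addr_gt0|lra].
pose c := Num.sqrt C.
have c0 : 0 < c by rewrite sqrtr_gt0.
have cc : c * c = C by rewrite -expr2 sqr_sqrtr// ltW.
have pi0 : 0 < pi :> R by exact: pi_gt0.
(* Makes that logarithm exceed c l; the cap 1 bounds g + q by g + 1. *)
pose r := Num.min 1 (expR (ln (c * pi) - c * (l + 1))).
have r0 : 0 < r by rewrite lt_min ltr01 expR_gt0.
have r1 : r <= 1 by rewrite ge_min lexx.
have lr : ln r <= ln (c * pi) - c * (l + 1).
  rewrite -[leRHS]expRK ler_ln ?posrE ?expR_gt0//.
  by rewrite ge_min lexx orbT.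
exists (r * r); first by rewrite mulr_gt0.
have rr1 : r * r <= 1 by rewrite -[leRHS]mulr1 ler_pM// ltW.
have pos t : 0 <= t -> 0 < r + c * t.
  by move=> t0; have := mulr_ge0 (ltW c0) t0; lra.
have cI : {in `[0, pi]%R, continuous (fun t => (r + c * t)^-1)}.
  move=> t; rewrite in_itv/= => /andP[t0 _]; cvg_arith.
  by rewrite lt0r_neq0// pos.
apply: (@lt_le_trans _ _ (\int[mu]_(t in `[0, pi]) (r + c * t)^-1)); last first.
  apply: seg_int_le => //.
    by move=> t _; apply: Wcos_continuous => //; rewrite ?ae// mulr_gt0.
  move=> t; rewrite in_itv/= => /andP[t0 tpi].
  have Q0 : 0 < Q e T (r * r) (e * cos t).
    by rewrite Q_gt0 ?ae ?mulr_gt0// -[leRHS]ae abs_ecos.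
  apply: inv_le; first by rewrite sqrtr_gt0.
  have -> : r + c * t = Num.sqrt ((r + c * t) ^+ 2).
    by rewrite sqrtr_sqr gtr0_norm// pos.
  rewrite ler_wsqrtr// expr2.
  apply: le_trans (Q_ub _ _ _ _) _ => //; rewrite ?ae ?mulr_gt0//.
    by rewrite -[leRHS]ae abs_ecos.
  have h1 : (g + r * r) / (1 - e) <= C.
    by rewrite ler_pM2r ?invr_gt0; lra.
  have h2 : e - e * cos t <= t * t.
    have := cos_lb t0; have := cos_le1 t.
    have : 0 <= (1 - e) * (1 - cos t).
      by rewrite mulr_ge0//; have := cos_le1 t; lra.
    lra.
  have h3 : 0 <= e - e * cos t.
    by rewrite -{1}[e]mulr1 -mulrBr mulr_ge0// subr_ge0 cos_le1.
  have := ler_pM (_ : 0 <= (g + r * r) / (1 - e)) h3 h1 h2.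
  have -> : 0 <= (g + r * r) / (1 - e).
    by rewrite divr_ge0//; [rewrite ltW// addr_gt0// mulr_gt0|lra].
  move=> /(_ isT); rewrite -cc.
  have := mulr_ge0 (ltW r0) (mulr_ge0 (ltW c0) t0).
  lra.
rewrite (@seg_FTC2 R 0 pi _ (fun t => c^-1 * ln (r + c * t)))//; last 2 first.
- exact: ltW.
- move=> t; rewrite in_itv/= => /andP[t0 tpi]; have d0 := pos _ t0.
  have dl : is_derive t 1 (fun t => ln (r + c * t)) ((r + c * t)^-1 * c).
    apply: (@is_derive1_comp _ (@ln R) (fun t : R => r + c * t)).
      exact: is_derive1_ln.
    apply: is_derive_eq; rewrite /GRing.scale/=; ring.
  apply: is_derive_eq; rewrite /GRing.scale/=; field.
  by rewrite !lt0r_neq0.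
rewrite mulr0 addr0 -mulrBr ltr_pdivlMl//.
have : ln (c * pi) <= ln (r + c * pi).
  rewrite ler_ln ?posrE ?mulr_gt0//; last by rewrite pos// ltW.
  by rewrite lerDr ltW.
lra.
Qed.

Lemma q_exists e T : `|e| < 1 -> 0 < T ->
  exists q, 0 < q /\ P e T q = pi / k0.
Proof.
move=> e1 T0; have [q1 q10 Pq1] := P_large (pi / k0) e1 T0.
(* Adding [k0 * k0] brings the bound pi / sqrt q of [P_ub] below pi / k0. *)
pose q2 := q1 + k0 * k0.
have q12 : q1 <= q2 by rewrite lerDl mulr_ge0// ltW.
have Pq2 : P e T q2 <= pi / k0.
  apply: le_trans (P_ub e1 T0 _) _; first exact: lt_le_trans q12.
  rewrite ler_wpM2l ?pi_ge0//; apply: inv_le => //.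
  rewrite -[leLHS]gtr0_norm// -sqrtr_sqr ler_wsqrtr// expr2 lerDr ltW//.
have cP : {in `[q1, q2]%R, continuous (P e T)}.
  move=> q; rewrite in_itv/= => /andP[q1q _].
  by apply: P_cvg => //; cvg_arith; exact: lt_le_trans q1q.
have [|q qq Pq] := IVT q12 (in_continuous_within cP) (v := pi / k0).
  by rewrite ge_min le_max Pq2 (ltW Pq1) orbT.
exists q; split => //; move: qq; rewrite in_itv/= => /andP[q1q _].
exact: lt_le_trans q1q.
Qed.

Definition qs e T : R := get [set q | 0 < q /\ P e T q = pi / k0].

Lemma qsP e T : `|e| < 1 -> 0 < T -> 0 < qs e T /\ P e T (qs e T) = pi / k0.
Proof. by move=> e1 T0; exact: getPex (q_exists e1 T0). Qed.

Lemma qs_cvg (Y : topologicalType) (y0 : Y) (fe fT : Y -> R) e T :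
  `|e| < 1 -> 0 < T ->
  fe y @[y --> y0] --> e -> fT y @[y --> y0] --> T ->
  qs (fe y) (fT y) @[y --> y0] --> qs e T.
Proof.
move=> e1 T0 he hT.
pose G (p : R * R) u := pi / k0 - P p.1 p.2 u.
have cq : qs p.1 p.2 @[p --> (e, T)] --> qs e T.
  have [q0 Pq] := qsP e1 T0.
  have near_dom : \forall p \near (e, T), `|p.1| < 1 /\ 0 < p.2.
    near=> p; split; near: p.
    - have h : `|p.1| @[p --> (e, T)] --> `|e| by cvg_arith.
      exact: (cvgr_lt _ h).
    - have h : p.2 @[p --> (e, T)] --> T by cvg_arith.
      exact: (cvgr_gt _ h).
  apply: (@implicit_monotone_continuous _ _ G (fun p => qs p.1 p.2)) => //=.
  - by rewrite /G/= Pq subrr.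
  - apply: filterS near_dom => p [p1 p2]; have [? Pp] := qsP p1 p2.
    by rewrite /G Pp subrr.
  - apply: filterS near_dom => p [p1 p2] u v u0 uv.
    by rewrite /G ltrD2l ltrN2 P_lt.
  - move=> u u0; rewrite /G; cvg_arith.
    by apply: P_cvg => //; cvg_arith.
have h : (fe y, fT y) @[y --> y0] --> (e, T) by exact: cvg_to_pair.
exact: cvg_comp h cq.
Unshelve. all: by end_near. Qed.

End period.

Lemma sqrt_inj_gt0 (R : rcfType) (x y : R) : 0 < x -> 0 < y ->
  Num.sqrt x = Num.sqrt y -> x = y.
Proof.
by move=> x0 y0 h; rewrite -(sqr_sqrtr (ltW x0)) h sqr_sqrtr// ltW.
Qed.

Lemma sub_affine_lt (R : realFieldType) (c A B u v : R) : 0 < c -> B <= A ->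
  u < v -> u - (1 + A * c) < v - (1 + B * c).
Proof. by move=> c0 /(ler_wpM2r (ltW c0)) h uv; lra. Qed.

(** * Mean value *)

Section mean.
Context {R : realType}.
Notation mu := (@lebesgue_measure R).
Variables (g k0 : R).
Hypotheses (hg : 0 < g) (hk0 : 0 < k0).
Implicit Types (e T q z t : R).

Local Notation Q := (Q g).
Local Notation W := (W g).
Local Notation P := (P g).
Local Notation qs := (qs g k0).

(** The integral of z over half a period, since dx = W dt. *)
Definition N e T : R := \int[mu]_(t in `[0, pi]) (e * cos t * W e T (qs e T) (e * cos t)).

Lemma zW_continuous e T q : `|e| < 1 -> 0 < T -> 0 < q ->
  continuous (fun t => e * cos t * W e T q (e * cos t)).
Proof.
move=> e1 T0 q0 t; have h := Wcos_continuous hg e1 T0 q0.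
apply: cvgM; last exact: h.
by cvg_arith.
Qed.

Lemma int_cos_pi : \int[mu]_(t in `[0, pi]) cos t = 0.
Proof.
rewrite (@seg_FTC2 R 0 pi _ sin (pi_ge0 R)).
- by rewrite sinpi sin0 subrr.
- by move=> t _; cvg_arith.
- by move=> t _; exact: is_derive_sin.
Qed.

(** [W] is nondecreasing in z, so z W(z) >= z W(0) for either sign of z, and the cosine has zero
    integral: the orbit spends more time at large z. *)
Lemma N_ge0 e T : `|e| < 1 -> 0 < T -> 0 <= N e T.
Proof.
move=> e1 T0; have [q0 _] := qsP hg hk0 e1 T0.
have z0 : `|0 : R| <= `|e| by rewrite normr0.
have cc : {in `[0, pi]%R, continuous (fun t => W e T (qs e T) 0 * e * cos t)}.
  by move=> t _; cvg_arith.
have <- : \int[mu]_(t in `[0, pi]) (W e T (qs e T) 0 * e * cos t) = 0.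
  by rewrite seg_intZl ?int_cos_pi ?mulr0// => t _; cvg_arith.
apply: seg_int_le => //; first by move=> t _; exact: zW_continuous.
move=> t _; have zt := abs_ecos e t.
rewrite -mulrA mulrC.
have [zp|zn] := leP 0 (e * cos t).
  by rewrite ler_wpM2l// W_incr.
apply: ler_wnM2l; first exact: ltW.
by apply: W_incr => //; exact: ltW.
Qed.

Lemma N_le e T : `|e| < 1 -> 0 < T -> N e T <= `|e| * (pi / k0).
Proof.
move=> e1 T0; have [q0 Pq] := qsP hg hk0 e1 T0.
have cW : {in `[0, pi]%R, continuous (fun t => W e T (qs e T) (e * cos t))}.
  by move=> t _; exact: Wcos_continuous.
rewrite -Pq -seg_intZl//; apply: seg_int_le.
- by move=> t _; exact: zW_continuous.
- by move=> t ?; apply: cvgM; [exact: cvg_cst|exact: cW].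
- move=> t _; rewrite ler_wpM2r//.
    by rewrite ltW// W_gt0// abs_ecos.
  exact: le_trans (ler_norm _) (abs_ecos _ _).
Qed.

(** Each profile of [Q] is an affine function of [J] with positive slope, so [J_cross] fixes the
    order of two profiles on either side of a point where they agree. *)
Lemma Q_cross e T T' q q' z z0 : `|e| < 1 -> 0 < T' -> T' <= T ->
  0 < q -> 0 < q' -> `|z| <= `|e| -> `|z0| <= `|e| ->
  Q e T' q' z0 = Q e T q z0 ->
  (z <= z0 -> Q e T q z <= Q e T' q' z) /\
  (z0 <= z -> Q e T' q' z <= Q e T q z).
Proof.
move=> e1 T0' TT' q0 q0' ze ze0; have T0 := lt_le_trans T0' TT'.
have z1 := abs_z_gtN1 e1 ze; have z01 := abs_z_gtN1 e1 ze0.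
have Je := J_gt0 e1 T0 (abs_e_gtN1 e); have Je' := J_gt0 e1 T0' (abs_e_gtN1 e).
have AE r S y : Q e S r y = (g + r) / J e S `|e| * J e S y - g.
  by rewrite /Q; ring.
rewrite !AE => /addIr; set A' := (g + q') / _; set A := (g + q) / _ => E.
have A0 : 0 < A by rewrite divr_gt0// addr_gt0.
have A0' : 0 < A' by rewrite divr_gt0// addr_gt0.
have J0 := J_gt0 e1 T0 z01.
rewrite !lerD2r; split=> h.
- rewrite -(ler_pM2r J0) mulrAC -E mulrAC.
  by have j := ler_wpM2l (ltW A0') (J_cross e1 T0' TT' z1 h); clear -j; lra.
- rewrite -(ler_pM2r J0) [leRHS]mulrAC -E [leRHS]mulrAC.
  by have j := ler_wpM2l (ltW A0') (J_cross e1 T0' TT' z01 h); clear -j; lra.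
Qed.

(** Both weights have the same integral, the half period, so their difference [D] has zero mean and
    vanishes at some [t0], with z = z0 there. By [Q_cross] the product (z - z0) D is nonnegative, so
    the integral of z D is at least z0 times that of [D], which is 0. *)
Lemma N_antitone e T T' : `|e| < 1 -> 0 < T' -> T' <= T -> N e T <= N e T'.
Proof.
move=> e1 T0' TT'; have T0 := lt_le_trans T0' TT'.
have [q0 Pq] := qsP hg hk0 e1 T0; have [q0' Pq'] := qsP hg hk0 e1 T0'.
set q := qs e T in q0 Pq; set q' := qs e T' in q0' Pq'.
pose D t := W e T' q' (e * cos t) - W e T q (e * cos t).
have cD : continuous D.
  by move=> t; apply: cvgB; [exact: (Wcos_continuous hg e1 T0' q0')
    |exact: (Wcos_continuous hg e1 T0 q0)].
have D0 : \int[mu]_(t in `[0, pi]) D t = 0.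
  rewrite seg_intB; last 2 first.
  - by move=> t _; exact: Wcos_continuous.
  - by move=> t _; exact: Wcos_continuous.
  by rewrite -[X in X - _]/(P e T' q') -[X in _ - X]/(P e T q) Pq Pq' subrr.
have [t0 Dt0] : exists t0, D t0 = 0.
  have [F [F0 dF]] := antiderivative_exists cD.
  have [|t0 _] := @MVT_segment R F D 0 pi (pi_ge0 R) (fun x _ => dF x).
    by apply: in_continuous_within => x _; exact: is_derive_continuous (dF x).
  rewrite -(seg_FTC2 (pi_ge0 R) (f := D)) ?D0//.
  move=> /esym/eqP; rewrite subr0 mulf_eq0 (gt_eqF (pi_gt0 R)) orbF => /eqP.
  by exists t0.
pose z0 := e * cos t0.
have Q0 t T1 q1 : 0 < T1 -> 0 < q1 -> 0 < Q e T1 q1 (e * cos t).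
  by move=> *; rewrite Q_gt0 ?abs_ecos.
have Qz0 : Q e T' q' z0 = Q e T q z0.
  move: Dt0 => /eqP; rewrite subr_eq0 => /eqP /invr_inj.
  by apply: sqrt_inj_gt0; exact: Q0.
have key t : z0 * D t <= e * cos t * D t.
  have [h1 h2] := Q_cross e1 T0' TT' q0 q0' (abs_ecos e t) (abs_ecos e t0) Qz0.
  rewrite -subr_ge0 -mulrBl.
  have [tz|zt] := leP (e * cos t) z0.
    apply: mulr_le0; first by rewrite subr_le0.
    rewrite subr_le0; apply: inv_le; first by rewrite sqrtr_gt0 Q0.
    apply: ler_wsqrtr; apply: h1; exact: tz.
  apply: mulr_ge0; first by rewrite subr_ge0 ltW.
  rewrite subr_ge0; apply: inv_le; first by rewrite sqrtr_gt0 Q0.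
  apply: ler_wsqrtr; apply: h2; exact: ltW.
have c' := zW_continuous e1 T0' q0'; have c := zW_continuous e1 T0 q0.
rewrite -subr_ge0 /N -/q -/q' -(seg_intB (fun t _ => c' t) (fun t _ => c t)).
have I0 : \int[mu]_(t in `[0, pi]) (z0 * D t) = 0.
  by rewrite seg_intZl ?D0 ?mulr0// => t _; exact: cD.
rewrite -[leLHS]I0.
apply: seg_int_le.
- by move=> t _; apply: cvgM; [exact: cvg_cst|exact: cD].
- by move=> t _; apply: cvgB; [exact: c'|exact: c].
- by move=> t _; rewrite -mulrBr; exact: key.
Qed.

Lemma N_cvg (Y : topologicalType) (y0 : Y) (fe fT : Y -> R) e T :
  `|e| < 1 -> 0 < T ->
  fe y @[y --> y0] --> e -> fT y @[y --> y0] --> T ->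
  N (fe y) (fT y) @[y --> y0] --> N e T.
Proof.
move=> e1 T0 he hT.
pose G (p : R * R) t := p.1 * cos t * W p.1 p.2 (qs p.1 p.2) (p.1 * cos t).
have cG : (\int[mu]_(t in `[0, pi]) G p t) @[p --> (e, T)] -->
    \int[mu]_(t in `[0, pi]) G (e, T) t.
  have [q0 _] := qsP hg hk0 e1 T0.
  apply: seg_int_continuous; first exact: pi_ge0.
    move=> t _; rewrite /G/=; apply: cvgM; first by cvg_arith.
    apply: W_cvg => //; first exact: abs_ecos.
    - by cvg_arith.
    - by cvg_arith.
    - by apply: qs_cvg => //; cvg_arith.
    - by cvg_arith.
  near=> p => t _.
  have p1 : `|p.1| < 1.
    near: p; have h : `|p.1| @[p --> (e, T)] --> `|e| by cvg_arith.
    exact: (cvgr_lt _ h).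
  have p2 : 0 < p.2.
    near: p; have h : p.2 @[p --> (e, T)] --> T by cvg_arith.
    exact: (cvgr_gt _ h).
  by have [? _] := qsP hg hk0 p1 p2; exact: zW_continuous.
have h : (fe y, fT y) @[y --> y0] --> (e, T) by exact: cvg_to_pair.
exact: cvg_comp h cG.
Unshelve. all: by end_near. Qed.

Lemma kpK : k0 / pi * (pi / k0) = 1.
Proof. rewrite mulf_div [pi * k0]mulrC divff//.
by apply: mulf_neq0; apply: lt0r_neq0 => //; exact: pi_gt0. Qed.

Lemma Tm_exists e : `|e| < 1 ->
  exists T, 0 < T /\ T - (1 + N e T * (k0 / pi)) = 0.
Proof.
move=> e1; have pi0 := pi_gt0 R.
have kp : 0 < k0 / pi by rewrite divr_gt0.
have ae : 1 <= 1 + `|e| by rewrite lerDl.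
have cG : {in `[1, 1 + `|e|]%R, continuous (fun T => T - (1 + N e T * (k0 / pi)))}.
  move=> T; rewrite in_itv/= => /andP[T1 _]; cvg_arith.
  by apply: N_cvg => //; [exact: lt_le_trans T1|cvg_arith..].
(* The bounds 0 <= N <= |e| pi / k0 give opposite signs at the ends 1 and 1 + |e|. *)
have [|T] := IVT ae (in_continuous_within cG) (v := 0).
  rewrite ge_min le_max; apply/andP; split; apply/orP; [left|right].
    have := mulr_ge0 (N_ge0 e1 ltr01) (ltW kp); lra.
  have := N_le e1 (lt_le_trans ltr01 ae); rewrite -(ler_pM2r kp).
  rewrite -(mulrA `|e|) (mulrC (pi / k0)) kpK mulr1.
  lra.
rewrite in_itv/= => /andP[T1 _] h; exists T; split => //.
exact: lt_le_trans T1.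
Qed.

(* The mean of [h] is [1] exactly when the mean of [z] is [T - 1]. *)
Definition Tm e : R := get [set T | 0 < T /\ T - (1 + N e T * (k0 / pi)) = 0].

Lemma TmP e : `|e| < 1 -> 0 < Tm e /\ Tm e - (1 + N e (Tm e) * (k0 / pi)) = 0.
Proof. by move=> e1; exact: getPex (Tm_exists e1). Qed.

Lemma Tm_gt0 e : `|e| < 1 -> 0 < Tm e.
Proof. by case/TmP. Qed.

Lemma N_Tm e : `|e| < 1 -> N e (Tm e) = (Tm e - 1) * (pi / k0).
Proof.
move=> e1; have [_ /eqP] := TmP e1; rewrite subr_eq0 => /eqP h.
by rewrite [in RHS]h addrAC subrr add0r -mulrA kpK mulr1.
Qed.

Lemma Tm_ge1 e : `|e| < 1 -> 1 <= Tm e.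
Proof.
move=> e1; have [T0 /eqP] := TmP e1; rewrite subr_eq0 => /eqP h.
rewrite [leRHS]h lerDl; apply: mulr_ge0; first exact: N_ge0.
by rewrite divr_ge0 ?pi_ge0// ltW.
Qed.

Lemma Tm_le e : `|e| < 1 -> Tm e <= 1 + `|e|.
Proof.
move=> e1; have := N_le e1 (Tm_gt0 e1); rewrite N_Tm// ler_pM2r ?divr_gt0 ?pi_gt0//.
lra.
Qed.

Lemma Tm_cvg (Y : topologicalType) (y0 : Y) (fe : Y -> R) e : `|e| < 1 ->
  fe y @[y --> y0] --> e -> Tm (fe y) @[y --> y0] --> Tm e.
Proof.
move=> e1 he; have kp : 0 < k0 / pi by rewrite divr_gt0// pi_gt0.
have near_dom : \forall x \near e, `|x| < 1.
  have h : `|x| @[x --> e] --> `|e| by cvg_arith.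
  exact: (cvgr_lt _ h).
have cT : Tm x @[x --> e] --> Tm e.
  have [T0 hT] := TmP e1.
  apply: (@implicit_monotone_continuous _ _
    (fun x T => T - (1 + N x T * (k0 / pi))) Tm) => //.
  - by apply: filterS near_dom => x; exact: TmP.
  - apply: filterS near_dom => x x1 u v u0 uv.
    exact: sub_affine_lt kp (N_antitone x1 u0 (ltW uv)) uv.
  - by move=> u u0; cvg_arith; apply: N_cvg => //; cvg_arith.
exact: cvg_comp he cT.
Qed.

Definition qe e : R := qs e (Tm e).

Lemma qe_gt0 e : `|e| < 1 -> 0 < qe e.
Proof. by move=> e1; have [] := qsP hg hk0 e1 (Tm_gt0 e1). Qed.

Lemma P_qe e : `|e| < 1 -> P e (Tm e) (qe e) = pi / k0.
Proof. by move=> e1; have [] := qsP hg hk0 e1 (Tm_gt0 e1). Qed.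

Lemma qe_cvg (Y : topologicalType) (y0 : Y) (fe : Y -> R) e : `|e| < 1 ->
  fe y @[y --> y0] --> e -> qe (fe y) @[y --> y0] --> qe e.
Proof.
by move=> e1 he; apply: qs_cvg => //; [exact: Tm_gt0|exact: Tm_cvg].
Qed.

Lemma qe_le e : `|e| < 1 -> qe e <= k0 ^+ 2.
Proof.
move=> e1; have q0 := qe_gt0 e1.
have := P_ub hg e1 (Tm_gt0 e1) q0; rewrite P_qe// ler_pM2l ?pi_gt0//.
rewrite lef_pV2 ?posrE ?sqrtr_gt0// => h.
have -> : qe e = Num.sqrt (qe e) ^+ 2 by rewrite sqr_sqrtr// ltW.
by apply: lerXn2r => //; rewrite nnegrE ?sqrtr_ge0// ltW.
Qed.

(** The product of M and T, read off from Q = Mt J - g at z = |e|, where Q equals [qe]. *)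
Definition Mt e : R := (g + qe e) / J e (Tm e) `|e|.

Lemma QE e z : Q e (Tm e) (qe e) z = Mt e * J e (Tm e) z - g.
Proof. by rewrite /Q /Mt; ring. Qed.

Lemma Mt_gt0 e : `|e| < 1 -> 0 < Mt e.
Proof.
move=> e1; rewrite divr_gt0 ?addr_gt0 ?qe_gt0// J_gt0 ?Tm_gt0//.
exact: abs_e_gtN1.
Qed.

Lemma Mt_le e : `|e| < 1 -> Mt e <= 16 * (g + k0 ^+ 2).
Proof.
move=> e1; have T1 := Tm_ge1 e1; have T0 := Tm_gt0 e1; have T2 := Tm_le e1.
have Je := J_gt0 e1 T0 (abs_e_gtN1 e).
(* The lower bound of [J_ge] suffices: 1 <= T gives (1 + T)^2 <= 4 T^2, and 1 + |e| + T <= 4. *)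
have h : 16^-1 <= J e (Tm e) `|e|.
  apply: le_trans (J_ge e1 T0 (abs_e_gtN1 e)).
  have e0 := normr_ge0 e.
  have c0 : 0 < (1 + Tm e) * (1 + Tm e) * (1 + `|e| + Tm e).
    by rewrite !mulr_gt0//; lra.
  rewrite ler_pdivlMr//.
  have : (1 + Tm e) * (1 + Tm e) <= 4 * (Tm e * Tm e).
    have := mulr_ge0 (_ : 0 <= Tm e - 1) (_ : 0 <= 3 * Tm e + 1).
    move=> /(_ ltac:(lra) ltac:(lra)); lra.
  move=> h4; have : (1 + Tm e) * (1 + Tm e) * (1 + `|e| + Tm e) <=
      4 * (Tm e * Tm e) * 4.
    by apply: ler_pM => //; [apply: mulr_ge0|..]; lra.
  lra.
rewrite ler_pdivrMr//.
have h1 : g + qe e <= g + k0 ^+ 2 by rewrite lerD2l qe_le.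
have g0 : 0 < g + qe e by rewrite addr_gt0 ?qe_gt0.
have := ler_wpM2l (_ : 0 <= 16 * (g + k0 ^+ 2)) h.
by move=> /(_ ltac:(lra)); lra.
Qed.

Lemma Mt_cvg (Y : topologicalType) (y0 : Y) (fe : Y -> R) e : `|e| < 1 ->
  fe y @[y --> y0] --> e -> Mt (fe y) @[y --> y0] --> Mt e.
Proof.
move=> e1 he; have h1 := qe_cvg e1 he; have h2 := Tm_cvg e1 he.
have h3 : J (fe y) (Tm (fe y)) `|fe y| @[y --> y0] --> J e (Tm e) `|e|.
  by apply: J_cvg => //; [exact: Tm_gt0|exact: abs_e_gtN1|exact: cvR_norm].
rewrite /Mt; cvg_arith.
by rewrite lt0r_neq0// J_gt0 ?Tm_gt0//; exact: abs_e_gtN1.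
Qed.

Definition w e t : R := W e (Tm e) (qe e) (e * cos t).

Lemma w_gt0 e t : `|e| < 1 -> 0 < w e t.
Proof. by move=> e1; rewrite W_gt0 ?Tm_gt0 ?qe_gt0 ?abs_ecos. Qed.

Lemma w_continuous e : `|e| < 1 -> continuous (w e).
Proof. by move=> e1; apply: Wcos_continuous => //; [exact: Tm_gt0|exact: qe_gt0]. Qed.

(** Of the points z and - z one is nonnegative, and there the weight is at least its value [w0] at z
    = 0. Hence [w0] is at most w(t) + w(pi - t), whose integral over [0, pi] is 2 pi / k0. The phase
    speed is therefore at least k0 / 2 on the whole side z <= 0, uniformly up to rupture. *)
Lemma w_le_left e t : `|e| < 1 -> e * cos t <= 0 -> w e t <= 2 / k0.
Proof.
move=> e1 zt; have T0 := Tm_gt0 e1; have q0 := qe_gt0 e1.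
pose w0 := W e (Tm e) (qe e) 0.
have z0 : `|0 : R| <= `|e| by rewrite normr0.
apply: (@le_trans _ _ w0); first by apply: W_incr => //; exact: abs_ecos.
have cw : {in `[0, pi]%R, continuous (w e)} by move=> ? _; exact: w_continuous.
have cwr : {in `[0, pi]%R, continuous (fun t => w e (pi - t))}.
  move=> x _; apply: (@continuous_comp _ _ _ (fun t : R => pi - t) (w e)).
    by cvg_arith.
  exact: w_continuous.
have : w0 * (pi - 0) <= 2 * (pi / k0).
  rewrite -(P_qe e1) -(seg_int_cst _ (pi_ge0 R)) mulr2n mulrDl mul1r.
  rewrite -{1}[P _ _ _](seg_int_reflect (pi_ge0 R))//; last exact: w_continuous.
  rewrite -[P _ _ _]/(\int[mu]_(t in `[0, pi]) w e t) -seg_intD//.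
  apply: seg_int_le => //.
  - by move=> ? _; exact: cvg_cst.
  - by move=> x xab; apply: cvgD; [exact: cwr|exact: cw].
  move=> x _; have h1 := w_gt0 x e1; have h2 := w_gt0 (pi - x) e1.
  have cE : cos (pi - x) = - cos x by rewrite cosB cospi sinpi; ring.
  have [zp|zn] := leP 0 (e * cos x).
    have : w0 <= w e x by apply: W_incr => //; exact: abs_ecos.
    by rewrite /= -/(w e (pi - x)); lra.
  have : w0 <= w e (pi - x).
    apply: W_incr => //; first exact: abs_ecos.
    by rewrite cE mulrN oppr_ge0 ltW.
  by rewrite /= -/(w e (pi - x)); lra.
rewrite subr0 mulrCA mulrC ler_pM2l ?pi_gt0//.
Qed.

End mean.

(** * The closed orbit *)

Section calculus_more.
Context {R : realType}.
Notation mu := (@lebesgue_measure R).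
Implicit Types (f F : R -> R) (a b c x y : R).

Lemma is_derive_shift_comp F f a b x : is_derive (a * x + b) 1 F (f (a * x + b)) ->
  is_derive x 1 (fun x => F (a * x + b)) (f (a * x + b) * a).
Proof.
move=> dF; apply: (@is_derive1_comp _ F (fun x : R => a * x + b)).
apply: is_derive_eq; rewrite /GRing.scale/=; ring.
Qed.

Lemma antiderivative_odd F f : F 0 = 0 ->
  (forall x, is_derive x 1 F (f x)) -> (forall x, f (- x) = f x) ->
  forall x, F (- x) = - F x.
Proof.
move=> F0 dF ev x; pose G x := F (-1 * x + 0) + F x.
have dG y : is_derive y 1 G 0.
  rewrite (_ : 0 = f (-1 * y + 0) * -1 + f y).
    by apply: is_deriveD; apply: is_derive_shift_comp.
  by rewrite addr0 mulN1r ev mulrN1 addNr.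
have := is_derive_0_is_cst x 0 dG; rewrite /G !mulr0 !addr0 F0 addr0 mulN1r.
by move=> /eqP; rewrite addr_eq0 => /eqP.
Qed.

Lemma antiderivative_shift F f c : (forall x, is_derive x 1 F (f x)) ->
  (forall x, f (x + c) = f x) ->
  forall x y, F (x + c) - F x = F (y + c) - F y.
Proof.
move=> dF per x y; pose G x := F (1 * x + c) - F x.
have dG (z : R) : is_derive z 1 G 0.
  rewrite (_ : 0 = f (1 * z + c) * 1 - f z).
    by apply: is_deriveB; apply: is_derive_shift_comp.
  by rewrite mul1r per mulr1 subrr.
by have := is_derive_0_is_cst x y dG; rewrite /G !mul1r.
Qed.

Lemma increasing_of_derive F f : (forall x, is_derive x 1 F (f x)) ->
  (forall x, 0 < f x) -> {mono F : x y / x < y}.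
Proof.
move=> dF f0; apply: leW_mono; apply: le_mono => x y xy.
have [|c _ h] := @MVT R F f x y xy (fun z _ => dF z).
  by apply: in_continuous_within => z _; exact: is_derive_continuous (dF z).
by rewrite -subr_gt0 h mulr_gt0// subr_gt0.
Qed.

End calculus_more.

Section orbit.
Context {R : realType}.
Notation mu := (@lebesgue_measure R).
Variables (g k0 : R).
Hypotheses (hg : 0 < g) (hk0 : 0 < k0).
Variable (e : R).
Implicit Types (t x y z : R).
Hypothesis (e1 : `|e| < 1).

Local Notation Q := (Q g).
Local Notation W := (W g).
Local Notation T := (Tm g k0 e).
Local Notation q := (qe g k0 e).
Local Notation Mt := (Mt g k0 e).
Local Notation w := (w g k0 e).
Local Notation N := (N g k0).
Local Notation L := (pi / k0).

(** Position on the orbit as a function of the phase angle, dx = w dt; [Theta] below is its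
    inverse. *)
Definition X : R -> R :=
  get [set F : R -> R | F 0 = 0 /\ forall x : R, is_derive x 1 F (w x)].

Lemma XP : X 0 = 0 /\ forall x : R, is_derive x 1 X (w x).
Proof.
exact: (getPex (antiderivative_exists (w_continuous hg hk0 e1))).
Qed.

Lemma X0 : X 0 = 0. Proof. by case: XP. Qed.

Lemma dX x : is_derive x 1 X (w x). Proof. by case: XP. Qed.

Lemma wN x : w (- x) = w x.
Proof. by rewrite /w cosN. Qed.

Lemma wD2pi x : w (x + 2 * pi) = w x.
Proof. by rewrite /w mulr2n mulrDl mul1r addrA !cosDpi opprK. Qed.

Lemma L_gt0 : 0 < L.
Proof. by rewrite divr_gt0// pi_gt0. Qed.

Lemma XN x : X (- x) = - X x.
Proof. exact: antiderivative_odd X0 dX wN x. Qed.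

Lemma Xpi : X pi = L.
Proof.
have := P_qe hg hk0 e1; rewrite /P (seg_FTC2 (pi_ge0 R) (F := X)).
- by rewrite X0 subr0.
- by move=> t _; exact: w_continuous.
- by move=> t _; exact: dX.
Qed.

Lemma XD2pi x : X (x + 2 * pi) = X x + 2 * L.
Proof.
have := antiderivative_shift dX wD2pi x (- pi).
rewrite (_ : - pi + 2 * pi = pi); last by ring.
by rewrite XN Xpi => h; rewrite -[LHS](subrK (X x)) h; ring.
Qed.

Lemma X_lt : {mono X : x y / x < y}.
Proof. by apply: increasing_of_derive dX _ => x; exact: w_gt0. Qed.

Lemma X_inj : injective X.
Proof.
move=> x y xy; have [h|h|//] := ltgtP x y.
  by move: h; rewrite -X_lt xy ltxx.
by move: h; rewrite -X_lt xy ltxx.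
Qed.

Lemma X_surj y : exists t, X t = y.
Proof.
have XnD n : X (2 * pi *+ n) = 2 * L *+ n.
  elim: n => [|n IH]; first by rewrite !mulr0n X0.
  by rewrite (mulrSr (2 * pi)) (mulrSr (2 * L)) XD2pi IH.
have L0 := L_gt0.
pose n := (Num.bound (`|y| / (2 * L))).
have yn : `|y| < 2 * L *+ n.
  have LL0 : 0 < 2 * L by rewrite mulr_gt0.
  rewrite -[_ *+ n]mulr_natl -ltr_pdivrMr//.
  by rewrite archi_boundP// divr_ge0// ltW.
pose b : R := 2 * pi *+ n.
have b0 : 0 <= b by rewrite mulrn_wge0// mulr_ge0// pi_ge0.
have Xb : X b = 2 * L *+ n := XnD n.
have bb : - b <= b by lra.
have cX : {in `[- b, b]%R, continuous X}.
  by move=> t _; exact: is_derive_continuous (dX t).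
have [|t _ Xt] := IVT bb (in_continuous_within cX) (v := y); last by exists t.
rewrite XN Xb; move: yn; rewrite ltr_norml => /andP[y1 y2].
by rewrite ge_min le_max (ltW y1) (ltW y2) orbT.
Qed.

Definition Theta x : R := get [set t | X t = x].

Lemma ThetaK x : X (Theta x) = x.
Proof. exact: (getPex (X_surj x)). Qed.

Lemma XK t : Theta (X t) = t.
Proof. by apply: X_inj; rewrite ThetaK. Qed.

Lemma dTheta x : is_derive x 1 Theta (w (Theta x))^-1.
Proof.
rewrite -{1}(ThetaK x); apply: is_derive_inverse.
- by near=> t; exact: XK.
- by near=> t; exact: is_derive_continuous (dX t).
- exact: dX.
- by rewrite lt0r_neq0// w_gt0.
Unshelve. all: by end_near. Qed.

Lemma Theta_continuous : continuous Theta.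
Proof. by move=> x; exact: is_derive_continuous (dTheta x). Qed.

Lemma ThetaN x : Theta (- x) = - Theta x.
Proof. by apply: X_inj; rewrite XN !ThetaK. Qed.

Lemma Theta0 : Theta 0 = 0.
Proof. by apply: X_inj; rewrite ThetaK X0. Qed.

Lemma ThetaL : Theta L = pi.
Proof. by rewrite -Xpi XK. Qed.

Lemma ThetaNL : Theta (- L) = - pi.
Proof. by rewrite ThetaN ThetaL. Qed.

Lemma ThetaD2L x : Theta (x + 2 * L) = Theta x + 2 * pi.
Proof. by apply: X_inj; rewrite XD2pi !ThetaK. Qed.

Definition zz x : R := e * cos (Theta x).
Definition vv x : R := (1 + zz x) / T - 1.
Definition MM : R := Mt / T.
Definition sq x : R := Num.sqrt (Q e T q (zz x)).
Definition dvv x : R := - (e * sin (Theta x) * sq x) / T.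

Lemma sq_gt0 x : 0 < sq x.
Proof. by rewrite sqrtr_gt0 Q_gt0 ?Tm_gt0 ?qe_gt0 ?abs_ecos. Qed.

Lemma dThetaE x : is_derive x 1 Theta (sq x).
Proof. by have := dTheta x; rewrite /w /W invrK. Qed.

Lemma T0 : 0 < T. Proof. exact: Tm_gt0. Qed.
Lemma T1 : 1 <= T. Proof. exact: Tm_ge1. Qed.
Lemma T_le : T <= 1 + `|e|. Proof. exact: Tm_le. Qed.

Lemma zz_gtN1 x : -1 < zz x.
Proof. exact: abs_z_gtN1 e1 (abs_ecos _ _). Qed.

Lemma dzz x : is_derive x 1 zz (- (e * sin (Theta x) * sq x)).
Proof.
have h : is_derive x 1 (fun x => cos (Theta x)) (- sin (Theta x) * sq x).
  by apply: (@is_derive1_comp _ cos Theta); exact: dThetaE.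
apply: is_derive_eq; rewrite /GRing.scale/=; ring.
Qed.

Lemma dvvP x : is_derive x 1 vv (dvv x).
Proof.
have h := dzz x.
apply: is_derive_eq; rewrite /GRing.scale/= /dvv; ring.
Qed.

Lemma dsq x : is_derive x 1 sq (- (Mt * dJ e T (zz x) * (e * sin (Theta x))) / 2).
Proof.
have Q0 : 0 < Q e T q (zz x).
  by rewrite Q_gt0 ?Tm_gt0 ?qe_gt0 ?abs_ecos.
have hJ := J_derive e1 T0 (zz_gtN1 x).
have hJz : is_derive x 1 (fun x => J e T (zz x))
    (dJ e T (zz x) * (- (e * sin (Theta x) * sq x))).
  by apply: (@is_derive1_comp _ (J e T) zz); exact: dzz.
have hQ : is_derive x 1 (fun x => Mt * J e T (zz x) - g)
    (Mt * (dJ e T (zz x) * (- (e * sin (Theta x) * sq x)))).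
  apply: is_derive_eq; rewrite /GRing.scale/=; ring.
have -> : sq = fun x => Num.sqrt (Mt * J e T (zz x) - g).
  by apply/funext => y; rewrite /sq QE.
rewrite QE in Q0.
have h := @is_derive1_comp _ Num.sqrt (fun x => Mt * J e T (zz x) - g) _ _ _
  (is_derive1_sqrt Q0) hQ.
apply: (is_derive_eq h); rewrite -[Num.sqrt _]/(Num.sqrt _).
have s0 : Num.sqrt (Mt * J e T (zz x) - g) != 0 by rewrite lt0r_neq0// sqrtr_gt0.
rewrite /sq QE; move: s0; set s := Num.sqrt _ => s0.
by field.
Qed.

(** The left-hand side is the z-derivative of z'^2 / 2 = (e^2 - z^2) Q / 2, that is, z''. By
    [J_interpolation] the same energy is the logarithmic potential up to an affine function of z;
    differentiating this form gives the right-hand side, the slope of the affine function entering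
    through [be]. *)
Lemma energy_derivative : exists be : R, forall z, -1 < z ->
  - z * Q e T q z + (e * e - z * z) / 2 * (Mt * dJ e T z) =
  g * z + be - Mt * (ln ((1 + z) / (1 + z + T)) + T / (1 + z + T)).
Proof.
have [al [be H]] := J_interpolation e1 T0.
exists (Mt * be) => z z1; have T0 := T0.
have hJ := J_derive e1 T0 z1.
have z10 : 0 < 1 + z by lra.
have z1T : 0 < 1 + z + T by lra.
pose V1 z := (e * e - z * z) / 2 * (Mt * J e T z - g).
pose V2 z := - (Mt * (T + (1 + z) * ln ((1 + z) / (1 + z + T)) - al - be * z))
   - (e * e - z * z) / 2 * g.
have d1 : is_derive z 1 V1
    (- z * (Mt * J e T z - g) + (e * e - z * z) / 2 * (Mt * dJ e T z)).
  apply: is_derive_eq; rewrite /GRing.scale/=; by field.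
have hi : is_derive z 1 (fun z => (1 + z) / (1 + z + T))
    (T / ((1 + z + T) * (1 + z + T))).
  have hv : is_derive z 1 (fun z => (1 + z + T)^-1)
      (- (1 + z + T) ^- 2 *: (1 : R)).
    apply: is_deriveV; first by rewrite lt0r_neq0.
    by apply: is_derive_eq; rewrite add0r addr0.
  apply: is_derive_eq; rewrite /GRing.scale/=; field.
  by rewrite lt0r_neq0.
have hl : is_derive z 1 (fun z => ln ((1 + z) / (1 + z + T)))
   (((1 + z) / (1 + z + T))^-1 * (T / ((1 + z + T) * (1 + z + T)))).
  apply: (@is_derive1_comp _ (@ln R) (fun z => (1 + z) / (1 + z + T))).
  by apply: is_derive1_ln; rewrite divr_gt0.
have d2 : is_derive z 1 V2
    (g * z + Mt * be - Mt * (ln ((1 + z) / (1 + z + T)) + T / (1 + z + T))).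
  apply: is_derive_eq; rewrite /GRing.scale/=; field.
  by rewrite !lt0r_neq0.
have V12 : \forall y \near z, V1 y = V2 y.
  near=> y; have y1 : -1 < y by near: y; exact: cvgr_gt (cvg_id) _ z1.
  rewrite /V1 /V2 mulrBr mulrA -(H y y1); by field.
have d1' := near_eq_is_derive V12 d1.
by rewrite QE -(@derive_val _ _ _ _ _ _ _ d1') (@derive_val _ _ _ _ _ _ _ d2).
Unshelve. all: by end_near. Qed.

Lemma nonlinE z : -1 < z -> nonlin ((1 + z) / T - 1) =
  ln ((1 + z) / (1 + z + T)) + T / (1 + z + T).
Proof.
move=> z1; have T0 := T0; have z1T : 0 < 1 + z + T by lra.
rewrite /nonlin addrC; congr (ln _ + _); field; rewrite !lt0r_neq0//; lra.
Qed.

Lemma ddvv_ex : exists ka : R, forall x,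
  is_derive x 1 dvv (g * vv x + ka - MM * nonlin (vv x)).
Proof.
have [be H] := energy_derivative; have T0 := T0.
exists (be / T + g * (1 - T^-1)) => x.
have hs := dsq x; have hT := dThetaE x.
have hsin : is_derive x 1 (fun x => sin (Theta x)) (cos (Theta x) * sq x).
  by apply: (@is_derive1_comp _ sin Theta).
have h : is_derive x 1 dvv (- (e * (cos (Theta x) * sq x) * sq x +
   e * sin (Theta x) * (- (Mt * dJ e T (zz x) * (e * sin (Theta x))) / 2)) / T).
  apply: is_derive_eq; rewrite /GRing.scale/=; ring.
apply: (is_derive_eq h).
rewrite {1}/vv nonlinE ?zz_gtN1//.
have -> : g * ((1 + zz x) / T - 1) + (be / T + g * (1 - T^-1)) -
   MM * (ln ((1 + zz x) / (1 + zz x + T)) + T / (1 + zz x + T)) =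
   (g * zz x + be - Mt * (ln ((1 + zz x) / (1 + zz x + T)) +
     T / (1 + zz x + T))) / T.
  rewrite /MM; move: (ln _) (T / (1 + _ + _)) => A B; field.
  by rewrite lt0r_neq0.
rewrite -H ?zz_gtN1//; congr (_ / T).
have ss : sq x * sq x = Q e T q (zz x).
  rewrite -expr2 sqr_sqrtr// ltW// Q_gt0 ?Tm_gt0 ?qe_gt0 ?abs_ecos//.
have c2 : e * e - zz x * zz x = e * e * (sin (Theta x) * sin (Theta x)).
  rewrite /zz; have := cos2Dsin2 (Theta x); rewrite !expr2 => h1.
  rewrite -[X in X - _]mulr1 -h1; ring.
by rewrite c2 -ss /zz; field.
Qed.

(** Substitution x = X(t), carried out by composing an antiderivative [H] in t with [Theta]; the
    choice of [T] enters through [N_Tm]. *)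
Lemma int_hh : \int[mu]_(x in `[- L, L]) ((1 + zz x) / T) = 2 * L.
Proof.
have T0 := T0.
pose f t := (1 + e * cos t) / T * w t.
have cf : continuous f.
  by move=> t; apply: cvgM; [cvg_arith|exact: w_continuous].
have [H [H0 dH]] := antiderivative_exists cf.
have Hodd : forall x, H (- x) = - H x.
  by apply: antiderivative_odd H0 dH _ => x; rewrite /f cosN wN.
have Hpi : H pi = L.
  have := seg_FTC2 (pi_ge0 R) (fun t _ => cf t) (fun t _ => dH t).
  rewrite H0 subr0 => <-.
  have -> : \int[mu]_(t in `[0, pi]) f t =
     \int[mu]_(t in `[0, pi]) (T^-1 * (w t + e * cos t * w t)).
    by apply: eq_seg_int => t _; rewrite /f; ring.
  have cw : {in `[0, pi]%R, continuous w}.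
    by move=> t _; exact: w_continuous.
  have czw : {in `[0, pi]%R, continuous (fun t => e * cos t * w t)}.
    by move=> t tt; apply: cvgM; [cvg_arith|exact: cw].
  rewrite seg_intZl; last by move=> t tt; apply: cvgD; [exact: cw|exact: czw].
  rewrite seg_intD//.
  rewrite -[X in X + _]/(P g e T q) -[X in _ + X]/(N e T) P_qe// N_Tm//.
  rewrite -[X in X + _]mul1r -mulrDl addrC subrK mulKf// lt0r_neq0//.
have oppL_le_L : - L <= L by have := L_gt0; lra.
rewrite (seg_FTC2 oppL_le_L (F := fun x => H (Theta x))).
- rewrite ThetaL ThetaNL Hodd Hpi; ring.
- move=> x _; cvg_arith; apply: is_derive_continuous (dzz x).
- move=> x _.
  have -> : (1 + zz x) / T = f (Theta x) * (w (Theta x))^-1.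
    by rewrite /f mulfK// lt0r_neq0// w_gt0.
  by apply: (@is_derive1_comp _ H Theta); exact: dTheta.
Qed.

Lemma vv_continuous : continuous vv.
Proof. by move=> x; exact: is_derive_continuous (dvvP x). Qed.

Lemma int_vv : \int[mu]_(x in `[- L, L]) vv x = 0.
Proof.
have oppL_le_L : - L <= L by have := L_gt0; lra.
rewrite seg_intB.
- rewrite int_hh seg_int_cst//; ring.
- move=> x _; cvg_arith; apply: is_derive_continuous (dzz x).
- by move=> x _; exact: cvg_cst.
Qed.

Lemma hh_gt0 x : 0 < 1 + vv x.
Proof.
rewrite /vv addrC subrK divr_gt0 ?T0//; have := zz_gtN1 x; lra.
Qed.

Lemma vv_gtN1 x : -1 < vv x.
Proof. have := hh_gt0 x; lra. Qed.

Lemma vv_lt1 x : vv x < 1.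
Proof.
rewrite /vv ltrBlDr ltr_pdivrMr ?T0//; have := T1.
have : zz x <= `|e| by exact: le_trans (ler_norm _) (abs_ecos _ _).
have := e1; lra.
Qed.

End orbit.

(** * The stationary equation for the orbit and estimates of its derivatives *)

Lemma is_derive_nonlin (R : realType) (y : R) : -1 < y ->
  is_derive y 1 (@nonlin R) (((1 + y) * (2 + y) ^+ 2)^-1).
Proof.
move=> y1; have y10 : 0 < 1 + y by lra.
have y20 : 0 < 2 + y by lra.
have hv : is_derive y 1 (fun y : R => (2 + y)^-1) (- (2 + y) ^- 2 *: (1 : R)).
  apply: is_deriveV; first by rewrite lt0r_neq0.
  by apply: is_derive_eq; rewrite add0r.
have hq : is_derive y 1 (fun y : R => (1 + y) / (2 + y)) ((2 + y) ^- 2).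
  apply: is_derive_eq; rewrite /GRing.scale/=; field.
  by rewrite lt0r_neq0.
have hl : is_derive y 1 (fun y : R => ln ((1 + y) / (2 + y)))
    (((1 + y) / (2 + y))^-1 * (2 + y) ^- 2).
  apply: (@is_derive1_comp _ (@ln R) (fun y => (1 + y) / (2 + y))).
  by apply: is_derive1_ln; rewrite divr_gt0.
rewrite /nonlin; apply: is_derive_eq; rewrite /GRing.scale/=; field.
by rewrite !lt0r_neq0.
Qed.

Lemma inv_period_mul (F : numFieldType) (k p : F) : k != 0 -> p != 0 ->
  k / (2 * p) * (p / k - - (p / k)) = 1.
Proof. by move=> k0 p0; field; rewrite k0 p0. Qed.

Lemma scaled_period (F : numFieldType) (k p : F) : k != 0 ->
  3 * k / 8 * (p / k) = 3 / 8 * p.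
Proof. by move=> k0; field; rewrite k0. Qed.

Section orbit_solution.
Context {R : realType}.
Notation mu := (@lebesgue_measure R).
Variables (g k0 : R).
Hypotheses (hg : 0 < g) (hk0 : 0 < k0).
Variable (e : R).
Implicit Types (t x y z : R).
Hypothesis (e1 : `|e| < 1).

Local Notation T := (Tm g k0 e).
Local Notation Mt := (Mt g k0 e).
Local Notation w := (w g k0 e).
Local Notation L := (pi / k0).
Local Notation Theta := (Theta g k0 e).
Local Notation vv := (vv g k0 e).
Local Notation dvv := (dvv g k0 e).
Local Notation zz := (zz g k0 e).
Local Notation sq := (sq g k0 e).
Local Notation MM := (MM g k0 e).

Definition ddvv x : R := g * vv x - MM * nonlin (vv x) + MM * K k0 vv.

Lemma nonlin_vv_continuous : continuous (fun x => nonlin (vv x)).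
Proof.
move=> x; apply: (@continuous_comp _ _ _ vv nonlin).
  exact: vv_continuous.
apply: is_derive_continuous (is_derive_nonlin _).
exact: vv_gtN1.
Qed.

Lemma dvvL : dvv L = 0.
Proof. by rewrite /dvv ThetaL// sinpi mulr0 mul0r oppr0 mul0r. Qed.

Lemma dvvNL : dvv (- L) = 0.
Proof. by rewrite /dvv ThetaNL// sinN sinpi oppr0 mulr0 mul0r oppr0 mul0r. Qed.

Lemma oppL_le_L : - L <= L.
Proof. by have := L_gt0 hk0; lra. Qed.

(** The constant left open in [ddvv_ex] is identified by integrating over a period: v' vanishes at
    both ends and v has zero mean, which leaves M times the mean of the nonlinearity. *)
Lemma ddvvP x : is_derive x 1 dvv (ddvv x).
Proof.
have [ka H] := ddvv_ex hg hk0 e1.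
suff E : ka = MM * K k0 vv.
  have := H x; rewrite E => h; apply: (is_derive_eq h).
  by rewrite /ddvv addrAC.
have cv : {in `[- L, L]%R, continuous vv} by move=> y _; exact: vv_continuous.
have cn : {in `[- L, L]%R, continuous (fun x => nonlin (vv x))}.
  by move=> y _; exact: nonlin_vv_continuous.
have cgv : {in `[- L, L]%R, continuous (fun x => g * vv x + ka)}.
  by move=> y yy; apply: cvgD; [apply: cvgM; [exact: cvg_cst|exact: cv]|exact: cvg_cst].
have cMn : {in `[- L, L]%R, continuous (fun x => MM * nonlin (vv x))}.
  by move=> y yy; apply: cvgM; [exact: cvg_cst|exact: cn].
have cgv' : {in `[- L, L]%R, continuous (fun x => g * vv x)}.
  by move=> y yy; apply: cvgM; [exact: cvg_cst|exact: cv].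
have cF : {in `[- L, L]%R, continuous (fun x => g * vv x + ka - MM * nonlin (vv x))}.
  by move=> y yy; apply: cvgB; [exact: cgv|exact: cMn].
have := seg_FTC2 oppL_le_L cF (fun x _ => H x).
rewrite dvvL dvvNL subrr seg_intB// seg_intD//; last by move=> y _; exact: cvg_cst.
rewrite !seg_intZl// int_vv// mulr0 add0r (seg_int_cst _ oppL_le_L) /K.
set I := \int[mu]_(x in _) nonlin _ => /eqP; rewrite subr_eq0 => /eqP h.
have kL : k0 / (2 * pi) * (L - - L) = 1.
  exact: inv_period_mul (lt0r_neq0 hk0) (lt0r_neq0 (pi_gt0 R)).
by rewrite mulrCA -h mulrCA kL mulr1.
Qed.

Lemma ddvv_continuous : continuous ddvv.
Proof.
move=> x; apply: cvgD; last exact: cvg_cst.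
apply: cvgB; (apply: cvgM; first exact: cvg_cst).
  exact: vv_continuous.
exact: nonlin_vv_continuous.
Qed.

Lemma dvv_continuous : continuous dvv.
Proof. by move=> x; exact: is_derive_continuous (ddvvP x). Qed.

Lemma dddvvP x : is_derive x 1 ddvv
  (g * dvv x - MM * (((1 + vv x) * (2 + vv x) ^+ 2)^-1 * dvv x)).
Proof.
have hv := dvvP hg hk0 e1 x.
have hn : is_derive x 1 (fun x => nonlin (vv x))
    (((1 + vv x) * (2 + vv x) ^+ 2)^-1 * dvv x).
  apply: (@is_derive1_comp _ nonlin vv).
  by apply: is_derive_nonlin; exact: vv_gtN1.
apply: is_derive_eq; rewrite /GRing.scale/=; ring.
Qed.

Lemma vvN x : vv (- x) = vv x.
Proof. by rewrite /vv /zz ThetaN// cosN. Qed.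

Lemma vv_periodic : periodic vv (2 * pi / k0).
Proof.
move=> x; rewrite -mulrA /vv /zz ThetaD2L//.
have -> : Theta x + 2 * pi = Theta x + pi + pi by ring.
by rewrite !cosDpi opprK.
Qed.

Lemma derive1_is (f df : R -> R) : (forall x, is_derive x 1 f (df x)) ->
  derive1 f = df.
Proof. by move=> h; apply/funext => x; rewrite derive1E; exact: derive_val. Qed.

(** The flux vanishes identically: [nonlin] has derivative 1 / ((1 + y)(2 + y)^2), so
    differentiating the second-order equation and multiplying by h^3 yields the thermocapillary term
    with the opposite sign. *)
Lemma vv_stationary : stationary_solution g MM (fun x => 1 + vv x).
Proof.
have d1 x : is_derive x 1 (fun x => 1 + vv x) (dvv x).
  by have h := dvvP hg hk0 e1 x; apply: is_derive_eq; rewrite add0r mul1r.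
have E1 := derive1_is d1.
have E2 := derive1_is ddvvP.
have E3 := derive1_is dddvvP.
have F0 : flux g MM (fun x => 1 + vv x) = cst 0.
  apply/funext => x; rewrite /flux !derive1nS derive1n0 E1 E2 E3/=.
  have h0 := hh_gt0 hg hk0 e1 x.
  have h1 : 0 < 1 + (1 + vv x) by lra.
  have h2 : 0 < 2 + vv x by lra.
  rewrite /cst; field; rewrite !lt0r_neq0//.
move=> t x; split.
- exact: hh_gt0.
- exact: derivable_cst.
- case=> [|[|[|//]]] _; rewrite ?derive1nS ?derive1n0 ?E1 ?E2.
  + by have [] := d1 x.
  + by have [] := ddvvP x.
  + by have [] := dddvvP x.
- by rewrite F0; exact: derivable_cst.
- by rewrite F0 !derive1_cst addr0.
Qed.

Lemma MM_gt0 : 0 < MM. Proof. by rewrite divr_gt0 ?Mt_gt0 ?T0. Qed.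

Lemma MM_le : MM <= 16 * (g + k0 ^+ 2).
Proof.
apply: le_trans (Mt_le hg hk0 e1).
rewrite ler_pdivrMr ?T0// ler_peMr ?T1// ltW//; exact: Mt_gt0.
Qed.

(** Conservation of energy reads v'^2 = (e^2 - z^2) Q / T^2, which is at most 4 Mt by
    [J_energy_bound] and T >= 1; [Mt_le] makes the bound independent of [e]. *)
Lemma dvv_bound x : `|dvv x| <= 1 + 64 * (g + k0 ^+ 2).
Proof.
have T0 := T0 hg hk0 e1; have T1 := T1 hg hk0 e1.
have M0 := Mt_gt0 hg hk0 e1; have Ml := Mt_le hg hk0 e1.
have ze := abs_ecos e (Theta x).
have z1 : -1 < zz x by exact: zz_gtN1.
have Jb := J_energy_bound e1 T0 ze; rewrite -/(zz x) in Jb.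
have c2 : e * e - zz x * zz x = e * e * (sin (Theta x) * sin (Theta x)).
  rewrite /zz; have := cos2Dsin2 (Theta x); rewrite !expr2 => h1.
  rewrite -[X in X - _]mulr1 -h1; ring.
have c20 : 0 <= e * e - zz x * zz x.
  by rewrite c2 mulr_ge0// -expr2 sqr_ge0.
have ss : sq x * sq x = Mt * J e T (zz x) - g.
  rewrite -QE -expr2 sqr_sqrtr// ltW// Q_gt0 ?qe_gt0//.
have h : dvv x * dvv x <= 4 * Mt.
  have -> : dvv x * dvv x = (e * e - zz x * zz x) * (sq x * sq x) / (T * T).
    by rewrite c2 /dvv; field; rewrite lt0r_neq0.
  rewrite ss ler_pdivrMr ?mulr_gt0//.
  have h1 := ler_wpM2l (ltW M0) Jb.
  have h2 : 0 <= (e * e - zz x * zz x) * g by rewrite mulr_ge0// ltW.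
  have h3 : Mt * (4 * T) <= 4 * Mt * (T * T).
    have -> : Mt * (4 * T) = 4 * Mt * T by ring.
    apply: ler_wpM2l; first by rewrite mulr_ge0// ltW.
    by rewrite ler_peMr// ltW.
  lra.
have h4 : `|dvv x| <= 1 + dvv x * dvv x.
  have -> : dvv x * dvv x = `|dvv x| ^+ 2 by rewrite real_normK ?num_real// expr2.
  have := sqr_ge0 (`|dvv x| - 1); have := sqr_ge0 `|dvv x|.
  by rewrite sqrrB mulr1 expr1n mulr2n; lra.
lra.
Qed.

(** The fourth root of 1 + z. Its inverse dominates every power of the logarithm at rupture and
    still has a uniformly bounded integral; the derivative estimate in [int_rr] works for exponents
    below 1/2, where its bracket is negative at the minimum of z. *)
Definition rr x : R := Num.sqrt (Num.sqrt (1 + zz x)).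

Lemma rr_gt0 x : 0 < rr x.
Proof. by rewrite !sqrtr_gt0; have := zz_gtN1 g k0 e1 x; lra. Qed.

Lemma rr_continuous : continuous rr.
Proof.
move=> x; rewrite /rr; have h := is_derive_continuous (dzz hg hk0 e1 x).
by cvg_arith.
Qed.

(* Derivative estimate for [sgn e * sin Theta / (1 + z) ^ (1/4)], uniform in
   [e]: it controls the singularity at film rupture. *)
Lemma int_rr : \int[mu]_(x in `[- L, L]) (rr x)^-1 <= 7 * pi * (8 / k0).
Proof.
(* The sign of [e]: with it z = |e| c, and the minimum of z is at c = -1 for both signs. *)
pose s : R := if 0 <= e then 1 else -1.
have se : s * e = `|e|.
  rewrite /s; case: ifPn => [e0|]; first by rewrite mul1r ger0_norm.
  by rewrite -ltNge => /ltW e0; rewrite mulN1r ler0_norm.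
have ss : s * s = 1 by rewrite /s; case: ifPn => _; ring.
pose c x := s * cos (Theta x).
have zc x : zz x = `|e| * c x.
  by rewrite -se /c /zz mulrACA ss mul1r.
have c1 x : -1 <= c x <= 1.
  rewrite /c /s; have := cos_geN1 (Theta x); have := cos_le1 (Theta x).
  by case: ifPn => _; rewrite ?mul1r ?mulN1r; lra.
pose G x := s * sin (Theta x) / rr x.
pose dG x := sq x / rr x *
  (c x + `|e| * (1 - c x * c x) / (4 * (1 + zz x))).
have dGP x : is_derive x 1 G (dG x).
  have z10 : 0 < 1 + zz x by have := zz_gtN1 g k0 e1 x; lra.
  have r0 := rr_gt0 x.
  have hz := dzz hg hk0 e1 x.
  have hT := dThetaE hg hk0 e1 x.
  have hsin : is_derive x 1 (fun x => sin (Theta x)) (cos (Theta x) * sq x).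
    by apply: (@is_derive1_comp _ sin Theta).
  have h1 : is_derive x 1 (fun x => 1 + zz x) (- (e * sin (Theta x) * sq x)).
    by apply: is_derive_eq; rewrite add0r mul1r.
  have s0 : 0 < Num.sqrt (1 + zz x) by rewrite sqrtr_gt0.
  have h2 := @is_derive1_comp _ Num.sqrt (fun x => 1 + zz x) _ _ _
    (is_derive1_sqrt z10) h1.
  have h3 := @is_derive1_comp _ Num.sqrt (fun x => Num.sqrt (1 + zz x)) _ _ _
    (is_derive1_sqrt s0) h2.
  have h4 : is_derive x 1 (fun x => (rr x)^-1) _ :=
    is_deriveV (lt0r_neq0 r0) h3.
  apply: is_derive_eq; rewrite /GRing.scale/= /dG.
  have E1 : Num.sqrt (1 + zz x) = rr x * rr x.
    by rewrite -expr2 sqr_sqrtr// ltW.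
  have E2 : 1 + zz x = (rr x * rr x) * (rr x * rr x).
    by rewrite -E1 -expr2 sqr_sqrtr// ltW.
  have E3 : e * sin (Theta x) * sin (Theta x) * s = `|e| * (1 - c x * c x).
    rewrite -se /c mulrACA ss mul1r.
    have := cos2Dsin2 (Theta x); rewrite !expr2 => h5.
    by rewrite -[X in _ * (X - _)]h5; ring.
  rewrite -E3 -/(rr x) E1 E2 /c; field.
  by rewrite lt0r_neq0.
have cr : {in `[- L, L]%R, continuous (fun x => (rr x)^-1)}.
  move=> x _; apply: cvgV; first exact: lt0r_neq0 (rr_gt0 x).
  exact: rr_continuous.
(* The term - G pays where c <= - 2/3: there G' <= - (sq / rr) / 4 and sq >= k0 / 2. Elsewhere 1 /
   rr <= 3, and the terms 3 Theta and 3 k0 x / 8 pay for G' and for k0 / (8 rr). *)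
pose H x := 8 / k0 * (- G x + 3 * Theta x + 3 * k0 / 8 * x).
pose dH x := 8 / k0 * (- dG x + 3 * sq x + 3 * k0 / 8).
have dHP x : is_derive x 1 H (dH x).
  have h1 := dGP x; have hT := dThetaE hg hk0 e1 x.
  by apply: is_derive_eq; rewrite /GRing.scale/= /dH mulr1.
have csq x : {for x, continuous sq}.
  exact: is_derive_continuous (dsq hg hk0 e1 x).
have cz x : {for x, continuous zz}.
  exact: is_derive_continuous (dzz hg hk0 e1 x).
have crr x : {for x, continuous rr} by exact: rr_continuous.
have cT x : {for x, continuous Theta} by exact: Theta_continuous.
have cdH : {in `[- L, L]%R, continuous dH}.
  move=> x _; rewrite /dH /dG /c.
  have a1 := csq x; have a2 := cz x; have a3 := crr x; have a4 := cT x.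
  cvg_arith; first exact: lt0r_neq0 (rr_gt0 x).
  rewrite lt0r_neq0// mulr_gt0//; have := zz_gtN1 g k0 e1 x; lra.
apply: (@le_trans _ _ (\int[mu]_(x in `[- L, L]) dH x)); last first.
  rewrite (seg_FTC2 oppL_le_L cdH (fun x _ => dHP x)) /H /G ThetaL// ThetaNL//.
  rewrite sinN sinpi oppr0 !mulr0 !mul0r oppr0 !add0r.
  rewrite -mulrBr mulrC ler_pM2r ?divr_gt0//.
  have -> : 3 * k0 / 8 * L = 3 / 8 * pi.
    exact: scaled_period (lt0r_neq0 hk0).
  have -> : 3 * k0 / 8 * - L = - (3 / 8 * pi).
    rewrite mulrN; congr (- _).
    exact: scaled_period (lt0r_neq0 hk0).
  have := pi_gt0 R; lra.
apply: seg_int_le => // x _.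
have r0 := rr_gt0 x; have q0 := sq_gt0 hg hk0 e1 x.
have z10 : 0 < 1 + zz x by have := zz_gtN1 g k0 e1 x; lra.
have /andP[cx1 cx2] := c1 x.
have a0 := normr_ge0 e; have a1 := e1.
have br : c x + `|e| * (1 - c x * c x) / (4 * (1 + zz x)) <= 1 / 4 + 3 / 4 * c x.
  have : `|e| * (1 - c x * c x) / (4 * (1 + zz x)) <= (1 - c x) / 4.
    rewrite ler_pdivrMr ?mulr_gt0//.
    have -> : (1 - c x) / 4 * (4 * (1 + zz x)) =
      `|e| * (1 - c x * c x) + (1 - c x) * (1 - `|e|) by rewrite zc; field.
    by rewrite lerDl mulr_ge0//; lra.
  lra.
have -> : dH x = (8 / k0) * (- dG x + 3 * sq x + 3 * k0 / 8) by [].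
rewrite mulrC -ler_pdivrMr ?divr_gt0//.
have -> : (rr x)^-1 / (8 / k0) = k0 / 8 * (rr x)^-1.
  by field; rewrite !lt0r_neq0.
have ir0 : 0 < (rr x)^-1 by rewrite invr_gt0.
have qr0 : 0 < sq x / rr x by rewrite divr_gt0.
have [cle|cgt] := leP (c x) (- (2 / 3)).
  have zneg : zz x <= 0 by rewrite zc mulr_ge0_le0//; lra.
  have sqk : k0 / 2 <= sq x.
    have := w_le_left hg hk0 e1 zneg; rewrite /w /W -/(zz x) -/(sq x).
    rewrite -[X in _ <= X]invf_div lef_pV2 ?posrE ?divr_gt0//.
  have b4 : c x + `|e| * (1 - c x * c x) / (4 * (1 + zz x)) <= - (1 / 4) by lra.
  have := ler_wpM2l (ltW qr0) b4; rewrite -/(dG x).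
  have := ler_wpM2r (ltW ir0) sqk; have := hk0.
  lra.
have r3 : (rr x)^-1 <= 3.
  rewrite -[leRHS]invrK; apply: inv_le; first by rewrite invr_gt0.
  have u3 : 3^-1 <= 1 + zz x.
    rewrite zc; have : `|e| * (- (2 / 3)) <= `|e| * c x by rewrite ler_wpM2l// ltW.
    lra.
  have E x1 : 0 <= x1 -> Num.sqrt (x1 ^+ 2) = x1.
    by move=> ?; rewrite sqrtr_sqr ger0_norm.
  have t0 : (0 : R) <= 3^-1 by rewrite invr_ge0.
  rewrite -[leLHS]E// ler_wsqrtr// -[leLHS]E ?sqr_ge0// ler_wsqrtr//.
  apply: le_trans u3; lra.
have b4 : c x + `|e| * (1 - c x * c x) / (4 * (1 + zz x)) <= 1 by lra.
have := ler_wpM2l (ltW qr0) b4; rewrite -/(dG x) mulr1 => h1.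
have := ler_wpM2l (ltW q0) r3 => h2.
have := ler_wpM2l (ltW hk0) r3 => h3.
lra.
Qed.

End orbit_solution.

Lemma ln_le_id (R : realType) (x : R) : 0 < x -> ln x <= x - 1.
Proof.
move=> x0; have := expR_ge1Dx (ln x); rewrite lnK ?posrE//; lra.
Qed.

(** * Uniform bounds up to rupture *)

Section uniform_bounds.
Context {R : realType}.
Notation mu := (@lebesgue_measure R).
Variables (g k0 : R).
Hypotheses (hg : 0 < g) (hk0 : 0 < k0).
Variable (e : R).
Implicit Types (t x y z : R).
Hypothesis (e1 : `|e| < 1).

Local Notation T := (Tm g k0 e).
Local Notation L := (pi / k0).
Local Notation vv := (vv g k0 e).
Local Notation zz := (zz g k0 e).
Local Notation MM := (MM g k0 e).
Local Notation rr := (rr g k0 e).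
Local Notation ddvv := (ddvv g k0 e).

Lemma rr4 x : rr x ^+ 4 = 1 + zz x.
Proof.
have z10 : 0 < 1 + zz x by have := zz_gtN1 g k0 e1 x; lra.
by rewrite (exprM _ 2 2) !sqr_sqrtr ?sqrtr_ge0// ltW.
Qed.

Lemma zz_lt1 x : zz x < 1.
Proof.
by apply: le_lt_trans e1; exact: le_trans (ler_norm _) (abs_ecos _ _).
Qed.

Lemma rr_le2 x : rr x <= 2.
Proof.
have r0 := rr_gt0 g k0 e1 x; rewrite leNgt; apply/negP => r2.
have : 2 ^+ 4 < rr x ^+ 4 by rewrite ltrXn2r// ?nnegrE ltW.
rewrite rr4; have := zz_lt1 x; lra.
Qed.

Lemma rr_powR p x : 1 <= p -> 2^-1 <= (rr x)^-1 `^ p^-1.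
Proof.
move=> p1; have r0 := rr_gt0 g k0 e1 x.
have p0 : 0 < p by lra.
have h1 : (2 : R)^-1 <= 2^-1 `^ p^-1.
  by apply: ger1_powR; [lra|rewrite invf_le1].
apply: le_trans h1 _; apply: ge0_ler_powR.
- by rewrite invr_ge0 ltW.
- by rewrite nnegrE.
- by rewrite nnegrE invr_ge0 ltW.
- by apply: inv_le => //; exact: rr_le2.
Qed.

(** For y = (1 / rr)^(1/p) one has - ln(1 + z) = 4 p ln y <= 4 p (y - 1), so the singularity is
    dominated by a function whose p-th power is 1 / rr. Bounded terms are absorbed by y >= 1/2
    ([rr_powR]). *)
Lemma nonlin_rr p x : 1 <= p ->
  `|nonlin (vv x)| <= (10 + 4 * p) * ((rr x)^-1 `^ p^-1).
Proof.
move=> p1; have p0 : 0 < p by lra.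
have r0 := rr_gt0 g k0 e1 x; have ri0 : 0 < (rr x)^-1 by rewrite invr_gt0.
have T0 := T0 hg hk0 e1; have T1 := T1 hg hk0 e1; have Tl := T_le hg hk0 e1.
have z1 := zz_gtN1 g k0 e1 x; have z2 := zz_lt1 x; have a1 := e1.
have yh := rr_powR x p1.
set y := _ `^ _ in yh *.
have y0 : 0 < y by rewrite powR_gt0.
have lu : ln (1 + zz x) = - (4 * p * ln y).
  rewrite -rr4 lnXn// /y ln_powR lnV ?posrE//; field.
  by rewrite lt0r_neq0.
have h1 : `|ln (1 + zz x)| <= 4 * p * y + 1.
  have [u1|u1] := leP (1 + zz x) 1.
    rewrite ler0_norm ?ln_le0// lu opprK.
    have p40 : 0 <= 4 * p by lra.
    by have := ler_wpM2l p40 (ln_le_id y0); lra.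
  rewrite ger0_norm ?ln_ge0 ?ltW//.
  have := ln_le_id (_ : 0 < 1 + zz x); rewrite lt_leAnge => /(_ ltac:(lra)).
  have := mulr_ge0 (ltW p0) (ltW y0); lra.
have uT : 1 <= 1 + zz x + T by lra.
have uT0 : 0 < 1 + zz x + T by lra.
have h2 : 0 <= ln (1 + zz x + T) <= 3.
  rewrite ln_ge0//=; have := ln_le_id uT0; lra.
have h3 : 0 <= T / (1 + zz x + T) <= 1.
  apply/andP; split; first by rewrite divr_ge0// ltW.
  by rewrite ler_pdivrMr//; lra.
have z10 : 0 < 1 + zz x by lra.
have -> : nonlin (vv x) = ln (1 + zz x) - ln (1 + zz x + T) + T / (1 + zz x + T).
  by rewrite /vv nonlinE// ln_div ?posrE.
move: h1; rewrite !ler_norml; lra.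
Qed.

(** The constant is 14 * 7 * 8 / 2, from [nonlin_rr] at p = 1 and [int_rr]. *)
Lemma K_bound : `|K k0 vv| <= 392.
Proof.
have kp0 : 0 < k0 / (2 * pi) by rewrite divr_gt0 ?mulr_gt0 ?pi_gt0.
rewrite normrM (gtr0_norm kp0) mulrC -ler_pdivlMr//.
have cn : {in `[- L, L]%R, continuous (fun x => nonlin (vv x))}.
  by move=> y _; exact: nonlin_vv_continuous.
have cr : {in `[- L, L]%R, continuous (fun x => (rr x)^-1)}.
  move=> x _; apply: cvgV; first exact: lt0r_neq0 (rr_gt0 g k0 e1 x).
  exact: rr_continuous.
apply: (@le_trans _ _ (\int[mu]_(x in `[- L, L]) (14 * (rr x)^-1))).
  apply: le_trans (le_normr_Rintegral _ (seg_integrable cn)) _ => //.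
  apply: seg_int_le.
  - by move=> x xx; apply: cvg_norm; exact: cn.
  - by move=> x xx; apply: cvgM; [exact: cvg_cst|exact: cr].
  - move=> x _; have := nonlin_rr x (lexx 1).
    rewrite invr1 powRr1; last by rewrite invr_ge0 ltW// rr_gt0.
    by have -> : 10 + 4 * 1 = 14 :> R by ring.
rewrite seg_intZl//.
apply: le_trans (ler_wpM2l _ (int_rr hg hk0 e1)) _ => //.
have p0 := pi_gt0 R; move: p0 hk0; move: (pi : R) k0 => p k p0 k0'.
rewrite invf_div le_eqVlt; apply/orP; left; apply/eqP; field.
by rewrite lt0r_neq0.
Qed.

(** Collects the bounds |v| <= 1, [MM_le], [K_bound] and [nonlin_rr]; the factor 2 turns bounded
    terms into multiples of a quantity that is at least 1/2. *)
Definition Cdd p := 2 * (g + 16 * (g + k0 ^+ 2) * 392) + 16 * (g + k0 ^+ 2) * (10 + 4 * p).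

Lemma ddvv_rr p x : 1 <= p -> `|ddvv x| <= Cdd p * ((rr x)^-1 `^ p^-1).
Proof.
move=> p1; have M0 := MM_gt0 hg hk0 e1; have Ml := MM_le hg hk0 e1.
have hv : `|vv x| <= 1.
  have := vv_gtN1 hg hk0 e1 x; have := vv_lt1 hg hk0 e1 x.
  by rewrite ler_norml => ? ?; rewrite !ltW.
have yh := rr_powR x p1; have hn := nonlin_rr x p1; have hK := K_bound.
set y := _ `^ _ in yh hn *.
have g0 := hg; have G0 : 0 < g + k0 ^+ 2 by rewrite addr_gt0 ?exprn_gt0.
have a1 : `|g * vv x| <= g by rewrite normrM gtr0_norm// ler_piMr// ltW.
have a2 : `|MM * nonlin (vv x)| <= 16 * (g + k0 ^+ 2) * ((10 + 4 * p) * y).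
  rewrite normrM (gtr0_norm M0); apply: ler_pM => //; exact: ltW.
have a3 : `|MM * K k0 vv| <= 16 * (g + k0 ^+ 2) * 392.
  rewrite normrM (gtr0_norm M0); apply: ler_pM => //; exact: ltW.
apply: le_trans (ler_normD _ _) _.
apply: (le_trans (lerD (ler_normB _ _) (lexx _))).
have A0 : 0 <= g + 16 * (g + k0 ^+ 2) * 392 by lra.
have := ler_wpM2l A0 yh; rewrite /Cdd; lra.
Qed.

Lemma ddvv_powR p x : 1 <= p -> `|ddvv x| `^ p <= (Cdd p `^ p) * (rr x)^-1.
Proof.
move=> p1; have p0 : 0 < p by lra.
have ri0 : 0 <= (rr x)^-1 by rewrite invr_ge0 ltW// rr_gt0.
have C0 : 0 <= Cdd p.
  have g0 := hg; have G0 : 0 < g + k0 ^+ 2 by rewrite addr_gt0 ?exprn_gt0.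
  have := mulr_ge0 (ltW G0) (ltW p0); rewrite /Cdd; lra.
apply: (@le_trans _ _ ((Cdd p * ((rr x)^-1 `^ p^-1)) `^ p)).
  apply: ge0_ler_powR; rewrite ?nnegrE ?mulr_ge0 ?powR_ge0//; first exact: ltW.
  exact: ddvv_rr.
rewrite powRM ?powR_ge0// -powRrM mulVf ?lt0r_neq0//.
by rewrite powRr1.
Qed.

Lemma int_ddvv_powR p : 1 <= p ->
  (\int[mu]_(x in `](- L)%R, L[) (`|ddvv x| `^ p)%:E <=
   (Cdd p `^ p * (7 * pi * (8 / k0)))%:E)%E.
Proof.
move=> p1.
have cr : continuous (fun x => (rr x)^-1).
  move=> x; apply: cvgV; first exact: lt0r_neq0 (rr_gt0 g k0 e1 x).
  exact: rr_continuous.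
have mr : measurable_fun setT (fun x => (rr x)^-1).
  exact: continuous_measurable_fun cr.
have md : measurable_fun setT (fun x => `|ddvv x| `^ p).
  apply: (measurableT_comp (measurable_powR p)).
  apply: (measurableT_comp (@normr_measurable R setT)).
  by apply: continuous_measurable_fun; exact: ddvv_continuous.
apply: (@le_trans _ _
    (\int[mu]_(x in `[(- L)%R, L]) (Cdd p `^ p * (rr x)^-1)%:E)%E).
  apply: (@le_trans _ _ (\int[mu]_(x in `](- L)%R, L[) (Cdd p `^ p * (rr x)^-1)%:E)%E).
    apply: ge0_le_integral => //.
    - by apply/measurable_EFinP; apply: measurable_funTS.
    - apply/measurable_EFinP; apply: measurable_funTS.
      by apply: measurable_funM => //; exact: measurable_cst.
    - by move=> x _; rewrite lee_fin ddvv_powR.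
  apply: ge0_subset_integral => //.
  - apply/measurable_EFinP; apply: measurable_funTS.
    by apply: measurable_funM => //; exact: measurable_cst.
  - move=> x _; rewrite lee_fin mulr_ge0 ?powR_ge0// invr_ge0 ltW//.
    exact: rr_gt0.
  - exact: subset_itv_oo_cc.
have crs : {in `[- L, L]%R, continuous (fun x => (rr x)^-1)} by move=> x _; exact: cr.
have crc : {in `[- L, L]%R, continuous (fun x => Cdd p `^ p * (rr x)^-1)}.
  by move=> x xx; apply: cvgM; [exact: cvg_cst|exact: crs].
rewrite -[leLHS]fineK; last by apply: integrable_fin_num => //; exact: seg_integrable.
rewrite lee_fin -[fine _]/(\int[mu]_(x in `[- L, L]) (Cdd p `^ p * (rr x)^-1)).
by rewrite seg_intZl// ler_wpM2l ?powR_ge0// int_rr.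
Qed.

End uniform_bounds.

Lemma horner_bump_next (F : comNzRingType) (p p' S S' : {poly F}) (k c x : F) :
  (p' * S * S - k *: (p * S' * S) + c *: (p * S')).[x] =
  p'.[x] * S.[x] * S.[x] - k * (p.[x] * S'.[x] * S.[x]) + c * (p.[x] * S'.[x]).
Proof. by rewrite !hornerE. Qed.

(** * Weak derivatives *)

Section bump.
Context {R : realType}.
Variables (a b c : R).
Hypothesis c0 : 0 < c.
Implicit Types (p : {poly R}) (k : nat) (x y : R).

Definition bump_arg x : R := (x - a) * (b - x).

Definition bump_polyarg : {poly R} := ('X - a%:P) * (b%:P - 'X).

(* Closed under differentiation; [p = 1, k = 0] is the usual bump function on
   [a, b], and it tends to the indicator of ]a, b[ as [c] tends to [0]. *)
Definition bump p k x : R :=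
  if 0 < bump_arg x then p.[x] / bump_arg x ^+ k * expR (- (c / bump_arg x)) else 0.

Lemma bump_argE x : bump_polyarg.[x] = bump_arg x.
Proof. by rewrite /bump_polyarg /bump_arg !hornerE. Qed.

(** The numerator in the derivative of p s^(-k) exp(- c / s), s = [bump_arg], over the common
    denominator s^(k+2). *)
Definition bump_next p k : {poly R} :=
  p^`() * bump_polyarg * bump_polyarg
  - k%:R *: (p * bump_polyarg^`() * bump_polyarg) + c *: (p * bump_polyarg^`()).

Lemma bump_arg_derive x : is_derive x 1 bump_arg bump_polyarg^`().[x].
Proof.
rewrite (_ : bump_arg = horner bump_polyarg); first exact: is_derive_poly.
by apply/funext => y; rewrite bump_argE.
Qed.

Lemma bump_arg_cvg x : bump_arg y @[y --> x] --> bump_arg x.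
Proof. exact: is_derive_continuous (bump_arg_derive x). Qed.

(** From exp u >= u at u = c / ((m + 1) s), raised to the power m + 1. *)
Lemma expRN_le_pow m s : 0 < s -> expR (- (c / s)) <= ((m.+1)%:R / c) ^+ m.+1 * s ^+ m.+1.
Proof.
move=> s0; rewrite -exprMn expRN.
have m0 : 0 < (m.+1)%:R :> R by rewrite ltr0n.
set t := _ * s.
have t0 : 0 < t by rewrite /t mulr_gt0// divr_gt0.
have -> : c / s = (m.+1)%:R * t^-1.
  by rewrite /t; field; rewrite !lt0r_neq0.
rewrite expRM_natl -exprVn; apply: lerXn2r.
- by rewrite nnegrE invr_ge0 expR_ge0.
- by rewrite nnegrE ltW.
rewrite -[leRHS]invrK lef_pV2 ?posrE ?expR_gt0 ?invr_gt0//.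
have := expR_ge1Dx t^-1; lra.
Qed.

Lemma bump_derive p k x : is_derive x 1 (bump p k) (bump (bump_next p k) k.+2 x).
Proof.
have [s0|s0] := ltP 0 (bump_arg x).
- pose f y := p.[y] * (bump_arg y ^+ k)^-1 * expR (- (c * (bump_arg y)^-1)).
  have fE : \forall y \near x, f y = bump p k y.
    near=> y; rewrite /bump ifT//; near: y.
    by have := cvgr_gt _ (@bump_arg_cvg x); apply.
  apply: near_eq_is_derive fE _.
  have sn0 : bump_arg x != 0 by rewrite lt0r_neq0.
  have ds := bump_arg_derive x; have dp := is_derive_poly p x.
  set s' := _.[x] in ds.
  have dk : is_derive x 1 (fun y => (bump_arg y ^+ k)^-1)
      (- (k%:R * s' / bump_arg x ^+ k.+1)).
    case: k {f} => [|k].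
      rewrite mul0r mul0r oppr0.
      rewrite (_ : (fun y => _) = cst 1); first exact: is_derive_cst.
      by apply/funext => y; rewrite expr0 invr1.
    have dX : is_derive x 1 (fun y => bump_arg y ^+ k.+1)
        ((k.+1%:R * bump_arg x ^+ k) *: s').
      rewrite (_ : (fun y => _) = bump_arg ^+ k.+1); first exact: is_deriveX.
      by apply/funext => y; rewrite exprfctE.
    have h := @is_deriveV _ (fun y => bump_arg y ^+ k.+1) x _ _
      (expf_neq0 k.+1 sn0) dX.
    apply: (is_derive_eq h); rewrite /GRing.scale/= !exprS; field.
    by rewrite sn0 expf_neq0.
  have di : is_derive x 1 (fun y => (bump_arg y)^-1) (- bump_arg x ^- 2 *: s').
    exact: is_deriveV.
  have de : is_derive x 1 (fun y => expR (- (c * (bump_arg y)^-1)))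
      (expR (- (c * (bump_arg x)^-1)) * (c * s' / bump_arg x ^+ 2)).
    apply: (@is_derive1_comp _ expR (fun y => - (c * (bump_arg y)^-1))).
    apply: is_derive_eq; rewrite /GRing.scale/=; field.
    by rewrite sn0.
  have h : is_derive x 1 f _ := is_deriveM (is_deriveM dp dk) de.
  apply: (is_derive_eq h).
  rewrite /bump s0 /bump_next horner_bump_next /GRing.scale/= -/s' !bump_argE.
  rewrite -[(_ * _) x]/(p.[x] * (bump_arg x ^+ k)^-1) !exprS expr0.
  field.
  by rewrite sn0 expf_neq0.
- have -> : bump (bump_next p k) k.+2 x = 0 by rewrite /bump ltNge s0.
  move: s0; rewrite le_eqVlt => /predU1P[s0|s0]; last first.
    have fE : \forall y \near x, cst 0 y = bump p k y.
      near=> y; rewrite /bump ifF//; apply/negbTE; rewrite -leNgt ltW//.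
      by near: y; have := cvgr_lt _ (@bump_arg_cvg x); apply.
    by apply: near_eq_is_derive fE _; exact: is_derive_cst.
  (* At a zero of [bump_arg] the exponential beats the power k and leaves two further powers of
     [bump_arg], itself at most a multiple of |y - x|; hence a quadratic bound and derivative 0. *)
  have cp : p.[y] @[y --> x] --> p.[x].
    exact: is_derive_continuous (is_derive_poly p x).
  have [r /= r0 Hr] : \forall y \near x, `|p.[y]| < `|p.[x]| + 1.
    by have := cvgr_lt _ (cvg_norm cp); apply; rewrite ltrDl.
  pose Ds := `|a + b - 2 * x| + 1.
  pose C := (`|p.[x]| + 1) * ((k.+2%:R / c) ^+ k.+2 * (Ds * Ds)).
  have r10 : 0 < Num.min r 1 by rewrite lt_min r0 ltr01.
  apply: (@is_derive_quadratic _ _ _ _ C (Num.min r 1)) => // y.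
  rewrite lt_min => /andP[yr y1].
  have fx0 : bump p k x = 0 by rewrite /bump s0 ltxx.
  rewrite fx0 subr0 mulr0 subr0.
  have B0 : 0 <= `|p.[x]| + 1 by rewrite addr_ge0.
  have C0 : 0 <= C.
    rewrite mulr_ge0// mulr_ge0//; last by rewrite mulr_ge0 ?addr_ge0.
    by rewrite exprn_ge0// divr_ge0// ltW.
  rewrite /bump; case: ifPn => [sy|_]; last by rewrite normr0 mulr_ge0// sqr_ge0.
  have py : `|p.[y]| <= `|p.[x]| + 1.
    by apply/ltW/Hr; rewrite /ball_/= distrC.
  have sD : bump_arg y <= Ds * `|y - x|.
    have -> : bump_arg y = (y - x) * (a + b - y - x).
      by move: s0; rewrite /bump_arg => h; rewrite -[LHS]subr0 -h; ring.
    apply: le_trans (ler_norm _) _; rewrite normrM mulrC ler_wpM2r//.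
    have -> : a + b - y - x = (a + b - 2 * x) - (y - x) by ring.
    by apply: le_trans (ler_normB _ _) _; rewrite lerD2l ltW.
  rewrite -mulrA normrM /C -mulrA; apply: ler_pM => //.
  have e0 := expR_ge0 (- (c / bump_arg y)).
  rewrite ger0_norm; last by rewrite mulr_ge0// invr_ge0 exprn_ge0// ltW.
  apply: (@le_trans _ _ ((k.+2%:R / c) ^+ k.+2 * bump_arg y ^+ 2)).
    rewrite mulrC ler_pdivrMr ?exprn_gt0// -mulrA -exprD.
    exact: expRN_le_pow.
  rewrite -[leRHS]mulrA ler_wpM2l//; first by rewrite exprn_ge0// divr_ge0// ltW.
  have -> : Ds * Ds * (y - x) ^+ 2 = (Ds * `|y - x|) ^+ 2.
    by rewrite exprMn real_normK ?num_real// expr2.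
  apply: lerXn2r => //; rewrite nnegrE; first exact: ltW.
  by rewrite mulr_ge0// addr_ge0.
Unshelve. all: by end_near. Qed.

Lemma bump_derive1 p k : derive1 (bump p k) = bump (bump_next p k) k.+2.
Proof.
apply/funext => x; rewrite derive1E; have h := bump_derive p k x.
exact: derive_val.
Qed.

Lemma bump_derive1n n p k : exists p' k', derive1n n (bump p k) = bump p' k'.
Proof.
elim: n => [|n [p' [k' IH]]]; first by exists p, k; rewrite derive1n0.
by exists (bump_next p' k'), k'.+2; rewrite derive1nS IH bump_derive1.
Qed.

Hypothesis ab : a < b.

Lemma bump_arg_gt0 x : 0 < bump_arg x -> x \in `]a, b[%R.
Proof.
rewrite /bump_arg in_itv/= => h; have ab' := ab.
have [xa|ax] := leP x a.
  have : (x - a) * (b - x) <= 0 by rewrite mulr_le0_ge0//; lra.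
  lra.
have [bx|xb //] := leP b x.
have : (x - a) * (b - x) <= 0 by rewrite mulr_ge0_le0//; lra.
lra.
Qed.

Lemma bump_arg_itv x : x \in `]a, b[%R -> 0 < bump_arg x.
Proof. by rewrite in_itv/= => /andP[ax xb]; rewrite mulr_gt0// subr_gt0. Qed.

Lemma bump_test p k : test_function (bump p k).
Proof.
split.
  move=> n x; have [p' [k' ->]] := bump_derive1n n p k.
  by have [] := bump_derive p' k' x.
apply: (@subclosed_compact _ _ `[a, b]).
- exact: closed_closure.
- exact: segment_compact.
apply: (@subset_trans _ (closure `[a, b])); last first.
  by rewrite -(closure_id _).1//; exact: itv_closed.
apply: closureS => x /=; rewrite /bump; case: ifPn => [/bump_arg_gt0|]; last by rewrite eqxx.
by move=> h _; exact: subset_itv_oo_cc h.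
Qed.

Lemma bump_notin p k x : x \notin `]a, b[%R -> bump p k x = 0.
Proof. by rewrite /bump; case: ifPn => // /bump_arg_gt0 ->. Qed.

Lemma bump_bound x : 0 <= bump 1 0 x <= 1.
Proof.
rewrite /bump; case: ifPn => [s0|_]; last by rewrite lexx ler01.
rewrite hornerE expr0 divr1 mul1r expR_ge0/= -[leRHS](@expR0 R) ler_expR.
by rewrite oppr_le0 divr_ge0// ltW.
Qed.

End bump.

Section weak_derivatives.
Context {R : realType}.
Notation mu := (@lebesgue_measure R).
Implicit Types (u du ddu w phi : R -> R) (a b x y : R).

Lemma locally_integrable_itv u a b : locally_integrable setT u ->
  mu.-integrable `[a, b] (EFin \o u).
Proof.
move=> [mf _ h]; apply/integrableP; split.
  by apply/measurable_EFinP; exact: measurable_funTS.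
by apply: h => //; exact: segment_compact.
Qed.

Lemma bump_int_cvg u a b : a < b -> locally_integrable setT u ->
  \int[mu]_x (u x * bump a b (n.+1%:R^-1) 1 0 x) @[n --> \oo] -->
  \int[mu]_(x in `]a, b[) u x.
Proof.
move=> ab lu; have mi : measurable `]a, b[%classic by [].
have iu : mu.-integrable `]a, b[ (EFin \o u).
  apply: integrableS (locally_integrable_itv a b lu) => //.
  exact: subset_itv_oo_cc.
have mu_ : measurable_fun `]a, b[ u.
  by case: lu => [mf _ _]; exact: measurable_funTS.
have n0 n : 0 < (n.+1%:R^-1 : R) by rewrite invr_gt0.
pose f_ n x := (u x * bump a b (n.+1%:R^-1) 1 0 x)%:E.
have mb n : measurable_fun setT (bump a b (n.+1%:R^-1) 1 0).
  apply: continuous_measurable_fun => x.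
  exact: is_derive_continuous (bump_derive a b (n0 n) 1 0 x).
have mf_ n : measurable_fun `]a, b[ (f_ n).
  apply/measurable_EFinP; apply: measurable_funM => //.
  exact: measurable_funTS.
have ff : {ae mu, forall x, `]a, b[%classic x -> f_ ^~ x @ \oo --> (u x)%:E}.
  apply: aeW => x xab; apply: cvg_EFin; first by near=> n.
  rewrite -[X in _ --> X]mulr1; apply: cvgM; first exact: cvg_cst.
  have s0 := bump_arg_itv xab.
  have h : (fun n : nat => bump a b (n.+1%:R^-1) 1 0 x) =
      (fun n => expR (- (n.+1%:R^-1 * (bump_arg a b x)^-1))).
    by apply/funext => n; rewrite /bump s0 hornerE expr0 divr1 mul1r.
  rewrite h -[X in _ --> X](@expR0 R).
  apply: (@cvg_comp _ _ _ (fun n : nat => - (n.+1%:R^-1 * (bump_arg a b x)^-1))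
     expR _ (nbhs 0)); last exact: continuous_expR.
  rewrite (_ : 0 = - (0 * (bump_arg a b x)^-1)); last by rewrite mul0r oppr0.
  by apply: cvgN; apply: cvgM; [exact: cvg_harmonic|exact: cvg_cst].
have dom : {ae mu, forall x n, `]a, b[%classic x -> (`|f_ n x| <= (abse \o (EFin \o u)) x)%E}.
  apply: aeW => x n _; rewrite /f_ /= lee_fin normrM ler_piMr//.
  have /andP[h0 h1] := bump_bound a b (n0 n) x.
  by rewrite ger0_norm.
have mue : measurable_fun `]a, b[ (EFin \o u) by exact/measurable_EFinP.
have [_ _ H] := @dominated_convergence _ _ _ mu _ mi f_ (EFin \o u)
  (abse \o (EFin \o u)) mf_ mue ff (integrable_abse iu) dom.
have E n : \int[mu]_x (u x * bump a b (n.+1%:R^-1) 1 0 x) =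
    \int[mu]_(x in `]a, b[) (u x * bump a b (n.+1%:R^-1) 1 0 x).
  rewrite [RHS]Rintegral_mkcond; apply: eq_Rintegral => x _.
  rewrite patchE; case: ifPn => // xab.
  by rewrite (@bump_notin _ a b _ ab) ?mulr0//; apply: contra xab => xab; rewrite inE.
rewrite (_ : (fun n => _) = (fun n => \int[mu]_(x in `]a, b[) (u x * bump a b (n.+1%:R^-1) 1 0 x))); last exact/funext.
rewrite /Rintegral; apply: fine_cvg; rewrite fineK//.
exact: integrable_fin_num.
Unshelve. all: by end_near. Qed.

(** Testing against bumps that tend to an indicator gives equal integrals over all intervals; at
    common Lebesgue points the derivative of the indefinite integral recovers both functions. *)
Lemma weak_derivative_unique n u w1 w2 :
  weak_derivative n u w1 -> weak_derivative n u w2 ->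
  {ae mu, forall x, w1 x = w2 x}.
Proof.
move=> [_ l1 H1] [_ l2 H2].
have I a b : a < b -> \int[mu]_(x in `]a, b[) w1 x = \int[mu]_(x in `]a, b[) w2 x.
  move=> ab; have c1 := bump_int_cvg ab l1; have c2 := bump_int_cvg ab l2.
  have E : (fun m : nat => \int[mu]_x (w1 x * bump a b (m.+1%:R^-1) 1 0 x)) =
           (fun m : nat => \int[mu]_x (w2 x * bump a b (m.+1%:R^-1) 1 0 x)).
    apply/funext => m.
    have m0 : 0 < (m.+1%:R^-1 : R) by rewrite invr_gt0.
    have t := bump_test m0 ab 1 0.
    have s0 : (-1) ^+ n != 0 :> R by rewrite expf_neq0// oppr_eq0 oner_eq0.
    by apply: (mulfI s0); rewrite -(H1 _ t) -(H2 _ t).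
  by rewrite E in c1; exact: (cvg_unique _ c1 c2).
have I' a b : \int[mu]_(x in `]a, b]) w1 x = \int[mu]_(x in `]a, b]) w2 x.
  have [ab|ba] := ltP a b; last first.
    by rewrite set_itv_ge -?leNgt ?bnd_simp// !Rintegral_set0.
  have ii w : locally_integrable setT w -> mu.-integrable `]a, b[ (EFin \o w).
    move=> lw; apply: integrableS (locally_integrable_itv a b lw) => //.
    exact: subset_itv_oo_cc.
  by rewrite -!Rintegral_itv_bndo_bndc ?I//; exact: ii.
have L1 := lebesgue_differentiation l1; have L2 := lebesgue_differentiation l2.
apply: (@filterS2 _ _ (ae_filter_ringOfSetsType mu) _ _ _ _ L1 L2) => x p1 p2.
have ii w : locally_integrable setT w -> mu.-integrable `](x - 1), (x + 1)] (EFin \o w).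
  move=> lw; apply: integrableS (locally_integrable_itv (x - 1) (x + 1) lw) => //.
  exact: subset_itv_oc_cc.
have xx : x < x + 1 by rewrite ltrDl.
have ax : (BRight (x - 1) < BRight x)%O by rewrite bnd_simp ltrBlDr ltrDl.
have [_ e1] := FTC1_lebesgue_pt xx (ii _ l1) ax p1.
have [_ e2] := FTC1_lebesgue_pt xx (ii _ l2) ax p2.
rewrite -e1 -e2; congr (derive1 _ x); apply/funext => y; exact: I'.
Qed.

Lemma wderiv_ae n u w : weak_derivative n u w ->
  {ae mu, forall x, wderiv n u x = w x}.
Proof.
move=> uw; have := getPex (ex_intro [set w | weak_derivative n u w] w uw).
by move=> h; exact: weak_derivative_unique h uw.
Qed.

Lemma continuous_locally_integrable u : continuous u -> locally_integrable setT u.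
Proof.
move=> cu; split; [exact: continuous_measurable_fun|exact: openT|].
move=> K _ cK; have /integrableP[_ h] : mu.-integrable K (EFin \o u).
  by apply: continuous_compact_integrable => //; exact: continuous_subspaceT.
exact: h.
Qed.

Lemma test_derive phi : test_function phi -> test_function (derive1 phi).
Proof.
move=> [d K]; split.
  by move=> n x; rewrite -derive1Sn; exact: d.
apply: subclosed_compact K _; first exact: closed_closure.
rewrite [X in _ `<=` X](closure_id _).1; last exact: closed_closure.
apply: closureS => x /=; apply: contra_neqP => nx.
have nz : \forall y \near x, phi y = 0.
  have : open (~` closure [set x | phi x != 0]).
    by rewrite openC; exact: closed_closure.
  rewrite openE => /(_ x nx); apply: filterS => y ny.
  apply/eqP; apply: contra_notT ny => ny; exact: subset_closure.
rewrite derive1E (near_eq_derive _ nz) derive_cst//.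
Qed.

Lemma test_continuous phi : test_function phi -> continuous phi.
Proof.
move=> [d _] x; have := d 0 x; rewrite derive1n0 => h.
exact/differentiable_continuous/derivable1_diffP.
Qed.

Lemma test_is_derive phi x : test_function phi -> is_derive x 1 phi (derive1 phi x).
Proof.
move=> [d _]; apply: DeriveDef; last by rewrite derive1E.
by have := d 0 x; rewrite derive1n0.
Qed.

Lemma test_support phi : test_function phi ->
  exists2 A, 0 < A & forall x, A <= `|x| -> phi x = 0.
Proof.
move=> [_ /compact_bounded[M [_ HM]]].
exists (`|M| + 1); first by rewrite ltr_wpDl.
move=> x xM; apply/eqP; apply: contraT => px.
have := HM (`|M| + 1 / 2); rewrite (le_lt_trans (ler_norm M)) ?ltrDl//.
  by move=> /(_ isT x (@subset_closure _ [set x | phi x != 0] x px)) /=; lra.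
Qed.

Lemma Rintegral_supported u A : (forall x, A <= `|x| -> u x = 0) ->
  \int[mu]_x u x = \int[mu]_(x in `[- A, A]) u x.
Proof.
move=> uA; rewrite [RHS]Rintegral_mkcond; apply: eq_Rintegral => x _.
rewrite patchE; case: ifPn => // xA; apply: uA.
rewrite leNgt; apply: contra xA; rewrite inE/= in_itv/= ltr_norml => /andP[? ?].
by rewrite !ltW.
Qed.

Lemma test_by_parts u du phi : (forall x, is_derive x 1 u (du x)) ->
  continuous du -> test_function phi ->
  \int[mu]_x (u x * derive1 phi x) = - \int[mu]_x (du x * phi x).
Proof.
move=> hu cdu tp.
have [A A0 HA] := test_support tp; have [B B0 HB] := test_support (test_derive tp).
pose D := Num.max A B.
have DA x : D <= `|x| -> phi x = 0.
  by move=> h; apply: HA; apply: le_trans h; rewrite le_max lexx.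
have DB x : D <= `|x| -> derive1 phi x = 0.
  by move=> h; apply: HB; apply: le_trans h; rewrite le_max lexx orbT.
have D0 : 0 < D by rewrite lt_max A0.
have DD : - D <= D by lra.
rewrite (@Rintegral_supported _ D); last by move=> x /DB ->; rewrite mulr0.
rewrite (@Rintegral_supported _ D); last by move=> x /DA ->; rewrite mulr0.
have cu : continuous u by move=> x; exact: is_derive_continuous (hu x).
have cp := test_continuous tp; have cdp := test_continuous (test_derive tp).
have c1 : {in `[- D, D]%R, continuous (fun x => u x * derive1 phi x)}.
  by move=> x _; apply: cvgM; [exact: cu|exact: cdp].
have c2 : {in `[- D, D]%R, continuous (fun x => du x * phi x)}.
  by move=> x _; apply: cvgM; [exact: cdu|exact: cp].
apply/eqP; rewrite -subr_eq0 opprK -seg_intD//.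
rewrite (@seg_FTC2 R (- D) D _ (fun x => u x * phi x) DD).
- by rewrite !DA ?normrN ?gtr0_norm// !mulr0 subrr.
- by move=> x xx; apply: cvgD; [exact: c1|exact: c2].
- move=> x _; have h1 := hu x; have h2 := test_is_derive x tp.
  by apply: is_derive_eq; rewrite /GRing.scale/=; ring.
Qed.

Lemma weak_derivative0 u : continuous u -> weak_derivative 0 u u.
Proof.
move=> cu; split; [exact: continuous_locally_integrable..|].
by move=> phi _; rewrite derive1n0 expr0 mul1r.
Qed.

Lemma weak_derivative1 u du : (forall x, is_derive x 1 u (du x)) ->
  continuous du -> weak_derivative 1 u du.
Proof.
move=> hu cdu; have cu : continuous u by move=> x; exact: is_derive_continuous (hu x).
split; [exact: continuous_locally_integrable..|].
by move=> phi tp; rewrite derive1n1 expr1 mulN1r; exact: test_by_parts.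
Qed.

Lemma weak_derivative2 u du ddu : (forall x, is_derive x 1 u (du x)) ->
  (forall x, is_derive x 1 du (ddu x)) -> continuous ddu ->
  weak_derivative 2 u ddu.
Proof.
move=> hu hdu cddu; have cu : continuous u by move=> x; exact: is_derive_continuous (hu x).
have cdu : continuous du by move=> x; exact: is_derive_continuous (hdu x).
split; [exact: continuous_locally_integrable..|].
move=> phi tp; rewrite derive1nS derive1n1 sqrrN expr1n mul1r.
rewrite (test_by_parts hu cdu (test_derive tp)) (test_by_parts hdu cddu tp).
by rewrite opprK.
Qed.

Lemma weak_wderiv n u w : weak_derivative n u w -> weak_derivative n u (wderiv n u).
Proof. by move=> uw; exact: (getPex (ex_intro [set w | weak_derivative n u w] w uw)). Qed.

Lemma measurable_abs_powR (p : R) u : measurable_fun setT u ->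
  measurable_fun setT (fun x => `|u x| `^ p).
Proof.
move=> mu_; apply: (measurableT_comp (measurable_powR p)).
exact: (measurableT_comp (@normr_measurable R setT)).
Qed.

Lemma continuous_Lp_loc (p : R) u : 0 <= p -> continuous u -> Lp_loc p u.
Proof.
move=> p0 cu; have mu_ : measurable_fun setT u by exact: continuous_measurable_fun.
split => // K cK; have mK := compact_measurable cK.
have : mu.-integrable K (EFin \o (fun x => `|u x| `^ p)).
  apply: measurable_bounded_integrable => //.
  - exact: compact_finite_measure.
  - by apply: measurable_funTS; exact: measurable_abs_powR.
  have /compact_bounded[M [_ HM]] := continuous_compact (continuous_subspaceT cu) cK.
  exists ((`|M| + 1) `^ p); split; first exact: num_real.
  move=> y My x Kx /=; rewrite ger0_norm ?powR_ge0//; apply: le_trans (ltW My).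
  apply: ge0_ler_powR => //; rewrite ?nnegrE ?addr_ge0//.
  apply: HM; last by exists x.
  by rewrite (le_lt_trans (ler_norm M))// ltrDl.
move=> /integrableP[_]; congr (_ < _)%E; apply: eq_integral => x _ /=.
by rewrite ger0_norm ?powR_ge0.
Qed.

Lemma W2_perI (p k0 : R) u du ddu : 0 <= p -> (forall x, is_derive x 1 u (du x)) ->
  (forall x, is_derive x 1 du (ddu x)) -> continuous ddu ->
  periodic u (2 * pi / k0) -> W2_per p k0 u.
Proof.
move=> p0 hu hdu cddu per.
have cu : continuous u by move=> x; exact: is_derive_continuous (hu x).
have cdu : continuous du by move=> x; exact: is_derive_continuous (hdu x).
split => // -[|[|[|//]]] _.
- by exists u; [exact: weak_derivative0|exact: continuous_Lp_loc].
- by exists du; [exact: weak_derivative1|exact: continuous_Lp_loc].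
- by exists ddu; [exact: weak_derivative2 hu hdu _|exact: continuous_Lp_loc].
Qed.

(** [wderiv] is a choice within an almost-everywhere class; this lets norms be computed with any
    explicit weak derivative. *)
Lemma integral_wderiv (p : R) n u w (D : set R) : measurable D ->
  weak_derivative n u w ->
  (\int[mu]_(x in D) (`|wderiv n u x| `^ p)%:E =
   \int[mu]_(x in D) (`|w x| `^ p)%:E)%E.
Proof.
move=> mD uw; have [_ [m1 _ _] _] := weak_wderiv uw.
have [_ [m2 _ _] _] := uw.
apply: ge0_ae_eq_integral => //.
- by apply/measurable_EFinP; apply: measurable_funTS; exact: measurable_abs_powR.
- by apply/measurable_EFinP; apply: measurable_funTS; exact: measurable_abs_powR.
- apply: filterS (wderiv_ae uw); first exact: (ae_filter_ringOfSetsType mu).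
  by move=> x /= -> _.
Qed.

Lemma W2_norm_le (p k0 A : R) u du ddu : 0 < p ->
  (forall x, is_derive x 1 u (du x)) ->
  (forall x, is_derive x 1 du (ddu x)) -> continuous ddu ->
  (\int[mu]_(x in `](- (pi / k0))%R, (pi / k0)%R[) (`|u x| `^ p)%:E
    + \int[mu]_(x in `](- (pi / k0))%R, (pi / k0)%R[) (`|du x| `^ p)%:E
    + \int[mu]_(x in `](- (pi / k0))%R, (pi / k0)%R[) (`|ddu x| `^ p)%:E
    <= A%:E)%E ->
  (W2_norm p k0 u <= (A `^ p^-1)%:E)%E.
Proof.
move=> p0 hu hdu cddu.
have cdu : continuous du by move=> x; exact: is_derive_continuous (hdu x).
rewrite /W2_norm (integral_wderiv p _ (weak_derivative1 hu cdu))//.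
rewrite (integral_wderiv p _ (weak_derivative2 hu hdu cddu))//.
set I := (X in (X <= _)%E) => IA.
have I0 : (0 <= I)%E.
  have J0 (f : R -> R) : (0 <= \int[mu]_(x in `](- (pi / k0))%R, (pi / k0)%R[) (`|f x| `^ p)%:E)%E.
    by apply: integral_ge0 => x _; rewrite lee_fin powR_ge0.
  by rewrite /I; apply: adde_ge0; first apply: adde_ge0; exact: J0.
rewrite -poweR_EFin; apply: gt0_ler_poweR => //.
- by rewrite invr_ge0 ltW.
- by rewrite in_itv/= I0 leey.
- by rewrite in_itv/= (le_trans I0 IA) leey.
Qed.

Lemma int_powR_le (p c d : R) (f : R -> R) : 0 <= p -> 0 < c -> 0 <= d -> continuous f ->
  {in `[- c, c]%R, forall x, `|f x| <= d} ->
  (\int[mu]_(x in `](- c)%R, c[) (`|f x| `^ p)%:E <= (2 * c * d `^ p)%:E)%E.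
Proof.
move=> p0 c0 d0 cf fd.
apply: (@le_trans _ _ (\int[mu]_(x in `](- c)%R, c[) (d `^ p)%:E)%E).
  apply: ge0_le_integral => //.
  - by apply/measurable_EFinP; apply: measurable_funTS; apply: measurable_abs_powR;
      exact: continuous_measurable_fun.
  - move=> x xx; rewrite lee_fin; apply: ge0_ler_powR; rewrite ?nnegrE//.
    by apply: fd; exact: subset_itv_oo_cc xx.
rewrite integral_cst//= lebesgue_measure_itv/= lte_fin ifT; last first.
  by rewrite ltrNl (lt_trans _ c0)// oppr_lt0.
by rewrite -EFinB -EFinM lee_fin opprK -mulr2n -[_ *+ 2]mulr_natl mulrC.
Qed.

(** Three squared terms over an interval of length 2 pi / k0 give the factor 6. *)
Lemma H2_norm_le (k0 d : R) u du ddu : 0 < k0 -> 0 <= d ->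
  (forall x, is_derive x 1 u (du x)) ->
  (forall x, is_derive x 1 du (ddu x)) -> continuous ddu ->
  {in `[- (pi / k0), pi / k0]%R, forall x,
    [/\ `|u x| <= d, `|du x| <= d & `|ddu x| <= d]} ->
  (H2_norm k0 u <= (Num.sqrt (6 * (pi / k0)) * d)%:E)%E.
Proof.
move=> k00 d0 hu hdu cddu H.
have L0 : 0 < pi / k0 by rewrite divr_gt0// pi_gt0.
have cu : continuous u by move=> x; exact: is_derive_continuous (hu x).
have cdu : continuous du by move=> x; exact: is_derive_continuous (hdu x).
have p20 : (0 : R) < 2 by [].
have B (f : R -> R) : continuous f ->
    {in `[- (pi / k0), pi / k0]%R, forall x, `|f x| <= d} ->
    (\int[mu]_(x in `](- (pi / k0))%R, (pi / k0)%R[) (`|f x| `^ 2)%:E <=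
      (2 * (pi / k0) * d ^+ 2)%:E)%E.
  by move=> cf fd; rewrite -(powR_mulrn _ d0); exact: int_powR_le.
have := @W2_norm_le 2 k0 (6 * (pi / k0) * d ^+ 2) u du ddu p20 hu hdu cddu.
rewrite powR12_sqrt; last by rewrite mulr_ge0 ?sqr_ge0// mulr_ge0// ltW.
rewrite sqrtrM; last by rewrite mulr_ge0// ltW.
rewrite sqrtr_sqr (ger0_norm d0); apply.
have -> : (6 * (pi / k0) * d ^+ 2)%:E =
  ((2 * (pi / k0) * d ^+ 2)%:E + (2 * (pi / k0) * d ^+ 2)%:E
    + (2 * (pi / k0) * d ^+ 2)%:E)%E :> \bar R.
  by rewrite -!EFinD; congr EFin; ring.
by apply: leeD; [apply: leeD|]; apply: B => // x xx; have [] := H x xx.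
Qed.

End weak_derivatives.

(** * Expansions at the trivial state *)

Section SD.
Context {R : realType}.
Notation mu := (@lebesgue_measure R).
Notation V3 := (R * R * R)%type.
Implicit Types (Y Z l : V3) (a b x y : R).

Definition nrm Y : R := `|Y.1.1| + `|Y.1.2| + `|Y.2|.
Definition dst Y Z : R := `|Z.1.1 - Y.1.1| + `|Z.1.2 - Y.1.2| + `|Z.2 - Y.2|.
Definition dot l Y Z : R :=
  l.1.1 * (Z.1.1 - Y.1.1) + l.1.2 * (Z.1.2 - Y.1.2) + l.2 * (Z.2 - Y.2).
Definition zero3 : V3 := (0, 0, 0).
Definition lin3 a l b l' : V3 :=
  (a * l.1.1 + b * l'.1.1, a * l.1.2 + b * l'.1.2, a * l.2 + b * l'.2).

(* First-order expansion at the origin whose remainder is small also for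
   differences of values; it holds uniformly for the indices in [D]. *)
Definition SD (I : Type) (D : I -> Prop) (f : I -> V3 -> R) (f0 : I -> R)
    (l : I -> V3) : Prop :=
  exists C r : R, [/\ 0 <= C, 0 < r, r <= 1 & forall i, D i ->
    [/\ `|f0 i| <= C, nrm (l i) <= C, f i zero3 = f0 i &
     forall Y Z, nrm Y <= r -> nrm Z <= r ->
       `|f i Z - f i Y - dot (l i) Y Z| <= C * (nrm Y + nrm Z) * dst Y Z]].

Lemma nrm_ge0 Y : 0 <= nrm Y. Proof. by rewrite /nrm !addr_ge0. Qed.
Lemma dst_ge0 Y Z : 0 <= dst Y Z. Proof. by rewrite /dst !addr_ge0. Qed.
Lemma nrm0 : nrm zero3 = 0. Proof. by rewrite /nrm /= !normr0 !addr0. Qed.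
Lemma dst0 Y : dst zero3 Y = nrm Y. Proof. by rewrite /dst /nrm /= !subr0. Qed.

Lemma dot_le l Y Z : `|dot l Y Z| <= nrm l * dst Y Z.
Proof.
rewrite /dot; apply: le_trans (ler_normD _ _) _.
apply: (le_trans (lerD (ler_normD _ _) (lexx _))); rewrite !normrM.
set a := `|l.1.1|; set b := `|l.1.2|; set c := `|l.2|.
rewrite /nrm /dst -/a -/b -/c.
set p := `|_ - _|; set q := `|Z.1.2 - _|; set s := `|Z.2 - _|.
have [ha hb hc] : [/\ 0 <= a, 0 <= b & 0 <= c] by rewrite !normr_ge0.
have [hp hq hs] : [/\ 0 <= p, 0 <= q & 0 <= s] by rewrite !normr_ge0.
have := mulr_ge0 ha hq; have := mulr_ge0 ha hs; have := mulr_ge0 hb hp.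
have := mulr_ge0 hb hs; have := mulr_ge0 hc hp; have := mulr_ge0 hc hq.
lra.
Qed.

Lemma nrm_lin3 a l b l' : nrm (lin3 a l b l') <= `|a| * nrm l + `|b| * nrm l'.
Proof.
rewrite /nrm /lin3 /=.
have h x y := ler_normD (a * x) (b * y).
have := h l.1.1 l'.1.1; have := h l.1.2 l'.1.2; have := h l.2 l'.2.
by rewrite !normrM; lra.
Qed.

Lemma dot_lin3 a l b l' Y Z :
  dot (lin3 a l b l') Y Z = a * dot l Y Z + b * dot l' Y Z.
Proof. by rewrite /dot /lin3 /=; ring. Qed.

Lemma ge_half (m C n y y0 : R) : 0 <= C -> 0 <= n -> m <= y0 ->
  n <= m / (2 * (C + 1)) -> `|y - y0| <= C * n -> m / 2 <= y.
Proof.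
move=> C0 n0 my0; rewrite ler_pdivlMr ?ler_norml; last by lra.
have Cn := mulr_ge0 C0 n0; move=> nm /andP[h _]; lra.
Qed.

Section SD_ops.
Variables (I : Type) (D : I -> Prop).

Lemma SD_lip f f0 k : SD D f f0 k ->
  exists C r : R, [/\ 0 <= C, 0 < r, r <= 1 & forall i, D i ->
   [/\ `|f0 i| <= C, nrm (k i) <= C, f i zero3 = f0 i &
    forall Y Z, nrm Y <= r -> nrm Z <= r ->
     [/\ `|f i Z - f i Y| <= C * dst Y Z,
         `|f i Z - f0 i| <= C * nrm Z, `|f i Y - f0 i| <= C * nrm Y &
      `|f i Z - f i Y - dot (k i) Y Z| <= C * (nrm Y + nrm Z) * dst Y Z]]].
Proof.
(* The Lipschitz constant is [C] from the linear part plus 2 [C] from the remainder, both norms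
   being at most r <= 1. *)
move=> [C [r [C0 r0 r1 H]]]; exists (3 * C), r; split => //; first lra.
move=> i Di; have [h0 hk hz hr] := H i Di; split => //; [lra|lra|].
have lip Y Z : nrm Y <= r -> nrm Z <= r -> `|f i Z - f i Y| <= 3 * C * dst Y Z.
  move=> nY nZ; have h1 := hr Y Z nY nZ; have h2 := dot_le (k i) Y Z.
  have d0 := dst_ge0 Y Z.
  have -> : f i Z - f i Y = (f i Z - f i Y - dot (k i) Y Z) + dot (k i) Y Z by ring.
  apply: le_trans (ler_normD _ _) _.
  have h3 := ler_wpM2r d0 hk.
  have h4 : C * (nrm Y + nrm Z) * dst Y Z <= C * 2 * dst Y Z.
    by rewrite ler_wpM2r// ler_wpM2l//; lra.
  lra.
have n0 : nrm zero3 <= r by rewrite nrm0 ltW.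
move=> Y Z nY nZ; split; first exact: lip.
- by rewrite -hz -dst0; exact: lip.
- by rewrite -hz -dst0; exact: lip.
- apply: le_trans (hr Y Z nY nZ) _; rewrite ler_wpM2r ?dst_ge0//.
  by rewrite ler_wpM2r ?addr_ge0 ?nrm_ge0//; lra.
Qed.

Lemma SD_eq f f' f0 f0' k k' : SD D f f0 k ->
  (forall i Y, D i -> f i Y = f' i Y) -> (forall i, D i -> f0 i = f0' i) ->
  (forall i, D i -> k i = k' i) -> SD D f' f0' k'.
Proof.
move=> [C [r [C0 r0 r1 H]]] ef e0 ek; exists C, r; split => // i Di.
have [h0 hk hz hr] := H i Di; rewrite -e0// -ek// -ef//; split => // Y Z nY nZ.
by rewrite -!ef//; exact: hr.
Qed.

Lemma SD_cst f0 : (exists C, forall i, D i -> `|f0 i| <= C) ->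
  SD D (fun i _ => f0 i) f0 (fun=> zero3).
Proof.
move=> [C H]; exists `|C|, 1; split => // i Di; split => //.
- exact: le_trans (H i Di) (ler_norm _).
- by rewrite nrm0.
- move=> Y Z _ _; rewrite subrr /dot /= !mul0r !addr0 subr0 normr0.
  by rewrite !mulr_ge0 ?addr_ge0 ?nrm_ge0 ?dst_ge0.
Qed.

Lemma SD_coord (l : V3) : SD D (fun _ Y => dot l zero3 Y) (fun=> 0) (fun=> l).
Proof.
exists (nrm l), 1; split; rewrite ?nrm_ge0// => i Di; split => //.
- by rewrite normr0 nrm_ge0.
- by rewrite /dot /= !subrr !mulr0 !addr0.
- move=> Y Z _ _; rewrite (_ : _ - _ = 0); last by rewrite /dot /=; ring.
  by rewrite normr0 !mulr_ge0 ?addr_ge0 ?nrm_ge0 ?dst_ge0.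
Qed.

Lemma SD_add f g f0 g0 k h : SD D f f0 k -> SD D g g0 h ->
  SD D (fun i Y => f i Y + g i Y) (fun i => f0 i + g0 i)
    (fun i => lin3 1 (k i) 1 (h i)).
Proof.
move=> [C [r [C0 r0 r1 H]]] [C' [r' [C0' r0' r1' H']]].
exists (C + C'), (Num.min r r'); split.
- by rewrite addr_ge0.
- by rewrite lt_min r0 r0'.
- by rewrite ge_min r1.
move=> i Di; have [a1 a2 a3 a4] := H i Di; have [b1 b2 b3 b4] := H' i Di; split.
- by have := ler_normD (f0 i) (g0 i); lra.
- by have := nrm_lin3 1 (k i) 1 (h i); rewrite normr1; lra.
- by rewrite a3 b3.
- move=> Y Z; rewrite !le_min => /andP[y1 y2] /andP[z1 z2].
  have h1 := a4 Y Z y1 z1; have h2 := b4 Y Z y2 z2.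
  rewrite dot_lin3 !mul1r.
  have -> : f i Z + g i Z - (f i Y + g i Y) - (dot (k i) Y Z + dot (h i) Y Z) =
   (f i Z - f i Y - dot (k i) Y Z) + (g i Z - g i Y - dot (h i) Y Z) by ring.
  by apply: le_trans (ler_normD _ _) _; lra.
Qed.

Lemma SD_mul f g f0 g0 k h : SD D f f0 k -> SD D g g0 h ->
  SD D (fun i Y => f i Y * g i Y) (fun i => f0 i * g0 i)
    (fun i => lin3 (g0 i) (k i) (f0 i) (h i)).
Proof.
move=> /SD_lip[C [r [C0 r0 r1 H]]] /SD_lip[C' [r' [C0' r0' r1' H']]].
have CC : 0 <= C * C' by rewrite mulr_ge0.
exists (4 * (C * C')), (Num.min r r'); split.
- lra.
- by rewrite lt_min r0 r0'.
- by rewrite ge_min r1.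
move=> i Di; have [a1 a2 a3 a4] := H i Di; have [b1 b2 b3 b4] := H' i Di; split.
- by rewrite normrM; have := ler_pM (normr_ge0 _) (normr_ge0 _) a1 b1; lra.
- have := nrm_lin3 (g0 i) (k i) (f0 i) (h i).
  have := ler_pM (normr_ge0 _) (nrm_ge0 _) b1 a2.
  have := ler_pM (normr_ge0 _) (nrm_ge0 _) a1 b2; lra.
- by rewrite a3 b3.
- move=> Y Z; rewrite !le_min => /andP[y1 y2] /andP[z1 z2].
  have [p1 p2 p3 p4] := a4 Y Z y1 z1; have [q1 q2 q3 q4] := b4 Y Z y2 z2.
  rewrite dot_lin3; have d0 := dst_ge0 Y Z.
  have nY := nrm_ge0 Y; have nZ := nrm_ge0 Z.
  have -> : f i Z * g i Z - f i Y * g i Y -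
     (g0 i * dot (k i) Y Z + f0 i * dot (h i) Y Z) =
   g0 i * (f i Z - f i Y - dot (k i) Y Z) + f0 i * (g i Z - g i Y - dot (h i) Y Z)
   + (f i Z - f0 i) * (g i Z - g i Y) + (g i Y - g0 i) * (f i Z - f i Y) by ring.
  apply: le_trans (ler_normD _ _) _.
  apply: (le_trans (lerD (ler_normD _ _) (lexx _))).
  apply: (le_trans (lerD (lerD (ler_normD _ _) (lexx _)) (lexx _))).
  rewrite !normrM.
  have t1 := ler_pM (normr_ge0 _) (normr_ge0 _) b1 p4.
  have t2 := ler_pM (normr_ge0 _) (normr_ge0 _) a1 q4.
  have t3 := ler_pM (normr_ge0 _) (normr_ge0 _) p2 q1.
  have t4 := ler_pM (normr_ge0 _) (normr_ge0 _) q3 p1.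
  have u1 := mulr_ge0 (mulr_ge0 CC nY) d0.
  have u2 := mulr_ge0 (mulr_ge0 CC nZ) d0.
  by clear -t1 t2 t3 t4 u1 u2; lra.
Qed.

(** Chain rule. Base values are at least [m], and the radius is shrunk until all values are at least
    m / 2 ([ge_half]), where [phi] satisfies its own two-point estimate. *)
Lemma SD_comp (phi dphi : R -> R) (m K : R) f f0 k : 0 < m -> 0 <= K ->
  (forall y0 y1 y2, m <= y0 -> m / 2 <= y1 -> m / 2 <= y2 ->
     `|phi y2 - phi y1 - dphi y0 * (y2 - y1)| <=
       K * (`|y1 - y0| + `|y2 - y0|) * `|y2 - y1|) ->
  (forall C, exists C', forall y, m <= y -> `|y| <= C ->
     `|phi y| <= C' /\ `|dphi y| <= C') ->
  (forall i, D i -> m <= f0 i) -> SD D f f0 k ->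
  SD D (fun i Y => phi (f i Y)) (fun i => phi (f0 i))
    (fun i => lin3 (dphi (f0 i)) (k i) 0 zero3).
Proof.
move=> m0 K0 Hphi Hb fm /SD_lip[C [r [C0 r0 r1 H]]].
have [C' HC'] := Hb C.
pose r' := Num.min r (m / (2 * (C + 1))).
have C10 : 0 < 2 * (C + 1) by lra.
have r'0 : 0 < r' by rewrite lt_min r0 divr_gt0.
have CA : 0 <= `|C'| by [].
exists (`|C'| * (C + 1) + `|C'| + K * C * C), r'; split => //.
- by rewrite !addr_ge0 ?mulr_ge0 ?addr_ge0.
- by rewrite ge_min r1.
move=> i Di; have [a1 a2 a3 a4] := H i Di; have f0m := fm i Di.
have [b1 b2] := HC' (f0 i) f0m a1.
have b1' := le_trans b1 (ler_norm C'); have b2' := le_trans b2 (ler_norm C').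
have KC0 : 0 <= K * C * C by rewrite !mulr_ge0.
have CC0 : 0 <= `|C'| * C by rewrite mulr_ge0.
have CC1 : 0 <= `|C'| * (C + 1) by rewrite mulr_ge0// addr_ge0.
split.
- by apply: (le_trans b1'); rewrite addrAC lerDr addr_ge0.
- apply: (le_trans (nrm_lin3 _ _ _ _)); rewrite normr0 mul0r addr0.
  have b3 := ler_pM (normr_ge0 _) (nrm_ge0 _) b2' a2.
  by clear -b3 KC0 CA; lra.
- by rewrite a3.
- move=> Y Z; rewrite !le_min => /andP[y1 y2] /andP[z1 z2].
  have [p1 p2 p3 p4] := a4 Y Z y1 z1.
  have d0 := dst_ge0 Y Z; have nY := nrm_ge0 Y; have nZ := nrm_ge0 Z.
  have fYm := ge_half C0 nY f0m y2 p3; have fZm := ge_half C0 nZ f0m z2 p2.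
  have h := Hphi _ _ _ f0m fYm fZm.
  rewrite dot_lin3 mul0r addr0.
  have -> : phi (f i Z) - phi (f i Y) - dphi (f0 i) * dot (k i) Y Z =
    (phi (f i Z) - phi (f i Y) - dphi (f0 i) * (f i Z - f i Y)) +
    dphi (f0 i) * (f i Z - f i Y - dot (k i) Y Z) by ring.
  apply: le_trans (ler_normD _ _) _; rewrite normrM.
  have t1 := ler_pM (normr_ge0 _) (normr_ge0 _) b2' p4.
  have t2 : K * (`|f i Y - f0 i| + `|f i Z - f0 i|) * `|f i Z - f i Y| <=
     K * (C * nrm Y + C * nrm Z) * (C * dst Y Z).
    apply: ler_pM => //; first by rewrite mulr_ge0 ?addr_ge0.
    by rewrite ler_wpM2l// lerD.
  have u1 := mulr_ge0 (mulr_ge0 CA (addr_ge0 nY nZ)) d0.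
  have u2 := mulr_ge0 (mulr_ge0 CC0 (addr_ge0 nY nZ)) d0.
  by clear -h t1 t2 u1 u2; lra.
Qed.

Lemma SD_inv (m : R) f f0 k : 0 < m -> (forall i, D i -> m <= f0 i) ->
  SD D f f0 k ->
  SD D (fun i Y => (f i Y)^-1) (fun i => (f0 i)^-1)
    (fun i => lin3 (- (f0 i ^+ 2)^-1) (k i) 0 zero3).
Proof.
move=> m0 fm; have mi0 : 0 < m^-1 by rewrite invr_gt0.
pose q := m^-1.
apply: (@SD_comp (fun y => y^-1) (fun y => - (y ^+ 2)^-1) m (4 * (q * q * q))) => //.
- by rewrite !mulr_ge0// ltW.
- move=> y0 y1 y2 h0 h1 h2.
  have y00 : 0 < y0 by lra.
  have y10 : 0 < y1 by lra.
  have y20 : 0 < y2 by lra.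
  have -> : y2^-1 - y1^-1 - - (y0 ^+ 2)^-1 * (y2 - y1) =
    (y2^-1 * y0^-1 * y0^-1 * (y2 - y0) + y2^-1 * y1^-1 * y0^-1 * (y1 - y0)) * (y2 - y1)
    * 1 - 0 by field; rewrite !lt0r_neq0.
  rewrite mulr1 subr0 normrM ler_wpM2r//.
  have i0 : y0^-1 <= q by apply: inv_le.
  have i1 : y1^-1 <= 2 * q.
    by rewrite -[2 * q]invrK invfM invrK mulrC; apply: inv_le => //; lra.
  have i2 : y2^-1 <= 2 * q.
    by rewrite -[2 * q]invrK invfM invrK mulrC; apply: inv_le => //; lra.
  have [j0 j1 j2] : [/\ 0 < y0^-1, 0 < y1^-1 & 0 < y2^-1] by rewrite !invr_gt0.
  have q0 : 0 < q by [].
  have e1 : y2^-1 * y0^-1 * y0^-1 <= 4 * (q * q * q).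
    have : y2^-1 * y0^-1 * y0^-1 <= 2 * q * q * q.
      by apply: ler_pM => //; [rewrite mulr_ge0// ltW|exact: ltW|apply: ler_pM => //; exact: ltW].
    have := mulr_gt0 (mulr_gt0 q0 q0) q0; lra.
  have e2 : y2^-1 * y1^-1 * y0^-1 <= 4 * (q * q * q).
    have : y2^-1 * y1^-1 * y0^-1 <= 2 * q * (2 * q) * q.
      by apply: ler_pM => //; [rewrite mulr_ge0// ltW|exact: ltW|apply: ler_pM => //; exact: ltW].
    lra.
  apply: le_trans (ler_normD _ _) _.
  rewrite (normrM _ (y2 - y0)) (normrM _ (y1 - y0)).
  rewrite (gtr0_norm (mulr_gt0 (mulr_gt0 j2 j0) j0)).
  rewrite (gtr0_norm (mulr_gt0 (mulr_gt0 j2 j1) j0)).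
  have := ler_wpM2r (normr_ge0 (y2 - y0)) e1.
  have := ler_wpM2r (normr_ge0 (y1 - y0)) e2.
  lra.
- move=> C; exists (q + q * q) => y my _.
  have y0 : 0 < y by lra.
  have i0 : y^-1 <= q by apply: inv_le.
  have j0 : 0 < y^-1 by rewrite invr_gt0.
  have q0 : 0 < q by [].
  have qq := mulr_gt0 q0 q0.
  rewrite normrN expr2 invfM normrM (gtr0_norm j0); split; first lra.
  have := ler_pM (ltW j0) (ltW j0) i0 i0; lra.
Qed.

Lemma SD_sqrt (m : R) f f0 k : 0 < m -> (forall i, D i -> m <= f0 i) ->
  SD D f f0 k ->
  SD D (fun i Y => Num.sqrt (f i Y)) (fun i => Num.sqrt (f0 i))
    (fun i => lin3 (2 * Num.sqrt (f0 i))^-1 (k i) 0 zero3).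
Proof.
move=> m0 fm; pose s := Num.sqrt (m / 2).
have m20 : 0 < m / 2 by lra.
have s0 : 0 < s by rewrite sqrtr_gt0.
have si0 : 0 < s^-1 by rewrite invr_gt0.
pose q := s^-1.
have sq_ge y : m / 2 <= y -> [/\ 0 < Num.sqrt y, s <= Num.sqrt y &
    Num.sqrt y * Num.sqrt y = y].
  move=> h; have y0 : 0 < y by lra.
  split; [by rewrite sqrtr_gt0|exact: ler_wsqrtr|].
  by rewrite -expr2 sqr_sqrtr// ltW.
apply: (@SD_comp Num.sqrt (fun y => (2 * Num.sqrt y)^-1) m (q * q * q)) => //.
- by rewrite !mulr_ge0// ltW.
- move=> y0 y1 y2 h0 h1 h2.
  have [a1 a2 a3] := sq_ge y0 ltac:(lra).
  have [b1 b2 b3] := sq_ge y1 h1; have [c1 c2 c3] := sq_ge y2 h2.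
  move: a1 a2 a3 b1 b2 b3 c1 c2 c3.
  set x0 := Num.sqrt y0; set x1 := Num.sqrt y1; set x2 := Num.sqrt y2.
  move=> a1 a2 a3 b1 b2 b3 c1 c2 c3; rewrite -a3 -b3 -c3.
  have p1 : 0 < x1 + x0 by lra.
  have p2 : 0 < x2 + x0 by lra.
  have p3 : 0 < x2 + x1 by lra.
  have -> : x2 - x1 - (2 * x0)^-1 * (x2 * x2 - x1 * x1) =
    (- (2 * x0)^-1 * (x2 + x1)^-1 * ((x1 + x0)^-1 * (x1 * x1 - x0 * x0)
      + (x2 + x0)^-1 * (x2 * x2 - x0 * x0))) * (x2 * x2 - x1 * x1).
    by field; rewrite !lt0r_neq0.
  rewrite normrM ler_wpM2r// normrM mulNr normrN.
  have q0 : 0 < q by [].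
  have inv y : s <= y -> [/\ 0 < y^-1 & y^-1 <= q].
    by move=> h; split; [rewrite invr_gt0; lra|exact: inv_le].
  have [u0 u1] := inv (2 * x0) ltac:(lra).
  have [u2 u3] := inv (x2 + x1) ltac:(lra).
  have [u4 u5] := inv (x1 + x0) ltac:(lra).
  have [u6 u7] := inv (x2 + x0) ltac:(lra).
  rewrite (gtr0_norm (mulr_gt0 u0 u2)) -[leRHS]mulrA.
  apply: ler_pM => //; first by rewrite mulr_ge0// ltW.
    by apply: ler_pM => //; exact: ltW.
  apply: le_trans (ler_normD _ _) _; rewrite (normrM _ (x1 * x1 - _)).
  rewrite (normrM _ (x2 * x2 - _)) (gtr0_norm u4) (gtr0_norm u6).
  have := ler_wpM2r (normr_ge0 (x1 * x1 - x0 * x0)) u5.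
  have := ler_wpM2r (normr_ge0 (x2 * x2 - x0 * x0)) u7.
  lra.
- move=> C; exists (1 + C + q) => y my yC.
  have [a1 a2 a3] := sq_ge y ltac:(lra).
  have q0 : 0 < q by [].
  have u0 : 0 < (2 * Num.sqrt y)^-1 by rewrite invr_gt0; lra.
  rewrite (gtr0_norm a1) (gtr0_norm u0); split.
    have yC' := le_trans (ler_norm y) yC.
    have C0 := le_trans (normr_ge0 _) yC.
    have := sqr_ge0 (Num.sqrt y - 1); rewrite sqrrB mulr1 expr1n mulr2n expr2 a3.
    lra.
  have h : (2 * Num.sqrt y)^-1 <= q by apply: inv_le => //; lra.
  have C0 := le_trans (normr_ge0 _) yC; lra.
Qed.

End SD_ops.

Lemma SD_reindex (I I' : Type) (D : I -> Prop) (D' : I' -> Prop) (h : I' -> I)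
   f f0 k : (forall i, D' i -> D (h i)) -> SD D f f0 k ->
  SD D' (fun i => f (h i)) (fun i => f0 (h i)) (fun i => k (h i)).
Proof.
move=> Dh [C [r [C0 r0 r1 H]]]; exists C, r; split => // i Di.
exact: H (h i) (Dh i Di).
Qed.

Definition int3 a b (k : R -> V3) : V3 :=
  (\int[mu]_(t in `[a, b]) (k t).1.1, \int[mu]_(t in `[a, b]) (k t).1.2,
   \int[mu]_(t in `[a, b]) (k t).2).

(** The integration variable is made part of the index, so the constants of [SD] are uniform in it
    and survive integration. *)
Lemma SD_int (I : Type) (D : I -> Prop) a b (f : I -> R -> V3 -> R)
    (f0 : I -> R -> R) (k : I -> R -> V3) (r1 : R) : a <= b -> 0 < r1 ->
  SD (fun p : I * R => D p.1 /\ p.2 \in `[a, b]%R)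
     (fun p => f p.1 p.2) (fun p => f0 p.1 p.2) (fun p => k p.1 p.2) ->
  (forall i Y, D i -> nrm Y <= r1 -> {in `[a, b]%R, continuous (fun t => f i t Y)}) ->
  (forall i, D i -> [/\ {in `[a, b]%R, continuous (fun t => (k i t).1.1)},
    {in `[a, b]%R, continuous (fun t => (k i t).1.2)} &
    {in `[a, b]%R, continuous (fun t => (k i t).2)}]) ->
  SD D (fun i Y => \int[mu]_(t in `[a, b]) f i t Y)
    (fun i => \int[mu]_(t in `[a, b]) f0 i t) (fun i => int3 a b (k i)).
Proof.
move=> ab r10 [C [r [C0 r0 rle1 H]]] cf ck.
have ba0 : 0 <= b - a by rewrite subr_ge0.
exists (C * (b - a) * 3), (Num.min r r1); split.
- by rewrite !mulr_ge0.
- by rewrite lt_min r0.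
- by rewrite ge_min rle1.
move=> i Di.
have E0 : \int[mu]_(t in `[a, b]) f i t zero3 = \int[mu]_(t in `[a, b]) f0 i t.
  by apply: eq_seg_int => t tab; have [_ _ -> _] := H (i, t) (conj Di tab).
have [k1 k2 k3] := ck i Di.
have kb t : t \in `[a, b]%R -> [/\ `|(k i t).1.1| <= C, `|(k i t).1.2| <= C & `|(k i t).2| <= C].
  move=> tab; have [_ h _ _] := H (i, t) (conj Di tab).
  move: h; rewrite /nrm/=.
  have := normr_ge0 (k i t).1.1; have := normr_ge0 (k i t).1.2.
  by have := normr_ge0 (k i t).2; split; lra.
have Cba : 0 <= C * (b - a) by rewrite mulr_ge0.
split => //.
- rewrite -E0; apply: (@le_trans _ _ (C * (b - a))); last lra.
  apply: seg_int_norm_le => //; first by apply: cf => //; rewrite nrm0 ltW.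
  by move=> t tab; have [h _ -> _] := H (i, t) (conj Di tab).
- rewrite /nrm /int3 /=.
  have h1 : `|\int[mu]_(t in `[a, b]) (k i t).1.1| <= C * (b - a).
    by apply: seg_int_norm_le => // t /kb[].
  have h2 : `|\int[mu]_(t in `[a, b]) (k i t).1.2| <= C * (b - a).
    by apply: seg_int_norm_le => // t /kb[].
  have h3 : `|\int[mu]_(t in `[a, b]) (k i t).2| <= C * (b - a).
    by apply: seg_int_norm_le => // t /kb[].
  lra.
move=> Y Z; rewrite !le_min => /andP[y1 y2] /andP[z1 z2].
have cY := cf i Y Di y2; have cZ := cf i Z Di z2.
have cl (l : R -> R) x : {in `[a, b]%R, continuous l} ->
    {in `[a, b]%R, continuous (fun t => x * l t)}.
  by move=> h t tab; apply: cvgM; [exact: cvg_cst|exact: h].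
have -> : dot (int3 a b (k i)) Y Z = \int[mu]_(t in `[a, b]) dot (k i t) Y Z.
  rewrite /dot /int3 /= ![\int[mu]_(t in _) _ * _]mulrC.
  rewrite -(seg_intZl _ k1) -(seg_intZl _ k2) -(seg_intZl _ k3).
  rewrite -seg_intD; [|exact: cl|exact: cl].
  rewrite -seg_intD; [| |exact: cl].
    by apply: eq_seg_int => t _; ring.
  by move=> t tab; apply: cvgD; [exact: cl k1 _ _|exact: cl k2 _ _].
have cd : {in `[a, b]%R, continuous (fun t => dot (k i t) Y Z)}.
  move=> t tab; rewrite /dot.
  have a1 := k1 t tab; have a2 := k2 t tab; have a3 := k3 t tab.
  by apply: cvgD; [apply: cvgD|]; apply: cvgM => //; exact: cvg_cst.
have cZY : {in `[a, b]%R, continuous (fun t => f i t Z - f i t Y)}.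
  by move=> t tab; apply: cvgB; [exact: cZ|exact: cY].
rewrite -seg_intB// -seg_intB//.
set B := C * _ * _ * _.
apply: (@le_trans _ _ (C * (nrm Y + nrm Z) * dst Y Z * (b - a))).
  apply: seg_int_norm_le => //.
    by move=> t tab; apply: cvgB; [exact: cZY|exact: cd].
  move=> t tab; have [_ _ _ h] := H (i, t) (conj Di tab).
  exact: h.
have u := mulr_ge0 (mulr_ge0 Cba (addr_ge0 (nrm_ge0 Y) (nrm_ge0 Z))) (dst_ge0 Y Z).
rewrite /B; lra.
Qed.

End SD.

(** * Symmetrized integrands and their first-order expansions *)

Section symmetrized.
Context {R : realType}.
Notation mu := (@lebesgue_measure R).
Notation V3 := (R * R * R)%type.
Implicit Types (c t : R) (Y Z : V3).

Lemma SD_1 (I : Type) (D : I -> Prop) :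
  SD D (fun _ Y => Y.1.1) (fun=> 0) (fun=> (1, 0, 0) : V3).
Proof.
by apply: (SD_eq (SD_coord D (1, 0, 0))) => // i Y _; rewrite /dot /=; ring.
Qed.

Lemma SD_2 (I : Type) (D : I -> Prop) :
  SD D (fun _ Y => Y.1.2) (fun=> 0) (fun=> (0, 1, 0) : V3).
Proof.
by apply: (SD_eq (SD_coord D (0, 1, 0))) => // i Y _; rewrite /dot /=; ring.
Qed.

Lemma SD_3 (I : Type) (D : I -> Prop) :
  SD D (fun _ Y => Y.2) (fun=> 0) (fun=> (0, 0, 1) : V3).
Proof.
by apply: (SD_eq (SD_coord D (0, 0, 1))) => // i Y _; rewrite /dot /=; ring.
Qed.

Lemma lin3E (a b : R) (l l' r : V3) :
  a * l.1.1 + b * l'.1.1 = r.1.1 -> a * l.1.2 + b * l'.1.2 = r.1.2 ->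
  a * l.2 + b * l'.2 = r.2 -> lin3 a l b l' = r.
Proof. by case: r => [[r1 r2] r3] /= <- <- <-. Qed.

Definition ut t Y := 1 + (1 + Y.1.2) * t.
(* At [z = e * c] and [Y.1.1 = e ^+ 2] the kernel of [J] is [kA - z * kB]:
   splitting into even and odd parts in [z] removes the sign of [e]. *)
Definition den c t Y :=
  (ut t Y * ut t Y - Y.1.1) * (ut t Y * ut t Y - Y.1.1 * (c * c)).
Definition kB c t Y := 2 * ((1 + Y.1.2) * (1 + Y.1.2)) * t * (den c t Y)^-1.
Definition kA c t Y := kB c t Y * ut t Y.

(** After writing t as (1 + t) - 1, the integrals over t needed at the trivial state are
    combinations of these powers. *)
Lemma int_inv_powers (a b c d : R) :
  \int[mu]_(t in `[0, 1]) (a * (1 + t)^-1 ^+ 2 + b * (1 + t)^-1 ^+ 3 +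
     c * (1 + t)^-1 ^+ 4 + d * (1 + t)^-1 ^+ 5) =
  a / 2 + b * (3 / 8) + c * (7 / 24) + d * (15 / 64).
Proof.
have t0 (t : R) : t \in `[0, 1]%R -> 1 + t != 0.
  by rewrite in_itv/= => /andP[? ?]; rewrite gt_eqF//; lra.
pose r (t : R) : R := (1 + t)^-1.
have dr t : t \in `[0, 1]%R -> is_derive t 1 r (- r t ^+ 2).
  move=> /t0 h.
  have h1 : is_derive t 1 (fun t : R => 1 + t) 1 by apply: is_derive_eq; ring.
  have d1 := is_deriveV h h1.
  by apply: is_derive_eq; rewrite /GRing.scale/= mulr1 exprVn.
rewrite (@seg_FTC2 _ 0 1 _ (fun t => - (a * r t + b / 2 * r t ^+ 2 +
   c / 3 * r t ^+ 3 + d / 4 * r t ^+ 4))) //.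
- by rewrite /r; field.
- move=> t /t0 h.
  have c1 n : (1 + x)^-1 ^+ n @[x --> t] --> (1 + t)^-1 ^+ n.
    apply: (@continuous_comp _ _ _ (fun x : R => (1 + x)^-1) (fun y : R => y ^+ n)).
      by cvg_arith.
    exact: exprn_continuous.
  have c2 n x : x * (1 + t)^-1 ^+ n @[t --> t] --> x * (1 + t)^-1 ^+ n.
    by apply: cvgM; [exact: cvg_cst|exact: c1].
  by do 3?[apply: cvgD]; exact: c2.
- move=> t tab; have h := dr t tab; apply: is_derive_eq.
  rewrite /GRing.scale/= /r; field; exact: t0.
Qed.

Definition Dct (p : R * R) : Prop := `|p.1| <= 1 /\ p.2 \in `[0, 1]%R.

Lemma SD_t : SD Dct (fun p _ => p.2) (fun p => p.2) (fun=> zero3).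
Proof.
apply: SD_cst; exists 1 => -[c t] [_ /=]; rewrite in_itv/= => /andP[t0 t1].
by rewrite ger0_norm.
Qed.

Lemma SD_cc : SD Dct (fun p _ => p.1 * p.1) (fun p => p.1 * p.1) (fun=> zero3).
Proof.
apply: SD_cst; exists 1 => -[c t] [/= h _].
rewrite normrM; have := ler_pM (normr_ge0 _) (normr_ge0 _) h h; lra.
Qed.

Lemma SD_const (I : Type) (D : I -> Prop) (a : R) :
  SD D (fun _ _ => a) (fun=> a) (fun=> zero3).
Proof. by apply: SD_cst; exists `|a|. Qed.

Lemma SD_ut : SD Dct (fun p => ut p.2) (fun p => 1 + p.2) (fun p => (0, p.2, 0)).
Proof.
apply: (SD_eq (SD_add (SD_const _ 1) (SD_mul (SD_add (SD_const _ 1) (SD_2 _)) SD_t))).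
- by [].
- by move=> [c t] _ /=; ring.
- by move=> [c t] _; apply: lin3E => /=; ring.
Qed.

Lemma SD_den : SD Dct (fun p => den p.1 p.2) (fun p => (1 + p.2) ^+ 4)
  (fun p => (- (1 + p.1 ^+ 2) * (1 + p.2) ^+ 2, 4 * p.2 * (1 + p.2) ^+ 3, 0)).
Proof.
have uu := SD_mul SD_ut SD_ut.
have d1 := SD_add uu (SD_mul (SD_const _ (-1)) (SD_1 Dct)).
have d2 := SD_add uu (SD_mul (SD_const _ (-1)) (SD_mul (SD_1 Dct) SD_cc)).
apply: (SD_eq (SD_mul d1 d2)).
- by move=> [c t] Y _ /=; rewrite /den; ring.
- by move=> [c t] _ /=; ring.
- by move=> [c t] _; apply: lin3E => /=; ring.
Qed.

Lemma SD_kB : SD Dct (fun p => kB p.1 p.2) (fun p => 2 * p.2 / (1 + p.2) ^+ 4)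
  (fun p => (2 * p.2 * (1 + p.1 ^+ 2) / (1 + p.2) ^+ 6,
     4 * p.2 / (1 + p.2) ^+ 4 - 8 * p.2 ^+ 2 / (1 + p.2) ^+ 5, 0)).
Proof.
have t1 : SD Dct (fun _ Y => 1 + Y.1.2) _ _ := SD_add (SD_const _ 1) (SD_2 Dct).
have n := SD_mul (SD_mul (SD_const Dct 2) (SD_mul t1 t1)) SD_t.
have t0 p : Dct p -> 1 <= 1 + p.2.
  by move=> [_]; rewrite in_itv/= => /andP[? ?]; lra.
have h (p : R * R) : Dct p -> 1 <= (1 + p.2) ^+ 4.
  by move=> /t0 h; rewrite exprn_ege1.
apply: (SD_eq (SD_mul n (SD_inv (m := 1) _ h SD_den))) => //.
- by move=> p Dp /=; ring.
- move=> p Dp; have := t0 p Dp => p1.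
  by apply: lin3E => /=; field; rewrite lt0r_neq0//; lra.
Qed.

Lemma SD_kA : SD Dct (fun p => kA p.1 p.2) (fun p => 2 * p.2 / (1 + p.2) ^+ 3)
  (fun p => (2 * p.2 * (1 + p.1 ^+ 2) / (1 + p.2) ^+ 5,
     4 * p.2 / (1 + p.2) ^+ 3 - 6 * p.2 ^+ 2 / (1 + p.2) ^+ 4, 0)).
Proof.
have t0 p : Dct p -> 1 + p.2 != 0.
  by move=> [_]; rewrite in_itv/= => /andP[? ?]; rewrite lt0r_neq0//; lra.
apply: (SD_eq (SD_mul SD_kB SD_ut)) => //.
- by move=> p /t0 Dp /=; field.
- by move=> p /t0 Dp; apply: lin3E => /=; field.
Qed.

Definition Dc c : Prop := `|c| <= 1.

Lemma nrm_coord Y r : nrm Y <= r -> [/\ `|Y.1.1| <= r, `|Y.1.2| <= r & `|Y.2| <= r].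
Proof.
rewrite /nrm; have := normr_ge0 Y.1.1; have := normr_ge0 Y.1.2.
have := normr_ge0 Y.2; by split; lra.
Qed.

Lemma den_gt0 c t Y : Dc c -> nrm Y <= 4^-1 -> 0 <= t -> 0 < den c t Y.
Proof.
move=> hc /nrm_coord[]; rewrite !ler_norml => /andP[h1 h2] /andP[h3 h4] _ t0.
have u1 : 1 <= ut t Y.
  have : 0 <= (1 + Y.1.2) * t by rewrite mulr_ge0//; lra.
  by rewrite /ut; lra.
have uu : 1 <= ut t Y * ut t Y by rewrite -[leLHS]mulr1; apply: ler_pM.
have c2 : c * c <= 1.
  by move: hc; rewrite /Dc ler_norml => /andP[? ?]; have : 0 <= (1 - c) * (1 + c);
  [rewrite mulr_ge0//; lra|lra].
have c0 : 0 <= c * c by rewrite -expr2 sqr_ge0.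
have : Y.1.1 * (c * c) <= 4^-1 * (c * c) by rewrite ler_wpM2r//; lra.
by move=> h; rewrite /den mulr_gt0//; lra.
Qed.

Lemma kB_continuous c Y : Dc c -> nrm Y <= 4^-1 ->
  {in `[0, 1]%R, continuous (fun t => kB c t Y)}.
Proof.
move=> hc nY t; rewrite in_itv/= => /andP[t0 _].
have := den_gt0 hc nY t0; rewrite /kB /den /ut => /lt0r_neq0 h.
by cvg_arith.
Qed.

Lemma kA_continuous c Y : Dc c -> nrm Y <= 4^-1 ->
  {in `[0, 1]%R, continuous (fun t => kA c t Y)}.
Proof.
move=> hc nY t tab; apply: cvgM; first exact: kB_continuous.
by rewrite /ut; cvg_arith.
Qed.

Lemma cont_rat (f : R -> R) (n : nat) : continuous f ->
  {in `[0, 1]%R, continuous (fun t => f t / (1 + t) ^+ n)}.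
Proof.
move=> cf t; rewrite in_itv/= => /andP[t0 _].
apply: cvgM; first exact: cf.
apply: cvgV; first by rewrite expf_neq0// lt0r_neq0//; lra.
apply: (@continuous_comp _ _ _ (fun x : R => 1 + x) (fun y : R => y ^+ n)).
  by cvg_arith.
exact: exprn_continuous.
Qed.

Lemma SD_intB : SD Dc (fun c Y => \int[mu]_(t in `[0, 1]) kB c t Y) (fun=> 6^-1)
  (fun c => int3 0 1 (fun t => (2 * t * (1 + c ^+ 2) / (1 + t) ^+ 6,
     4 * t / (1 + t) ^+ 4 - 8 * t ^+ 2 / (1 + t) ^+ 5, 0))).
Proof.
apply: (SD_eq (SD_int (D := Dc) (r1 := 4^-1)
  (f0 := fun _ t => 2 * t / (1 + t) ^+ 4) ler01 _ SD_kB _ _)) => //.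
- exact: kB_continuous.
- move=> c _; split => t tab /=.
  + by apply: cont_rat tab => {}t; cvg_arith.
  + apply: cvgB.
      by apply: (cont_rat (f := fun t => 4 * t)) tab => {}t; cvg_arith.
    by apply: (cont_rat (f := fun t => 8 * (t * t))) tab => {}t; cvg_arith.
  + exact: cvg_cst.
- move=> c _ /=.
  transitivity (\int[mu]_(t in `[0, 1]) (0 * (1 + t)^-1 ^+ 2 + 2 * (1 + t)^-1 ^+ 3 +
     (-2) * (1 + t)^-1 ^+ 4 + 0 * (1 + t)^-1 ^+ 5)).
    apply: eq_seg_int => t; rewrite in_itv/= => /andP[t0 _].
    by field; rewrite lt0r_neq0//; lra.
  by rewrite int_inv_powers; field.
Qed.

(** 11/96 = 2 (7/24 - 15/64) is the integral of 2 t / (1 + t)^5; the 11/16 in the curvature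
    originates here. *)
Lemma SD_intA : SD Dc (fun c Y => \int[mu]_(t in `[0, 1]) kA c t Y) (fun=> 4^-1)
  (fun c => (11 / 96 * (1 + c ^+ 2), 4^-1, 0)).
Proof.
apply: (SD_eq (SD_int (D := Dc) (r1 := 4^-1)
  (f0 := fun _ t => 2 * t / (1 + t) ^+ 3)
  (k := fun c t => (2 * t * (1 + c ^+ 2) / (1 + t) ^+ 5,
     4 * t / (1 + t) ^+ 3 - 6 * t ^+ 2 / (1 + t) ^+ 4, 0)) ler01 _ SD_kA _ _)) => //.
- exact: kA_continuous.
- move=> c _; split => t tab /=.
  + by apply: cont_rat tab => {}t; cvg_arith.
  + apply: cvgB.
      by apply: (cont_rat (f := fun t => 4 * t)) tab => {}t; cvg_arith.
    by apply: (cont_rat (f := fun t => 6 * (t * t))) tab => {}t; cvg_arith.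
  + exact: cvg_cst.
- move=> c _ /=.
  transitivity (\int[mu]_(t in `[0, 1]) (2 * (1 + t)^-1 ^+ 2 + (-2) * (1 + t)^-1 ^+ 3 +
     0 * (1 + t)^-1 ^+ 4 + 0 * (1 + t)^-1 ^+ 5)).
    apply: eq_seg_int => t; rewrite in_itv/= => /andP[t0 _].
    by field; rewrite lt0r_neq0//; lra.
  by rewrite int_inv_powers; field.
- move=> c _; rewrite /int3 /=; congr (_, _, _).
  + transitivity (\int[mu]_(t in `[0, 1]) (0 * (1 + t)^-1 ^+ 2 + 0 * (1 + t)^-1 ^+ 3 +
      (2 * (1 + c ^+ 2)) * (1 + t)^-1 ^+ 4 + (- 2 * (1 + c ^+ 2)) * (1 + t)^-1 ^+ 5)).
      apply: eq_seg_int => t; rewrite in_itv/= => /andP[t0 _].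
      by field; rewrite lt0r_neq0//; lra.
    by rewrite int_inv_powers; field.
  + transitivity (\int[mu]_(t in `[0, 1]) (-2 * (1 + t)^-1 ^+ 2 + 8 * (1 + t)^-1 ^+ 3 +
      (-6) * (1 + t)^-1 ^+ 4 + 0 * (1 + t)^-1 ^+ 5)).
      apply: eq_seg_int => t; rewrite in_itv/= => /andP[t0 _].
      by field; rewrite lt0r_neq0//; lra.
    by rewrite int_inv_powers; field.
  + by rewrite seg_int_cst ?mul0r.
Qed.

Variables (g k0 : R).
Hypotheses (hg : 0 < g) (hk0 : 0 < k0).

Local Notation m0 := (4 * g + 4 * k0 ^+ 2).
Definition sA c Y := (m0 + Y.2) * \int[mu]_(t in `[0, 1]) kA c t Y - g.
Definition sB c Y := (m0 + Y.2) * \int[mu]_(t in `[0, 1]) kB c t Y.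
Definition sD c Y := sA c Y * sA c Y - sB c Y * sB c Y * (Y.1.1 * (c * c)).
(* [sS] and [sZ] are [W z + W (- z)] and [z * (W z - W (- z))], [z = e * c],
   written without the square roots of [Q z] and [Q (- z)] separately. *)
Definition sS c Y :=
  Num.sqrt (2 * sA c Y * (sD c Y)^-1 + 2 * (Num.sqrt (sD c Y))^-1).
Definition sZ c Y := 2 * sB c Y * (Y.1.1 * (c * c)) * (sD c Y * sS c Y)^-1.

Lemma SD_sA : SD Dc sA (fun=> k0 ^+ 2)
  (fun c => (11 / 96 * m0 * (1 + c ^+ 2), m0 / 4, 4^-1)).
Proof.
apply: (SD_eq (SD_add (SD_mul (SD_add (SD_const Dc m0) (SD_3 Dc)) SD_intA)
  (SD_const Dc (- g)))) => //.
- by move=> c _; field.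
- by move=> c _; apply: lin3E => /=; field.
Qed.

Lemma SD_cc' : SD Dc (fun c _ => c * c) (fun c => c * c) (fun=> zero3).
Proof.
apply: SD_cst; exists 1 => c h.
rewrite normrM; have := ler_pM (normr_ge0 _) (normr_ge0 _) h h; lra.
Qed.

(** [sB] enters below only in products with [Y.1.1], which vanishes at the origin, so at first order
    it contributes through its value m0 / 6; hence the existential linear part. *)
Lemma SD_sBE : exists l, SD Dc (fun c Y => sB c Y) (fun=> m0 / 6) l.
Proof.
eexists; apply: (SD_eq (SD_mul (SD_add (SD_const Dc m0) (SD_3 Dc)) SD_intB)) => //.
by move=> c _; field.
Qed.

Lemma SD_Ecc : SD Dc (fun c Y => Y.1.1 * (c * c)) (fun=> 0) (fun c => (c ^+ 2, 0, 0)).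
Proof.
apply: (SD_eq (SD_mul (SD_1 Dc) SD_cc')) => //.
- by move=> c _; ring.
- by move=> c _; apply: lin3E => /=; ring.
Qed.

Lemma SD_sD : SD Dc sD (fun=> k0 ^+ 4)
  (fun c => (2 * k0 ^+ 2 * (11 / 96 * m0 * (1 + c ^+ 2)) - m0 ^+ 2 / 36 * c ^+ 2,
     k0 ^+ 2 * m0 / 2, k0 ^+ 2 / 2)).
Proof.
have [lB hB] := SD_sBE.
have h := SD_mul (SD_const Dc (-1)) (SD_mul (SD_mul hB hB) SD_Ecc).
apply: (SD_eq (SD_add (SD_mul SD_sA SD_sA) h)).
- by move=> c Y _; rewrite /sD; ring.
- by move=> c _; ring.
- by move=> c _; apply: lin3E => /=; field.
Qed.

Lemma SD_sS : SD Dc sS (fun=> 2 / k0)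
  (fun c => (- (11 / 96 * m0 * (1 + c ^+ 2)) / k0 ^+ 3 +
     m0 ^+ 2 * c ^+ 2 / (48 * k0 ^+ 5), - m0 / (4 * k0 ^+ 3), - (4 * k0 ^+ 3)^-1)).
Proof.
have k40 : 0 < k0 ^+ 4 by rewrite exprn_gt0.
have kn : k0 != 0 by rewrite lt0r_neq0.
have s4 : Num.sqrt (k0 ^+ 4) = k0 ^+ 2.
  by rewrite (_ : 4 = 2 * 2)%N// exprM sqrtr_sqr ger0_norm// sqr_ge0.
have i1 := SD_inv k40 (fun i _ => lexx (k0 ^+ 4)) SD_sD.
have r1 := SD_sqrt k40 (fun i _ => lexx (k0 ^+ 4)) SD_sD.
have k20 : 0 < k0 ^+ 2 by rewrite exprn_gt0.
have {}r1 := SD_eq r1 (fun _ _ _ => erefl) (fun _ _ => s4) (fun _ _ => erefl).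
have i2 := SD_inv k20 (fun i _ => lexx (k0 ^+ 2)) r1.
have h := SD_add (SD_mul (SD_mul (SD_const Dc 2) SD_sA) i1) (SD_mul (SD_const Dc 2) i2).
have p0 : 0 < (2 / k0) ^+ 2 by rewrite exprn_gt0// divr_gt0.
have e0 : 2 * k0 ^+ 2 * (k0 ^+ 4)^-1 + 2 * (k0 ^+ 2)^-1 = (2 / k0) ^+ 2 by field.
have {}h := SD_eq h (fun _ _ _ => erefl) (fun _ _ => e0) (fun _ _ => erefl).
have s2 : Num.sqrt ((2 / k0) ^+ 2) = 2 / k0.
  by rewrite sqrtr_sqr gtr0_norm// divr_gt0.
apply: (SD_eq (SD_sqrt p0 (fun i _ => lexx ((2 / k0) ^+ 2)) h)) => //.
by move=> c _; apply: lin3E => /=; rewrite s4 s2; field.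
Qed.

Lemma SD_sZ : SD Dc sZ (fun=> 0) (fun c => (m0 * c ^+ 2 / (6 * k0 ^+ 3), 0, 0)).
Proof.
have kn : k0 != 0 by rewrite lt0r_neq0.
have [lB hB] := SD_sBE.
have p0 : 0 < k0 ^+ 4 * (2 / k0) by rewrite mulr_gt0 ?divr_gt0 ?exprn_gt0.
have i1 := SD_inv p0 (fun i _ => lexx (k0 ^+ 4 * (2 / k0))) (SD_mul SD_sD SD_sS).
apply: (SD_eq (SD_mul (SD_mul (SD_mul (SD_const Dc 2) hB) SD_Ecc) i1)) => //.
- by move=> c _; ring.
- by move=> c _; apply: lin3E => /=; field.
Qed.

End symmetrized.

(** * Expansion of [M] in the squared amplitude *)

Section local_expansion.
Context {R : realType}.
Notation mu := (@lebesgue_measure R).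
Notation V3 := (R * R * R)%type.
Implicit Types (c t e x y z : R) (Y Z : V3).

Lemma SD_near (I : Type) (D : I -> Prop) (f : I -> V3 -> R) f0 k (m : R) :
  0 < m -> (forall i, D i -> m <= f0 i) -> SD D f f0 k ->
  exists2 r, 0 < r & forall i Y, D i -> nrm Y <= r -> 0 < f i Y.
Proof.
move=> m_gt0 fm /SD_lip[C [r [C0 r0 r1 H]]].
pose r' := Num.min r (m / (2 * (C + 1))).
have C10 : 0 < 2 * (C + 1) by lra.
exists r'; first by rewrite lt_min r0 divr_gt0.
move=> i Y Di; rewrite le_min => /andP[n1 n2].
have [_ _ _ h] := H i Di; have [_ h1 _ _] := h Y Y n1 n1.
have : C * nrm Y <= m / 2.
  move: n2; rewrite ler_pdivlMr// => n2.
  have := mulr_ge0 C0 (nrm_ge0 Y); have := nrm_ge0 Y; lra.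
have := fm i Di; move: h1; rewrite ler_norml => /andP[h1 _].
lra.
Qed.

Section sqrt_identities.
Variables (A B z : R).
Hypotheses (hp : 0 < A - B * z) (hn : 0 < A + B * z).

Let x := (Num.sqrt (A - B * z))^-1.
Let y := (Num.sqrt (A + B * z))^-1.

(** Square both sides: x^2 + y^2 = 2 A / (A^2 - B^2 z^2) and x y = 1 / sqrt(A^2 - B^2 z^2). On the
    right z occurs only as z^2. *)
Lemma sqrt_sum_symmetrized : x + y =
  Num.sqrt (2 * A * (A * A - B * B * (z * z))^-1 +
            2 * (Num.sqrt (A * A - B * B * (z * z)))^-1).
Proof.
have x0 : 0 < x by rewrite invr_gt0 sqrtr_gt0.
have y0 : 0 < y by rewrite invr_gt0 sqrtr_gt0.
have sx : Num.sqrt (A - B * z) * Num.sqrt (A - B * z) = A - B * z.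
  by rewrite -expr2 sqr_sqrtr// ltW.
have sy : Num.sqrt (A + B * z) * Num.sqrt (A + B * z) = A + B * z.
  by rewrite -expr2 sqr_sqrtr// ltW.
have xn : Num.sqrt (A - B * z) != 0 by rewrite lt0r_neq0// sqrtr_gt0.
have yn : Num.sqrt (A + B * z) != 0 by rewrite lt0r_neq0// sqrtr_gt0.
have dE : A * A - B * B * (z * z) = (A - B * z) * (A + B * z) by ring.
rewrite dE sqrtrM ?(ltW hp)// -[LHS]gtr0_norm ?addr_gt0// -sqrtr_sqr.
congr Num.sqrt.
have AE : 2 * A = (A - B * z) + (A + B * z) by ring.
rewrite AE /x /y; move: sx sy xn yn; set p := Num.sqrt (A - _).
set q := Num.sqrt (A + _) => <- <- xn yn; field.
by rewrite xn yn.
Qed.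

(** Divide x^2 - y^2 = 2 B z / (A^2 - B^2 z^2) by x + y. *)
Lemma sqrt_diff_symmetrized : z * x - z * y =
  2 * B * (z * z) * ((A * A - B * B * (z * z)) * (x + y))^-1.
Proof.
have sx : Num.sqrt (A - B * z) * Num.sqrt (A - B * z) = A - B * z.
  by rewrite -expr2 sqr_sqrtr// ltW.
have sy : Num.sqrt (A + B * z) * Num.sqrt (A + B * z) = A + B * z.
  by rewrite -expr2 sqr_sqrtr// ltW.
have xn : 0 < Num.sqrt (A - B * z) by rewrite sqrtr_gt0.
have yn : 0 < Num.sqrt (A + B * z) by rewrite sqrtr_gt0.
have dE : A * A - B * B * (z * z) = (A - B * z) * (A + B * z) by ring.
have BE : 2 * B * (z * z) = z * ((A + B * z) - (A - B * z)) by ring.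
rewrite dE BE /x /y; move: sx sy xn yn; set p := Num.sqrt (A - _).
set q := Num.sqrt (A + _) => <- <- xn yn; field.
by rewrite !lt0r_neq0// addr_gt0.
Qed.

End sqrt_identities.

Variables (g k0 : R).
Hypotheses (hg : 0 < g) (hk0 : 0 < k0).

Local Notation m0 := (4 * g + 4 * k0 ^+ 2).
Local Notation sA := (sA g k0).
Local Notation sB := (sB g k0).
Local Notation sD := (sD g k0).
Local Notation sS := (sS g k0).
Local Notation sZ := (sZ g k0).
Local Notation L := (pi / k0).

Lemma Tm0 : Tm g k0 0 = 1.
Proof.
have h : `|0 : R| < 1 by rewrite normr0.
have [_] := TmP hg hk0 h.
rewrite (_ : N _ _ _ _ = 0) ?mul0r ?addr0; first by move=> /eqP; rewrite subr_eq0 => /eqP.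
transitivity (\int[mu]_(t in `[0, pi]) (0 : R)).
  by apply: eq_seg_int => t _; rewrite !mul0r.
by rewrite seg_int_cst ?pi_ge0// mul0r.
Qed.

Lemma qe0 : qe g k0 0 = k0 ^+ 2.
Proof.
have h : `|0 : R| < 1 by rewrite normr0.
have q0 := qe_gt0 hg hk0 h; have := P_qe hg hk0 h; rewrite Tm0.
have J0 : J 0 1 (0 : R) != 0 by rewrite lt0r_neq0// J_gt0//; lra.
have -> : P g 0 1 (qe g k0 0) = (Num.sqrt (qe g k0 0))^-1 * pi.
  rewrite /P -[pi in RHS]subr0 -seg_int_cst ?pi_ge0//.
  apply: eq_seg_int => t _; rewrite mul0r /W /Q normr0 divff// mulr1.
  by rewrite addrC addKr.
have p0 : (pi : R) != 0 by rewrite lt0r_neq0// pi_gt0.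
rewrite mulrC => /(mulfI p0) /invr_inj h1.
by rewrite -(sqr_sqrtr (ltW q0)) h1.
Qed.

(** The bifurcation value: at [e = 0] the period forces q = k0^2, and J = 1/4, whence 4 (g +
    k0^2). *)
Lemma Mt0 : Mt g k0 0 = m0.
Proof.
rewrite /Mt qe0 Tm0 normr0 (_ : J 0 1 0 = 4^-1); first by field.
transitivity (\int[mu]_(t in `[0, 1]) (2 * (1 + t)^-1 ^+ 2 + (-2) * (1 + t)^-1 ^+ 3 +
     0 * (1 + t)^-1 ^+ 4 + 0 * (1 + t)^-1 ^+ 5)).
  apply: eq_seg_int => t; rewrite in_itv/= => /andP[t0 _]; rewrite /Jk.
  by field; rewrite !lt0r_neq0//; lra.
by rewrite int_inv_powers; field.
Qed.

(* Coordinates in which the trivial state [e = 0] is the origin. *)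
Definition Yv e : V3 := (e ^+ 2, Tm g k0 e - 1, Mt g k0 e - m0).

Lemma Yv0 : Yv 0 = zero3.
Proof. by rewrite /Yv Tm0 Mt0 expr0n !subrr. Qed.

Lemma Yv_near (r : R) : 0 < r ->
  exists2 d, 0 < d & forall e, `|e| < d -> nrm (Yv e) <= r.
Proof.
move=> r0; have h : `|0 : R| < 1 by rewrite normr0.
have c : nrm (Yv e) @[e --> (0 : R)] --> nrm (Yv 0).
  have h1 := Tm_cvg hg hk0 h (@cvg_id _ (nbhs (0 : R))).
  have h2 := Mt_cvg hg hk0 h (@cvg_id _ (nbhs (0 : R))).
  rewrite /nrm /Yv /=; cvg_arith => //; first exact: exprn_continuous.
move: c; rewrite Yv0 nrm0 => /cvgr0Pnorm_lt /(_ r r0) [d /= d0 hd].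
exists d => // e ed; apply: ltW; apply: le_lt_trans (ler_norm _) _.
by apply: hd; rewrite /ball_/= sub0r normrN.
Qed.

Lemma kA_cos_cvg Y th t : nrm Y <= 4^-1 -> 0 <= t ->
  kA (cos p.1) p.2 Y @[p --> (th, t)] --> kA (cos th) t Y.
Proof.
move=> nY t0; have hc : Dc (cos th) by rewrite /Dc cos_max.
have := den_gt0 hc nY t0; rewrite /kA /kB /den /ut => /lt0r_neq0 h.
have c1 := cvg_pr1 (@cvg_id _ (nbhs (th, t))).
have c2 := cvg_pr2 (@cvg_id _ (nbhs (th, t))).
by cvg_arith.
Qed.

Lemma kB_cos_cvg Y th t : nrm Y <= 4^-1 -> 0 <= t ->
  kB (cos p.1) p.2 Y @[p --> (th, t)] --> kB (cos th) t Y.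
Proof.
move=> nY t0; have hc : Dc (cos th) by rewrite /Dc cos_max.
have := den_gt0 hc nY t0; rewrite /kB /den /ut => /lt0r_neq0 h.
have c1 := cvg_pr1 (@cvg_id _ (nbhs (th, t))).
have c2 := cvg_pr2 (@cvg_id _ (nbhs (th, t))).
by cvg_arith.
Qed.

Lemma sA_cos_continuous Y : nrm Y <= 4^-1 -> continuous (fun th => sA (cos th) Y).
Proof.
move=> nY th; rewrite /sA.
have h : \int[mu]_(t in `[0, 1]) kA (cos y) t Y @[y --> th] -->
    \int[mu]_(t in `[0, 1]) kA (cos th) t Y.
  apply: (@seg_int_continuous _ _ (fun y t => kA (cos y) t Y)) => //.
    by move=> t; rewrite in_itv/= => /andP[t0 _]; exact: kA_cos_cvg.
  by apply: filterE => y; apply: kA_continuous => //; rewrite /Dc cos_max.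
by cvg_arith.
Qed.

Lemma sB_cos_continuous Y : nrm Y <= 4^-1 -> continuous (fun th => sB (cos th) Y).
Proof.
move=> nY th; rewrite /sB.
have h : \int[mu]_(t in `[0, 1]) kB (cos y) t Y @[y --> th] -->
    \int[mu]_(t in `[0, 1]) kB (cos th) t Y.
  apply: (@seg_int_continuous _ _ (fun y t => kB (cos y) t Y)) => //.
    by move=> t; rewrite in_itv/= => /andP[t0 _]; exact: kB_cos_cvg.
  by apply: filterE => y; apply: kB_continuous => //; rewrite /Dc cos_max.
by cvg_arith.
Qed.

Lemma sD_cos_continuous Y : nrm Y <= 4^-1 -> continuous (fun th => sD (cos th) Y).
Proof.
move=> nY th; have h1 := @sA_cos_continuous Y nY th.
by have h2 := @sB_cos_continuous Y nY th; rewrite /sD; cvg_arith.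
Qed.

Lemma sS_cos_continuous Y : nrm Y <= 4^-1 -> (forall c, Dc c -> 0 < sD c Y) ->
  continuous (fun th => sS (cos th) Y).
Proof.
move=> nY D0 th; have h1 := @sA_cos_continuous Y nY th.
have h2 := @sD_cos_continuous Y nY th.
have hD : 0 < sD (cos th) Y by apply: D0; rewrite /Dc cos_max.
have s0 : Num.sqrt (sD (cos th) Y) != 0 by rewrite lt0r_neq0// sqrtr_gt0.
have d0 := lt0r_neq0 hD.
by rewrite /sS; cvg_arith.
Qed.

Lemma sZ_cos_continuous Y : nrm Y <= 4^-1 -> (forall c, Dc c -> 0 < sD c Y) ->
  (forall c, Dc c -> 0 < sS c Y) -> continuous (fun th => sZ (cos th) Y).
Proof.
move=> nY D0 S0 th; have h1 := @sB_cos_continuous Y nY th.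
have h2 := @sD_cos_continuous Y nY th; have h3 := @sS_cos_continuous Y nY D0 th.
have ne : sD (cos th) Y * sS (cos th) Y != 0.
  by rewrite lt0r_neq0// mulr_gt0//; [apply: D0|apply: S0]; rewrite /Dc cos_max.
by rewrite /sZ; cvg_arith.
Qed.

(** With u = 1 + T t, the identity 1 / (u + z) = (u - z) / (u^2 - z^2) separates the kernel into its
    even and odd parts in z. *)
Lemma symmetric_parts e c : `|e| < 1 -> Dc c -> nrm (Yv e) <= 4^-1 ->
  Q g e (Tm g k0 e) (qe g k0 e) (e * c) = sA c (Yv e) - sB c (Yv e) * (e * c) /\
  Q g e (Tm g k0 e) (qe g k0 e) (- (e * c)) = sA c (Yv e) + sB c (Yv e) * (e * c).
Proof.
move=> e1 hc nY; have T0 := Tm_gt0 hg hk0 e1.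
have ec : `|e * c| < 1.
  by rewrite normrM; apply: le_lt_trans e1; rewrite -[leRHS]mulr1 ler_wpM2l.
have JE z : `|z| < 1 -> z * z = e ^+ 2 * (c * c) -> J e (Tm g k0 e) z =
   \int[mu]_(t in `[0, 1]) kA c t (Yv e) - z * \int[mu]_(t in `[0, 1]) kB c t (Yv e).
  move=> z1 zz; have kBc := kB_continuous hc nY; have kAc := kA_continuous hc nY.
  rewrite -seg_intZl// -seg_intB//; last first.
    by move=> t tab; apply: cvgM; [exact: cvg_cst|exact: kBc].
  apply: eq_seg_int => t; rewrite in_itv/= => /andP[t0 _].
  have zN1 : -1 < z by move: z1; rewrite ltr_norml => /andP[].
  have d1 := Jk_den1 e1 T0 t0; have d2 := Jk_den2 zN1 T0 t0.
  have d3 : 0 < 1 - z + Tm g k0 e * t.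
    have := mulr_ge0 (ltW T0) t0; move: z1; rewrite ltr_norml => /andP[]; lra.
  rewrite /kA /kB /den /ut /Jk /Yv /= -zz (addrC 1 (_ - 1)) subrK.
  have d4 : 0 < (1 + Tm g k0 e * t) * (1 + Tm g k0 e * t) - z * z.
    by have := mulr_gt0 d2 d3; congr (0 < _); ring.
  field; rewrite (lt0r_neq0 d2) (lt0r_neq0 d4) (lt0r_neq0 d1); done.
have MtE : m0 + (Mt g k0 e - m0) = Mt g k0 e by rewrite addrC subrK.
have zz : e * c * (e * c) = e ^+ 2 * (c * c) by ring.
rewrite !QE// !JE ?normrN ?mulrNN// /sA /sB /Yv /= MtE; split; ring.
Qed.

Lemma sS_sum e c : `|e| < 1 -> Dc c -> nrm (Yv e) <= 4^-1 ->
  let W := W g e (Tm g k0 e) (qe g k0 e) in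
  sS c (Yv e) = W (e * c) + W (- (e * c)) /\
  sZ c (Yv e) = e * c * W (e * c) - e * c * W (- (e * c)).
Proof.
move=> e1 hc nY /=; have [q1 q2] := symmetric_parts e1 hc nY.
have ec : `|e * c| <= `|e| by rewrite normrM -[leRHS]mulr1 ler_wpM2l.
have T0 := Tm_gt0 hg hk0 e1; have q0 := qe_gt0 hg hk0 e1.
have p1 := Q_gt0 hg e1 T0 q0 ec.
have p2 : 0 < Q g e (Tm g k0 e) (qe g k0 e) (- (e * c)).
  by apply: Q_gt0; rewrite ?normrN.
move: p1 p2; rewrite /W q1 q2 => p1 p2.
have zz : (Yv e).1.1 * (c * c) = e * c * (e * c) by rewrite /Yv /=; ring.
have SE : sS c (Yv e) = (Num.sqrt (sA c (Yv e) - sB c (Yv e) * (e * c)))^-1 +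
   (Num.sqrt (sA c (Yv e) + sB c (Yv e) * (e * c)))^-1.
  by rewrite (sqrt_sum_symmetrized p1 p2) /sS /sD zz.
by split => //; rewrite /sZ SE (sqrt_diff_symmetrized p1 p2) /sD zz.
Qed.

Lemma cos_pi_sub t : cos (pi - t) = - cos t.
Proof. by rewrite addrC cosDpi cosN. Qed.

(** Folding the integrand at t with that at pi - t doubles the integral over [0, pi]. The period and
    mean constraints thus become smooth equations in [Yv], which contains [e] explicitly only as
    e^2. *)
Lemma half_period_integrals e : `|e| < 1 -> nrm (Yv e) <= 4^-1 ->
  \int[mu]_(t in `[0, pi]) sS (cos t) (Yv e) = 2 * L /\
  \int[mu]_(t in `[0, pi]) sZ (cos t) (Yv e) = 2 * (Tm g k0 e - 1) * L.
Proof.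
move=> e1 nY; have T0 := Tm_gt0 hg hk0 e1; have q0 := qe_gt0 hg hk0 e1.
have hc t : Dc (cos t) by rewrite /Dc cos_max.
pose W1 t := W g e (Tm g k0 e) (qe g k0 e) (e * cos t).
have cW : continuous W1 by exact: Wcos_continuous.
have czW : continuous (fun t => e * cos t * W1 t) by exact: zW_continuous.
have rW t : W g e (Tm g k0 e) (qe g k0 e) (- (e * cos t)) = W1 (pi - t).
  by rewrite /W1 -mulrN cos_pi_sub.
have rc t : - cos t = cos (pi - t) by rewrite cos_pi_sub.
have Pe : \int[mu]_(t in `[0, pi]) W1 t = L := P_qe hg hk0 e1.
have Ne : \int[mu]_(t in `[0, pi]) (e * cos t * W1 t) = (Tm g k0 e - 1) * L.
  by rewrite -(N_Tm hg hk0 e1); apply: eq_seg_int.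
have cr (f : R -> R) : continuous f -> {in `[0, pi]%R, continuous (fun t => f (pi - t))}.
  move=> cf t _; apply: (@continuous_comp _ _ _ (fun t : R => pi - t) f); last exact: cf.
  by cvg_arith.
split.
- transitivity (\int[mu]_(t in `[0, pi]) (W1 t + W1 (pi - t))).
    by apply: eq_seg_int => t _; have [-> _] := sS_sum e1 (hc t) nY; rewrite rW.
  rewrite seg_intD; [|by move=> t _; exact: cW|exact: cr].
  by rewrite (seg_int_reflect (pi_ge0 R) cW) Pe; ring.
- transitivity (\int[mu]_(t in `[0, pi])
      (e * cos t * W1 t + e * cos (pi - t) * W1 (pi - t))).
    apply: eq_seg_int => t _; have [_ ->] := sS_sum e1 (hc t) nY.
    by rewrite rW -rc; rewrite /W1; ring.
  rewrite seg_intD; [|by move=> t _; exact: czW|exact: (cr (fun t => e * cos t * W1 t))].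
  by rewrite (seg_int_reflect (pi_ge0 R) czW) Ne; ring.
Qed.

Lemma int_cos2 : \int[mu]_(t in `[0, pi]) (cos t ^+ 2) = (pi : R) / 2.
Proof.
rewrite (@seg_FTC2 _ 0 pi _ (fun t => (t + sin t * cos t) / 2)) ?pi_ge0//.
- by rewrite sinpi sin0; field.
- by move=> t _; apply: (@continuous_comp _ _ _ cos (fun x : R => x ^+ 2));
    [exact: continuous_cos|exact: exprn_continuous].
- move=> t _; apply: is_derive_eq; rewrite /GRing.scale/=.
  have := cos2Dsin2 t; rewrite !expr2 => h.
  have -> : sin t * - sin t = cos t * cos t - 1 by rewrite -h; ring.
  by field.
Qed.

Lemma small_parameters : exists2 r, 0 < r & forall Y, nrm Y <= r ->
  [/\ nrm Y <= 4^-1, forall c, Dc c -> 0 < sD c Y & forall c, Dc c -> 0 < sS c Y].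
Proof.
have k40 : 0 < k0 ^+ 4 by rewrite exprn_gt0.
have k20 : 0 < 2 / k0 by rewrite divr_gt0.
have [r1 r10 h1] := SD_near k40 (fun _ _ => lexx _) (SD_sD g k0).
have [r2 r20 h2] := SD_near k20 (fun _ _ => lexx _) (SD_sS g hk0).
exists (Num.min 4^-1 (Num.min r1 r2)).
  by rewrite !lt_min r10 r20 invr_gt0 ltr0n.
move=> Y; rewrite !le_min => /andP[-> /andP[y1 y2]]; split => // c Dcc.
- exact: h1.
- exact: h2.
Qed.

Lemma SD_unit (f : V3 -> R) f0 l :
  SD (fun _ : unit => True) (fun _ Y => f Y) (fun=> f0) (fun=> l) ->
  exists C r, [/\ 0 <= C, 0 < r & forall Y Z y z, nrm Y <= r -> nrm Z <= r ->
   f Y = y -> f Z = z ->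
   `|z - y - dot l Y Z| <= C * (nrm Y + nrm Z) * dst Y Z].
Proof.
move=> [C [r [C0 r0 _ H]]]; exists C, r; split => // Y Z y z Yr Zr <- <-.
by have [_ _ _] := H tt I; exact.
Qed.

Lemma cos2_affine_continuous (a b : R) : continuous (fun t => a + b * cos t ^+ 2).
Proof.
have h : continuous (fun t : R => cos t ^+ 2).
  by move=> t; apply: (@continuous_comp _ _ _ cos (fun x : R => x ^+ 2));
    [exact: continuous_cos|exact: exprn_continuous].
by move=> t; apply: cvgD; [exact: cvg_cst|apply: cvgM; [exact: cvg_cst|exact: h]].
Qed.

Lemma int_cos2_affine (a b : R) :
  \int[mu]_(t in `[0, pi]) (a + b * cos t ^+ 2) = pi * (a + b / 2).
Proof.
have c1 : {in `[0, pi]%R, continuous (fun _ : R => a)} by move=> x _; exact: cvg_cst.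
have c2 : {in `[0, pi]%R, continuous (fun t : R => cos t ^+ 2)}.
  by move=> t _; apply: (@continuous_comp _ _ _ cos (fun x : R => x ^+ 2));
    [exact: continuous_cos|exact: exprn_continuous].
rewrite seg_intD//; last first.
  by move=> t tab; apply: cvgM; [exact: cvg_cst|exact: c2].
by rewrite seg_intZl// int_cos2 seg_int_cst ?pi_ge0//; field.
Qed.

Let pi0 : 0 < (pi : R). Proof. exact: pi_gt0. Qed.

(** Averaging cos^2 to 1/2 in [SD_sS] produces the coefficients: 11/96 * 3/2 = 11/64 and 1/48 * 1/2
    = 1/96. *)
Lemma SD_H1 : exists C r, [/\ 0 <= C, 0 < r & forall Y Z y z, nrm Y <= r -> nrm Z <= r ->
  \int[mu]_(t in `[0, pi]) sS (cos t) Y = y -> \int[mu]_(t in `[0, pi]) sS (cos t) Z = z ->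
  `|z - y - dot (pi * (- (11 / 64 * m0) / k0 ^+ 3 + m0 ^+ 2 / (96 * k0 ^+ 5)),
     - (pi * m0) / (4 * k0 ^+ 3), - pi / (4 * k0 ^+ 3)) Y Z|
   <= C * (nrm Y + nrm Z) * dst Y Z].
Proof.
have kn : k0 != 0 by rewrite lt0r_neq0.
have [r1 r10 hr] := small_parameters.
apply: (@SD_unit (fun Y => _) (\int[mu]_(t in `[0, pi]) (2 / k0))).
pose D := fun p : unit * R => True /\ p.2 \in `[0, pi]%R.
have h := SD_reindex (D' := D) (h := fun p => cos p.2) (fun p _ => cos_max p.2) (SD_sS g hk0).
apply: (SD_eq (SD_int (D := fun _ : unit => True) (pi_ge0 R) r10
  (f := fun _ t Y => sS (cos t) Y) (f0 := fun _ _ => 2 / k0)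
  (k := fun _ t => (- (11 / 96 * m0 * (1 + cos t ^+ 2)) / k0 ^+ 3 +
     m0 ^+ 2 * cos t ^+ 2 / (48 * k0 ^+ 5), - m0 / (4 * k0 ^+ 3), - (4 * k0 ^+ 3)^-1))
  h _ _)) => //.
- move=> _ Y _ nY t _; have [n1 n2 _] := hr Y nY; exact: sS_cos_continuous.
- move=> _ _; split => t _ /=; [|exact: cvg_cst|exact: cvg_cst].
  have := @cos2_affine_continuous (- (11 / 96 * m0) / k0 ^+ 3)
    (- (11 / 96 * m0) / k0 ^+ 3 + m0 ^+ 2 / (48 * k0 ^+ 5)) t.
  congr (continuous_at _ _); apply/funext => x; by field.
- move=> _ _; rewrite /int3 /=; congr (_, _, _).
  + transitivity (\int[mu]_(t in `[0, pi]) (- (11 / 96 * m0) / k0 ^+ 3 +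
      (- (11 / 96 * m0) / k0 ^+ 3 + m0 ^+ 2 / (48 * k0 ^+ 5)) * cos t ^+ 2)).
      by apply: eq_seg_int => t _; field.
    by rewrite int_cos2_affine; field.
  + by rewrite seg_int_cst ?pi_ge0//; field.
  + by rewrite seg_int_cst ?pi_ge0//; field.
Qed.

Lemma SD_H2 : exists C r, [/\ 0 <= C, 0 < r & forall Y Z y z, nrm Y <= r -> nrm Z <= r ->
  \int[mu]_(t in `[0, pi]) sZ (cos t) Y = y -> \int[mu]_(t in `[0, pi]) sZ (cos t) Z = z ->
  `|z - y - dot (pi * m0 / (12 * k0 ^+ 3), 0, 0) Y Z|
   <= C * (nrm Y + nrm Z) * dst Y Z].
Proof.
have kn : k0 != 0 by rewrite lt0r_neq0.
have [r1 r10 hr] := small_parameters.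
apply: (@SD_unit (fun Y => _) (\int[mu]_(t in `[0, pi]) 0)).
pose D := fun p : unit * R => True /\ p.2 \in `[0, pi]%R.
have h := SD_reindex (D' := D) (h := fun p => cos p.2) (fun p _ => cos_max p.2) (SD_sZ g hk0).
apply: (SD_eq (SD_int (D := fun _ : unit => True) (pi_ge0 R) r10
  (f := fun _ t Y => sZ (cos t) Y) (f0 := fun _ _ => 0)
  (k := fun _ t => (m0 * cos t ^+ 2 / (6 * k0 ^+ 3), 0, 0))
  h _ _)) => //.
- move=> _ Y _ nY t _; have [n1 n2 n3] := hr Y nY; exact: sZ_cos_continuous.
- move=> _ _; split => t _ /=; [|exact: cvg_cst|exact: cvg_cst].
  have := @cos2_affine_continuous 0 (m0 / (6 * k0 ^+ 3)) t.
  congr (continuous_at _ _); apply/funext => x; by field.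
- move=> _ _; rewrite /int3 /=; congr (_, _, _).
  + transitivity (\int[mu]_(t in `[0, pi]) (0 + m0 / (6 * k0 ^+ 3) * cos t ^+ 2)).
      by apply: eq_seg_int => t _; field.
    by rewrite int_cos2_affine; field.
  + by rewrite seg_int_cst ?pi_ge0// mul0r.
  + by rewrite seg_int_cst ?pi_ge0// mul0r.
Qed.

Lemma SD_M : exists C r, [/\ 0 <= C, 0 < r & forall Y Z y z, nrm Y <= r -> nrm Z <= r ->
  (m0 + Y.2) * (1 + Y.1.2)^-1 = y -> (m0 + Z.2) * (1 + Z.1.2)^-1 = z ->
  `|z - y - dot (0, - m0, 1) Y Z|
   <= C * (nrm Y + nrm Z) * dst Y Z].
Proof.
pose D := fun _ : unit => True.
have one : forall i, D i -> 1 <= 1 + 0 :> R by rewrite addr0.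
apply: (@SD_unit _ m0).
apply: (SD_eq (SD_mul (SD_add (SD_const D m0) (SD_3 D))
  (SD_inv ltr01 one (SD_add (SD_const D 1) (SD_2 D))))) => //.
- by move=> i _; rewrite !addr0 invr1 mulr1.
- by move=> i _; apply: lin3E => /=; rewrite addr0; field.
Qed.

Definition curvature : R := m0 * (m0 / (24 * k0 ^+ 2) + 11 / 16).

Lemma curvature_gt0 : 0 < curvature.
Proof.
have m00 : 0 < m0 by rewrite addr_gt0 ?mulr_gt0 ?exprn_gt0.
by rewrite /curvature mulr_gt0// addr_gt0 ?divr_gt0 ?mulr_gt0 ?exprn_gt0.
Qed.

(* Linearized at [e = 0], the period fixes the first functional below and the
   mean fixes the second one; solving for [dm] (increment of [T]) and [dn]
   (increment of [M T]) gives the curvature of the pitchfork. *)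
Lemma linear_system_solution (m k p C1 C2 C3 eta dE dm dn dM d : R) :
  0 < k -> 0 < p -> 0 <= m -> 0 <= eta ->
  d = `|dE| + `|dm| + `|dn| ->
  `|p * (- (11 / 64 * m) / k ^+ 3 + m ^+ 2 / (96 * k ^+ 5)) * dE +
    - (p * m) / (4 * k ^+ 3) * dm + - p / (4 * k ^+ 3) * dn| <= C1 * eta * d ->
  `|p * m / (12 * k ^+ 3) * dE - 2 * p / k * dm| <= C2 * eta * d ->
  `|dM - (- m * dm + dn)| <= C3 * eta * d ->
  let D1 := C1 * (4 * k ^+ 3 / p) in let D2 := C2 * (k / (2 * p)) in
  [/\ `|dM + m * (m / (24 * k ^+ 2) + 11 / 16) * dE| <=
       (C3 + D1 + 2 * m * D2) * eta * d &
     d <= (1 + m / (24 * k ^+ 2) + 11 / 16 * m) * `|dE| +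
       (D1 + (1 + m) * D2) * eta * d].
Proof.
move=> k_gt0 p0 m_ge0 eta0 dd h1 h2 h3 D1 D2.
have e2 : `|dm - m / (24 * k ^+ 2) * dE| <= D2 * eta * d.
  have -> : dm - m / (24 * k ^+ 2) * dE =
     - (k / (2 * p)) * (p * m / (12 * k ^+ 3) * dE - 2 * p / k * dm).
    by field; rewrite !lt0r_neq0.
  have kp : 0 < k / (2 * p) by rewrite divr_gt0 ?mulr_gt0.
  rewrite normrM normrN (gtr0_norm kp).
  have -> : D2 * eta * d = k / (2 * p) * (C2 * eta * d) by rewrite /D2; ring.
  by rewrite ler_wpM2l ?(ltW kp).
have e1 : `|dn + m * dm + (11 / 16 * m - m ^+ 2 / (24 * k ^+ 2)) * dE| <= D1 * eta * d.
  have -> : dn + m * dm + (11 / 16 * m - m ^+ 2 / (24 * k ^+ 2)) * dE =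
     - (4 * k ^+ 3 / p) * (p * (- (11 / 64 * m) / k ^+ 3 + m ^+ 2 / (96 * k ^+ 5)) * dE +
    - (p * m) / (4 * k ^+ 3) * dm + - p / (4 * k ^+ 3) * dn).
    by field; rewrite !lt0r_neq0.
  have kp : 0 < 4 * k ^+ 3 / p by rewrite divr_gt0 ?mulr_gt0 ?exprn_gt0.
  rewrite normrM normrN (gtr0_norm kp).
  have -> : D1 * eta * d = 4 * k ^+ 3 / p * (C1 * eta * d) by rewrite /D1; ring.
  by rewrite ler_wpM2l ?(ltW kp).
have e3 : `|dn + 11 / 16 * m * dE| <= (D1 + m * D2) * eta * d.
  have -> : dn + 11 / 16 * m * dE =
    (dn + m * dm + (11 / 16 * m - m ^+ 2 / (24 * k ^+ 2)) * dE) -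
     m * (dm - m / (24 * k ^+ 2) * dE) by field; rewrite lt0r_neq0.
  apply: le_trans (ler_normB _ _) _; rewrite normrM (ger0_norm m_ge0).
  have := ler_wpM2l m_ge0 e2; lra.
split.
- have -> : dM + m * (m / (24 * k ^+ 2) + 11 / 16) * dE =
    (dM - (- m * dm + dn)) + (dn + 11 / 16 * m * dE)
     - m * (dm - m / (24 * k ^+ 2) * dE) by field; rewrite lt0r_neq0.
  apply: le_trans (ler_normB _ _) _; rewrite normrM (ger0_norm m_ge0).
  have := ler_wpM2l m_ge0 e2; have := ler_normD (dM - (- m * dm + dn)) (dn + 11 / 16 * m * dE).
  lra.
- have c0 : 0 <= m / (24 * k ^+ 2) by rewrite divr_ge0// mulr_ge0// sqr_ge0.
  have f1 : `|dm| <= m / (24 * k ^+ 2) * `|dE| + D2 * eta * d.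
    rewrite -{1}(subrK (m / (24 * k ^+ 2) * dE) dm) addrC.
    apply: le_trans (ler_normD _ _) _; rewrite normrM (ger0_norm c0).
    by rewrite lerD2l.
  have f2 : `|dn| <= 11 / 16 * m * `|dE| + (D1 + m * D2) * eta * d.
    rewrite -{1}(addrK (11 / 16 * m * dE) dn) addrC.
    apply: le_trans (ler_normD _ _) _; rewrite normrN normrM.
    have -> : `|11 / 16 * m| = 11 / 16 * m by rewrite ger0_norm// mulr_ge0.
    by rewrite lerD2l.
  rewrite {1}dd; lra.
Qed.

Lemma mul_sum_le_half (a x y : R) : 0 <= a -> 0 <= x -> 0 <= y ->
  x <= (4 * (a + 1))^-1 -> y <= (4 * (a + 1))^-1 -> a * (x + y) <= 1 / 2.
Proof.
move=> a0 x0 y0; have p : 0 < 4 * (a + 1) by lra.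
rewrite -[(_ * _)^-1]mul1r !(ler_pdivlMr _ _ p); lra.
Qed.

Lemma mul_regroup_le (a b x y : R) : 0 <= b * x * y -> a * (b * x) * (b * y) <= (a * b * b + b) * x * y.
Proof. by lra. Qed.

Lemma le_absorb (d x b c : R) : 0 <= d -> c <= 1 / 2 -> d <= b * x + c * d -> d <= 2 * b * x.
Proof. by move=> d0 /(ler_wpM2r d0); lra. Qed.

Lemma subrBB (a b c : R) : (a - c) - (b - c) = a - b. Proof. by ring. Qed.

Lemma half_period_diff (p k a b : R) :
  2 * (a - 1) * (p / k) - 2 * (b - 1) * (p / k) = 2 * p / k * (a - b).
Proof. by ring. Qed.

Lemma dot_Yv a b c e e' : dot (a, b, c) (Yv e') (Yv e) =
  a * (e ^+ 2 - e' ^+ 2) + b * (Tm g k0 e - Tm g k0 e') + c * (Mt g k0 e - Mt g k0 e').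
Proof. by rewrite /dot /Yv /= !subrBB. Qed.

Lemma dst_Yv e e' : dst (Yv e') (Yv e) =
  `|e ^+ 2 - e' ^+ 2| + `|Tm g k0 e - Tm g k0 e'| + `|Mt g k0 e - Mt g k0 e'|.
Proof. by rewrite /dst /Yv /= !subrBB. Qed.

(** The increments of both constraints between two amplitudes are known exactly
    ([half_period_integrals]), so [linear_system_solution] applies to the increment of [Yv]. Near
    the origin the remainder is absorbed and the full increment is bounded by that of e^2;
    comparison with e' = 0 bounds [Yv e] itself by a multiple of e^2. *)
Lemma amplitude_expansion : exists C r, [/\ 0 <= C, 0 < r, r < 1 &
  forall e e', `|e| < r -> `|e'| < r ->
   `|Tm g k0 e - 1| <= C * e ^+ 2 /\
   `|MM g k0 e - MM g k0 e' + curvature * (e ^+ 2 - e' ^+ 2)| <=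
     C * (e ^+ 2 + e' ^+ 2) * `|e ^+ 2 - e' ^+ 2|].
Proof.
have m00 : 0 <= m0 by have := hg; have := exprn_gt0 2 hk0; lra.
have [C1 [r1 [C10 r10 H1]]] := SD_H1.
have [C2 [r2 [C20 r20 H2]]] := SD_H2.
have [C3 [r3 [C30 r30 H3]]] := SD_M.
pose D1 := C1 * (4 * k0 ^+ 3 / pi); pose D2 := C2 * (k0 / (2 * pi)).
have D10 : 0 <= D1 by rewrite mulr_ge0// divr_ge0 ?pi_ge0// mulr_ge0// exprn_ge0// ltW.
have D20 : 0 <= D2 by rewrite mulr_ge0// divr_ge0 ?(ltW hk0)// mulr_ge0 ?pi_ge0.
pose C4 := C3 + D1 + 2 * m0 * D2; pose C5 := D1 + (1 + m0) * D2.
pose B := 1 + m0 / (24 * k0 ^+ 2) + 11 / 16 * m0.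
have C40 : 0 <= C4 by have := mulr_ge0 m00 D20; rewrite /C4; lra.
have C50 : 0 <= C5 by have := mulr_ge0 m00 D20; rewrite /C5; lra.
have B1 : 1 <= B.
  have : 0 <= m0 / (24 * k0 ^+ 2) by rewrite divr_ge0// mulr_ge0// sqr_ge0.
  rewrite /B; lra.
(* The last entry makes [C5 * eta] at most 1/2, so that the remainder can be absorbed. *)
pose r := Num.min 4^-1 (Num.min r1 (Num.min r2 (Num.min r3 (4 * (C5 + 1))^-1))).
have r0 : 0 < r by rewrite !lt_min r10 r20 r30 !invr_gt0 ltr0n mulr_gt0//; lra.
have [d0 d00 near] := Yv_near r0.
have key e e' : `|e| < d0 -> `|e| < 1 -> `|e'| < d0 -> `|e'| < 1 ->
  let eta := nrm (Yv e') + nrm (Yv e) in let d := dst (Yv e') (Yv e) in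
   `|MM g k0 e - MM g k0 e' + curvature * (e ^+ 2 - e' ^+ 2)| <= C4 * eta * d /\
   d <= 2 * B * `|e ^+ 2 - e' ^+ 2|.
  move=> ed e1 e'd e'1 eta d.
  have := near e ed; rewrite !le_min => /and5P[y0 y1 y2 y3 y4].
  have := near e' e'd; rewrite !le_min => /and5P[z0 z1 z2 z3 z4].
  have [I1 I2] := half_period_integrals e1 y0.
  have [I1' I2'] := half_period_integrals e'1 z0.
  have MM_E x : (m0 + (Yv x).2) * (1 + (Yv x).1.2)^-1 = MM g k0 x.
    by rewrite /Yv /= [m0 + _]addrC subrK [1 + _]addrC subrK.
  have h3 := H3 _ _ _ _ z3 y3 (MM_E e') (MM_E e).
  have h1 := H1 _ _ _ _ z1 y1 I1' I1; have h2 := H2 _ _ _ _ z2 y2 I2' I2.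
  have eta0 : 0 <= eta by rewrite addr_ge0// nrm_ge0.
  have dE : d = `|e ^+ 2 - e' ^+ 2| + `|Tm g k0 e - Tm g k0 e'| + `|Mt g k0 e - Mt g k0 e'|.
    exact: dst_Yv.
  have g1 : `|pi * (- (11 / 64 * m0) / k0 ^+ 3 + m0 ^+ 2 / (96 * k0 ^+ 5)) * (e ^+ 2 - e' ^+ 2) +
    - (pi * m0) / (4 * k0 ^+ 3) * (Tm g k0 e - Tm g k0 e') +
    - pi / (4 * k0 ^+ 3) * (Mt g k0 e - Mt g k0 e')| <= C1 * eta * d.
    by move: h1; rewrite (subrr (2 * L)) dot_Yv sub0r normrN.
  have g2 : `|pi * m0 / (12 * k0 ^+ 3) * (e ^+ 2 - e' ^+ 2) -
      2 * pi / k0 * (Tm g k0 e - Tm g k0 e')| <= C2 * eta * d.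
    move: h2; rewrite dot_Yv !mul0r !addr0 distrC.
    by rewrite half_period_diff.
  have g3 : `|MM g k0 e - MM g k0 e' - (- m0 * (Tm g k0 e - Tm g k0 e') +
      (Mt g k0 e - Mt g k0 e'))| <= C3 * eta * d.
    by move: h3; rewrite dot_Yv mul0r add0r mul1r.
  have [a1 a2] := linear_system_solution hk0 pi0 m00 eta0 dE g1 g2 g3.
  split; first exact: a1.
  have q1 : C5 * eta <= 1 / 2.
    exact: (mul_sum_le_half C50 (nrm_ge0 _) (nrm_ge0 _) z4 y4).
  have d_ge0 : 0 <= d by exact: dst_ge0.
  exact: le_absorb d_ge0 q1 a2.
clear H1 H2 H3; clearbody C4 B.
have B20 : 0 <= 2 * B by lra.
pose rr := Num.min d0 (1 / 2).
exists (C4 * (2 * B) * (2 * B) + 2 * B), rr; split.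
- by rewrite addr_ge0// mulr_ge0// mulr_ge0.
- by rewrite lt_min d00; lra.
- by rewrite gt_min; apply/orP; right; lra.
move=> e e'; rewrite !lt_min => /andP[ed e2] /andP[e'd e'2].
have e1 : `|e| < 1 by lra.
have e'1 : `|e'| < 1 by lra.
have n0 : `|0 : R| < 1 by rewrite normr0.
have nd0 : `|0 : R| < d0 by rewrite normr0.
have yb x : `|x| < d0 -> `|x| < 1 -> nrm (Yv x) <= 2 * B * x ^+ 2.
  move=> xd x1; have [_] := key x 0 xd x1 nd0 n0.
  by rewrite Yv0 dst0 expr0n/= subr0 (ger0_norm (sqr_ge0 x)).
have b1 := yb e ed e1; have b2 := yb e' e'd e'1.
have CB : 0 <= C4 * (2 * B) * (2 * B) by rewrite mulr_ge0// mulr_ge0.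
split.
- have [_ h _] := nrm_coord (lexx (nrm (Yv e))).
  apply: (le_trans h); apply: (le_trans b1); rewrite ler_wpM2r ?sqr_ge0//.
  by rewrite lerDr.
- have [a1 a2] := key e e' ed e1 e'd e'1.
  apply: le_trans a1 _.
  set d := dst _ _ in a2 *; have d_ge0 : 0 <= d by exact: dst_ge0.
  have h : C4 * (nrm (Yv e') + nrm (Yv e)) * d <=
     C4 * (2 * B * (e ^+ 2 + e' ^+ 2)) * (2 * B * `|e ^+ 2 - e' ^+ 2|).
    apply: ler_pM => //; first by rewrite mulr_ge0// addr_ge0// nrm_ge0.
    by rewrite ler_wpM2l// [nrm _ + _]addrC mulrDr lerD.
  apply: (le_trans h).
  apply: mul_regroup_le.
  have : 0 <= 2 * B * (e ^+ 2 + e' ^+ 2) * `|e ^+ 2 - e' ^+ 2|.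
    by rewrite mulr_ge0// mulr_ge0// addr_ge0 ?sqr_ge0.
  exact.
Qed.

Lemma MM0 : MM g k0 0 = m0.
Proof. by rewrite /MM Mt0 Tm0 divr1. Qed.

End local_expansion.

Lemma sqr_le_norm (R : realDomainType) (x y : R) : `|x| <= y -> x ^+ 2 <= y ^+ 2.
Proof.
move=> h; rewrite -(real_normK (num_real x)).
by apply: lerXn2r => //; rewrite nnegrE; exact: le_trans h.
Qed.

(** * Parametrization of the branch *)

Section amplitude_curve.
Context {R : realType}.
Variables (M : R -> R) (c C r : R).
Hypotheses (c0 : 0 < c) (C0 : 0 <= C) (r0 : 0 < r) (r1 : r < 1).
Hypothesis expansion : forall e e', `|e| < r -> `|e'| < r ->
  `|M e - M e' + c * (e ^+ 2 - e' ^+ 2)| <=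
    C * (e ^+ 2 + e' ^+ 2) * `|e ^+ 2 - e' ^+ 2|.
Implicit Types (s e a b : R).

Let phi e := M 0 - M e.

(** On this range C e^2 <= c / 4, so [M] decreases in e^2 at rate at least c / 2 ([phi_lower]). *)
Definition amp_max : R := Num.min (r / 2) (c / (4 * (C + 1))).

Lemma amp_max_gt0 : 0 < amp_max.
Proof. by rewrite lt_min !divr_gt0//; have := C0; lra. Qed.

Lemma amp_max_lt e : `|e| <= amp_max -> `|e| < r.
Proof. by rewrite le_min => /andP[h _]; have := r0; lra. Qed.

Lemma amp_max_bound e : `|e| <= amp_max -> C * e ^+ 2 <= c / 4.
Proof.
move=> h; have := amp_max_lt h; have := r1 => r11 er.
move: h; rewrite le_min => /andP[_]; rewrite ler_pdivlMr => [h|]; last by have := C0; lra.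
have : e ^+ 2 <= `|e|.
  by rewrite -(real_normK (num_real e)) expr2 -[leRHS]mulr1 ler_wpM2l//; lra.
have n0 := normr_ge0 e.
have := mulr_ge0 C0 n0 => Cn h1.
have := ler_wpM2l C0 h1; lra.
Qed.

Lemma phi_lower a b : `|a| <= amp_max -> `|b| <= amp_max -> b ^+ 2 <= a ^+ 2 ->
  c / 2 * (a ^+ 2 - b ^+ 2) <= phi a - phi b.
Proof.
move=> ha hb ab; have := expansion (amp_max_lt ha) (amp_max_lt hb).
have d0 : 0 <= a ^+ 2 - b ^+ 2 by rewrite subr_ge0.
rewrite (ger0_norm d0) ler_norml => /andP[h1 h2].
have ba := amp_max_bound ha; have bb := amp_max_bound hb.
have : C * (a ^+ 2 + b ^+ 2) * (a ^+ 2 - b ^+ 2) <= c / 2 * (a ^+ 2 - b ^+ 2).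
  by rewrite ler_wpM2r//; lra.
rewrite /phi; lra.
Qed.

Lemma phi0 : phi 0 = 0. Proof. by rewrite /phi subrr. Qed.

Lemma phi_norm e : `|e| < r -> phi `|e| = phi e.
Proof.
move=> er; have := @expansion `|e| e; rewrite normr_id real_normK ?num_real//.
rewrite subrr mulr0 addr0 normr0 mulr0 => /(_ er er).
by rewrite normr_le0 subr_eq0 /phi => /eqP ->.
Qed.

Lemma phi_sq e : `|e| <= amp_max -> `|phi e - c * e ^+ 2| <= C * e ^+ 4.
Proof.
move=> h; have n0 : `|0 : R| < r by rewrite normr0.
have := expansion (amp_max_lt h) n0.
rewrite expr0n/= subr0 addr0 (ger0_norm (sqr_ge0 e)) -mulrA -exprD -normrN.
by rewrite /phi opprD opprB.
Qed.

Lemma phi_continuous e : `|e| <= amp_max -> {for e, continuous phi}.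
Proof.
move=> he; have er := amp_max_lt he.
pose C' := c + C * 2.
have sq : x ^+ 2 @[x --> e] --> e ^+ 2 by exact: exprn_continuous.
have cv : (C' * `|x ^+ 2 - e ^+ 2|) @[x --> e] --> (0 : R).
  have -> : (0 : R) = C' * `|e ^+ 2 - e ^+ 2| by rewrite subrr normr0 mulr0.
  by cvg_arith.
apply/cvgrPdist_le => eps eps0.
move: cv => /cvgr0Pnorm_le /(_ eps eps0) [d1 /= d10 h1].
have d2 : 0 < r - `|e| by rewrite subr_gt0.
exists (Num.min d1 (r - `|e|)); first by rewrite /= lt_min d10 d2.
move=> x /=; rewrite lt_min => /andP[x1 x2].
have xr : `|x| < r.
  by have := lerB_dist x e; rewrite distrC in x2; lra.
have hx := expansion er xr; have := h1 x x1.
rewrite ger0_norm; last by rewrite mulr_ge0// /C'; have := C0; have := c0; lra.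
apply: le_trans.
have -> : phi e - phi x = - ((M e - M x + c * (e ^+ 2 - x ^+ 2)) - c * (e ^+ 2 - x ^+ 2)).
  by rewrite /phi; ring.
rewrite normrN; apply: le_trans (ler_normB _ _) _; rewrite normrM (gtr0_norm c0).
have e21 (y : R) : `|y| < r -> y ^+ 2 <= 1.
  by move=> yr; rewrite -[leRHS](expr1n _ 2); apply: sqr_le_norm; have := r1; lra.
have p : C * (e ^+ 2 + x ^+ 2) * `|e ^+ 2 - x ^+ 2| <= C * 2 * `|e ^+ 2 - x ^+ 2|.
  by rewrite ler_wpM2r// ler_wpM2l//; have := e21 e er; have := e21 x xr; lra.
rewrite /C' [`|x ^+ 2 - _|]distrC; lra.
Qed.

(** Half of [amp_max] ensures c s^2 <= phi amp_max, as the intermediate value theorem requires; the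
    bound 1 lets cubic errors be weakened to quadratic ones. *)
Definition s_max : R := Num.min 1 (amp_max / 2).

Lemma s_max_gt0 : 0 < s_max.
Proof. by rewrite lt_min ltr01 divr_gt0 ?amp_max_gt0. Qed.

Lemma local_amplitude_exists s : `|s| <= s_max ->
  exists e, [/\ `|e| <= amp_max, 0 <= e * s & phi e = c * s ^+ 2].
Proof.
rewrite le_min => /andP[_ hs]; have a0 := amp_max_gt0.
have aN : `|amp_max| <= amp_max by rewrite gtr0_norm.
have oN : `|0 : R| <= amp_max by rewrite normr0 ltW.
have s2 : c * s ^+ 2 <= phi amp_max.
  have : s ^+ 2 <= (amp_max / 2) ^+ 2 by exact: sqr_le_norm.
  have := phi_lower aN oN; rewrite expr0n/= phi0 !subr0 => /(_ (sqr_ge0 _)).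
  have := sqr_ge0 amp_max => p0 h1 h2.
  have := mulr_ge0 (ltW c0) p0; have := ler_wpM2l (ltW c0) h2.
  rewrite exprMn expr2 [_^-1 ^+ 2]expr2; lra.
have [e /andP[e0 ea] he] : exists2 e, 0 <= e <= amp_max & phi e = c * s ^+ 2.
  have cw : {within `[0, amp_max], continuous phi}.
    apply: in_continuous_within => x; rewrite in_itv/= => /andP[x0 xa].
    by apply: phi_continuous; rewrite ger0_norm.
  have [|e] := IVT (ltW a0) cw (v := c * s ^+ 2); last by rewrite in_itv/=; exists e.
  rewrite phi0 ge_min le_max s2 orbT andbT; apply/orP; left.
  by rewrite mulr_ge0 ?sqr_ge0 ?ltW.
have [s0|s0] := leP 0 s.
  by exists e; rewrite ger0_norm// mulr_ge0.
exists (- e); rewrite normrN (ger0_norm e0); split => //.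
- by rewrite mulNr -mulrN mulr_ge0// oppr_ge0 ltW.
- rewrite -he -(@phi_norm (- e)) ?normrN ?(ger0_norm e0)//.
  by rewrite -[e in e < r](ger0_norm e0); apply: amp_max_lt; rewrite ger0_norm.
Qed.

Definition local_amplitude s : R :=
  get [set e | [/\ `|e| <= amp_max, 0 <= e * s & phi e = c * s ^+ 2]].

Lemma local_amplitudeP s : `|s| <= s_max ->
  [/\ `|local_amplitude s| <= amp_max, 0 <= local_amplitude s * s &
   phi (local_amplitude s) = c * s ^+ 2].
Proof. by move=> /local_amplitude_exists; exact: getPex. Qed.

Local Notation el := local_amplitude.

Lemma amplitude_sq_lip s s' : `|s| <= s_max -> `|s'| <= s_max ->
  s ^+ 2 <= s' ^+ 2 -> 0 <= el s' ^+ 2 - el s ^+ 2 <= 2 * (s' ^+ 2 - s ^+ 2).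
Proof.
move=> /local_amplitudeP[h1 _ h3] /local_amplitudeP[k1 _ k3] ss.
have [le|lt] := leP (el s ^+ 2) (el s' ^+ 2).
- have := phi_lower k1 h1 le; rewrite h3 k3 -mulrBr => h.
  by rewrite subr_ge0 le /= -(ler_pM2l c0); lra.
- have := phi_lower h1 k1 (ltW lt); rewrite h3 k3 -mulrBr => h.
  have : c / 2 * (el s ^+ 2 - el s' ^+ 2) > 0 by rewrite mulr_gt0 ?divr_gt0// subr_gt0.
  have : c * (s ^+ 2 - s' ^+ 2) <= 0 by rewrite mulr_ge0_le0 ?(ltW c0)// subr_le0.
  lra.
Qed.

Lemma local_amplitude_sq s : `|s| <= s_max -> el s ^+ 2 <= 2 * s ^+ 2.
Proof.
move=> hs; have h0 : `|0 : R| <= s_max by rewrite normr0 ltW// s_max_gt0.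
have := amplitude_sq_lip h0 hs; rewrite expr0n/= subr0 => /(_ (sqr_ge0 s)).
have -> : el 0 ^+ 2 = 0.
  have [h1 _ h2] := local_amplitudeP h0.
  have n0 : `|0 : R| <= amp_max by rewrite normr0 ltW// amp_max_gt0.
  have := phi_lower h1 n0; rewrite h2 expr0n/= phi0 mulr0 !subr0 => /(_ (sqr_ge0 _)).
  have := sqr_ge0 (el 0) => p q; apply/eqP; rewrite eq_le p andbT.
  by move: q; rewrite pmulr_rle0// divr_gt0.
by rewrite subr0 => /andP[].
Qed.

(** [amplitude_sq_lip] controls only squares; the signs are tied to those of the parameters. For
    equal signs (e - e')^2 <= |e^2 - e'^2|, and for opposite signs (s - s')^2 >= s^2 + s'^2
    dominates both squares. *)
Lemma local_amplitude_lip s s' : `|s| <= s_max -> `|s'| <= s_max ->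
  (el s - el s') ^+ 2 <= 2 * `|s ^+ 2 - s' ^+ 2| + 4 * (s - s') ^+ 2.
Proof.
have sub (x y : R) : `|x| <= s_max -> `|y| <= s_max -> x ^+ 2 <= y ^+ 2 ->
  (el x - el y) ^+ 2 <= 2 * `|x ^+ 2 - y ^+ 2| + 4 * (x - y) ^+ 2.
  move=> hx hy xy; have /andP[l1 l2] := amplitude_sq_lip hx hy xy.
  have [_ x1 _] := local_amplitudeP hx; have [_ y1 _] := local_amplitudeP hy.
  have -> : `|x ^+ 2 - y ^+ 2| = y ^+ 2 - x ^+ 2 by rewrite ler0_norm ?subr_le0// opprB.
  have d0 := sqr_ge0 (x - y).
  have [xy0|xy0] := leP 0 (x * y).
  - have p : 0 <= el x * el y.
      have [->|xn] := eqVneq x 0.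
        have n0 : `|0 : R| <= s_max by rewrite normr0 ltW// s_max_gt0.
        have := local_amplitude_sq n0; rewrite expr0n/= mulr0 => h.
        have /eqP : el 0 ^+ 2 = 0 by apply/eqP; rewrite eq_le h sqr_ge0.
        by rewrite sqrf_eq0 => /eqP ->; rewrite mul0r.
      have [yE|yn] := eqVneq y 0.
        have := xy; rewrite yE expr0n/= => h.
        have : x ^+ 2 = 0 by apply/eqP; rewrite eq_le h sqr_ge0.
        by move/eqP; rewrite sqrf_eq0 (negbTE xn).
      have xy1 : 0 < x * y by rewrite lt0r xy0 mulf_neq0.
      have := mulr_ge0 x1 y1; rewrite (_ : el x * x * (el y * y) = el x * el y * (x * y)); last by ring.
      by rewrite pmulr_lge0.
    have q : (el x - el y) ^+ 2 = el y ^+ 2 - el x ^+ 2 + 2 * (el x ^+ 2 - el x * el y) by ring.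
    have m0 : el x ^+ 2 <= el x * el y.
      rewrite -(@ler_pXn2r _ 2)// ?nnegrE ?sqr_ge0//.
      rewrite (exprMn _ (el x) (el y)) [leLHS]expr2 ler_wpM2l ?sqr_ge0//; lra.
    lra.
  - have := sqr_ge0 (el x + el y).
    have := local_amplitude_sq hx; have := local_amplitude_sq hy.
    have : (x - y) ^+ 2 = x ^+ 2 + y ^+ 2 - 2 * (x * y) by ring.
    have : (el x - el y) ^+ 2 = 2 * (el x ^+ 2 + el y ^+ 2) - (el x + el y) ^+ 2 by ring.
    lra.
move=> hs hs'; have [h|h] := leP (s ^+ 2) (s' ^+ 2); first exact: sub.
have := sub s' s hs' hs (ltW h); rewrite [`|_|]distrC.
have -> : (el s' - el s) ^+ 2 = (el s - el s') ^+ 2 by ring.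
by have -> : (s' - s) ^+ 2 = (s - s') ^+ 2 by ring.
Qed.

Definition clamp s : R := Num.max (- s_max) (Num.min s s_max).

Lemma clamp_le s : `|clamp s| <= s_max.
Proof.
have := s_max_gt0 => p; rewrite ler_norml /clamp le_max lexx /= ge_max ge_min lexx orbT andbT.
lra.
Qed.

Lemma clamp_id s : `|s| <= s_max -> clamp s = s.
Proof.
rewrite ler_norml => /andP[h1 h2].
by rewrite /clamp (min_idPl h2); apply/max_idPr.
Qed.

Lemma clamp_sign s : s != 0 -> 0 < clamp s * s.
Proof.
have p := s_max_gt0; rewrite /clamp; have [h|h|->] := ltgtP s 0 => // _.
- have h1 : Num.min s s_max = s by apply/min_idPl; lra.
  by rewrite h1; case: (leP (- s_max) s) => _; rewrite nmulr_lgt0//; lra.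
- have h1 : - s_max <= Num.min s s_max by rewrite le_min; lra.
  by rewrite (max_idPr h1) mulr_gt0// lt_min h.
Qed.

(* Continues the local amplitude beyond [s_max] monotonically to [1]. *)
Definition overshoot s : R := (s - clamp s) / (1 + `|s - clamp s|).

Lemma overshoot_lt s : `|overshoot s| < 1.
Proof.
have n := normr_ge0 (s - clamp s); have p : 0 < 1 + `|s - clamp s| by lra.
by rewrite /overshoot normrM normfV (gtr0_norm p) ltr_pdivrMr// mul1r; lra.
Qed.

Lemma overshoot_sign s : 0 <= overshoot s * s.
Proof.
have n := normr_ge0 (s - clamp s); have p : 0 < 1 + `|s - clamp s| by lra.
have q := s_max_gt0.
rewrite /overshoot mulrAC; apply: divr_ge0; last exact: ltW.
rewrite /clamp; have [h|h] := leP s s_max.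
  have [h1|h1] := leP (- s_max) s; first by rewrite subrr mul0r.
  by rewrite mulr_le0//; lra.
have h1 : - s_max <= s_max by lra.
by rewrite (max_idPr h1) mulr_ge0//; lra.
Qed.

Definition amplitude s : R := el (clamp s) + (1 - `|el s_max|) * overshoot s.

Lemma el_max_lt1 : `|el s_max| < 1.
Proof.
have p := s_max_gt0; have [|h _ _] := @local_amplitudeP s_max; first by rewrite gtr0_norm.
by apply: lt_trans (amp_max_lt h) _.
Qed.

Lemma amplitude_lt1 s : `|amplitude s| < 1.
Proof.
have p := s_max_gt0; have a1 := el_max_lt1.
have h1 : `|el (clamp s)| <= `|el s_max|.
  have h2 : `|s_max| <= s_max by rewrite gtr0_norm.
  have := amplitude_sq_lip (clamp_le s) h2 (sqr_le_norm (clamp_le s)).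
  rewrite subr_ge0 => /andP[h3 _].
  by rewrite -(@ler_pXn2r _ 2)// ?nnegrE// !real_normK ?num_real.
have o := overshoot_lt s.
apply: le_lt_trans (ler_normD _ _) _; rewrite normrM (gtr0_norm (x := 1 - _)) ?subr_gt0//.
have : (1 - `|el s_max|) * `|overshoot s| < 1 - `|el s_max|.
  by rewrite gtr_pMr ?subr_gt0.
lra.
Qed.

Lemma local_amplitude_neq0 s : `|s| <= s_max -> s != 0 -> 0 < el s * s.
Proof.
move=> hs sn; have [h1 h2 h3] := local_amplitudeP hs.
rewrite lt0r h2 andbT mulf_neq0//; apply/eqP => e0.
move: h3; rewrite e0 phi0 => /esym/eqP.
by rewrite mulf_eq0 sqrf_eq0 (negbTE sn) orbF; rewrite gt_eqF.
Qed.

Lemma amplitude_sign s : s != 0 -> 0 < amplitude s * s.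
Proof.
move=> sn; rewrite /amplitude mulrDl; apply: ltr_pwDl.
- have cs := clamp_sign sn.
  have cn : clamp s != 0 by apply/eqP => c00; move: cs; rewrite c00 mul0r ltxx.
  have := mulr_gt0 (local_amplitude_neq0 (clamp_le s) cn) cs.
  rewrite (_ : _ * (clamp s * s) = el (clamp s) * s * (clamp s) ^+ 2); last by ring.
  by rewrite pmulr_lgt0// exprn_even_gt0.
- by rewrite -mulrA mulr_ge0 ?overshoot_sign// subr_ge0 ltW// el_max_lt1.
Qed.

Lemma amplitude_local s : `|s| <= s_max -> amplitude s = el s.
Proof.
by move=> hs; rewrite /amplitude /overshoot (clamp_id hs) subrr mul0r mulr0 addr0.
Qed.

Lemma clamp_cvg s : clamp x @[x --> s] --> clamp s.
Proof.
apply: (@continuous_comp _ _ _ (fun x => Num.min x s_max) (fun y => Num.max (- s_max) y)).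
  by apply: continuous_min; [exact: cvg_id|exact: cvg_cst].
by apply: continuous_max; [exact: cvg_cst|exact: cvg_id].
Qed.

Lemma amplitude_continuous : continuous amplitude.
Proof.
move=> s; rewrite /amplitude; have hc := @clamp_cvg s.
apply: cvgD.
- have cv : 2 * `|clamp s * clamp s - clamp x * clamp x| +
      4 * ((clamp s - clamp x) * (clamp s - clamp x)) @[x --> s] --> (0 : R).
    have -> : (0 : R) = 2 * `|clamp s * clamp s - clamp s * clamp s| +
        4 * ((clamp s - clamp s) * (clamp s - clamp s)).
      by rewrite !subrr normr0 !mulr0 addr0.
    by cvg_arith.
  apply/cvgrPdist_lt => eps eps0.
  have e20 : 0 < eps ^+ 2 by rewrite exprn_gt0.
  move: cv => /cvgr0Pnorm_lt /(_ _ e20); apply: filterS => x; rewrite -!expr2 => hx.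
  have := local_amplitude_lip (clamp_le s) (clamp_le x) => h.
  have := le_lt_trans (le_trans h (ler_norm _)) hx.
  rewrite -(real_normK (num_real (el (clamp s) - _))).
  by rewrite ltr_pXn2r// nnegrE// ltW.
- apply: cvgM; first exact: cvg_cst.
  rewrite /overshoot; have n : 1 + `|s - clamp s| != 0.
    by rewrite lt0r_neq0//; have := normr_ge0 (s - clamp s); lra.
  by cvg_arith.
Qed.

Lemma amplitude_sup d : 0 < d -> exists s, 1 - d < amplitude s.
Proof.
(* At this parameter [overshoot] equals 1 / (1 + d). *)
move=> d0; have p := s_max_gt0; exists (s_max + d^-1).
have i0 : 0 < d^-1 by rewrite invr_gt0.
have cE : clamp (s_max + d^-1) = s_max.
  rewrite /clamp (min_idPr _); last lra.
  by apply/max_idPr; lra.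
have el0 : 0 <= el s_max.
  have [|_ h _] := @local_amplitudeP s_max; first by rewrite gtr0_norm.
  by move: h; rewrite pmulr_lge0.
have a1 := el_max_lt1; rewrite /amplitude /overshoot cE (ger0_norm el0) in a1 *.
have dE : s_max + d^-1 - s_max = d^-1 by ring.
have i1 : 0 < 1 + d by lra.
rewrite dE (gtr0_norm i0) (_ : d^-1 / _ = 1 - d / (1 + d)); last first.
  by field; rewrite !lt0r_neq0.
have : (1 - el s_max) * (d / (1 + d)) <= d / (1 + d).
  by rewrite ler_piMl ?divr_ge0 ?(ltW d0) ?(ltW i1)//; lra.
have : d / (1 + d) < d.
  by rewrite ltr_pdivrMr//; have := mulr_gt0 d0 d0; lra.
lra.
Qed.

(** From c |s^2 - e^2| <= C e^4 <= 4 C s^4 and |s + e| >= |s|, as e and s have the same sign. The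
    resulting cubic bound is weakened by |s| <= 1. *)
Lemma local_amplitude_cube s : `|s| <= s_max ->
  `|el s - s| <= 4 * C / c * s ^+ 2.
Proof.
move=> hs; have [->|sn] := eqVneq s 0.
  have n0 : `|0 : R| <= s_max by rewrite normr0 ltW// s_max_gt0.
  have := local_amplitude_sq n0; rewrite expr0n/= !mulr0 subr0 => h.
  have /eqP : el 0 ^+ 2 = 0 by apply/eqP; rewrite eq_le h sqr_ge0.
  by rewrite sqrf_eq0 => /eqP ->; rewrite normr0.
have [h1 h2 h3] := local_amplitudeP hs.
have h4 := local_amplitude_sq hs.
have s0 : 0 < `|s| by rewrite normr_gt0.
have s1 : `|s| <= 1 by move: hs; rewrite le_min => /andP[].
have h5 := phi_sq h1; rewrite h3 -mulrBr normrM (gtr0_norm c0) in h5.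
have h6 : `|s| * `|el s - s| <= `|s ^+ 2 - el s ^+ 2|.
  have -> : s ^+ 2 - el s ^+ 2 = (s + el s) * (s - el s) by ring.
  rewrite normrM [`|s - _|]distrC ler_wpM2r//.
  rewrite -(@ler_pXn2r _ 2)// ?nnegrE// !real_normK ?num_real//.
  have := sqr_ge0 (el s); have -> : (s + el s) ^+ 2 = s ^+ 2 + el s ^+ 2 + 2 * (el s * s) by ring.
  lra.
have h7 : C * el s ^+ 4 <= C * (4 * `|s| ^+ 4).
  rewrite ler_wpM2l//; rewrite (_ : 4 = 2 * 2)%N// !exprM real_normK ?num_real//.
  have -> : 4 * (s ^+ 2) ^+ 2 = (2 * s ^+ 2) ^+ 2 by ring.
  have s20 : 0 <= 2 * s ^+ 2 by rewrite mulr_ge0// sqr_ge0.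
  by apply: lerXn2r; rewrite ?nnegrE ?sqr_ge0.
have h8 : c * `|s| * `|el s - s| <= C * 4 * `|s| ^+ 4.
  have := ler_wpM2l (ltW c0) h6; lra.
have h9 : C * 4 * `|s| ^+ 4 <= `|s| * (C * 4 * `|s| ^+ 2).
  have : 0 <= C * 4 * `|s| ^+ 3 by rewrite !mulr_ge0// exprn_ge0.
  move=> q; have : C * 4 * `|s| ^+ 3 * `|s| <= C * 4 * `|s| ^+ 3 * 1 by rewrite ler_wpM2l.
  by rewrite !exprS !expr0; lra.
have h10 : c * `|el s - s| <= C * 4 * `|s| ^+ 2.
  rewrite -(ler_pM2l s0); apply: le_trans h9; apply: le_trans h8; lra.
rewrite real_normK ?num_real// in h10.
rewrite (_ : 4 * C / c * s ^+ 2 = (C * 4 * s ^+ 2) / c); last by ring.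
by rewrite ler_pdivlMr// mulrC.
Qed.

Lemma M_amplitude s : `|s| <= s_max -> M (amplitude s) = M 0 - c * s ^+ 2.
Proof.
move=> hs; rewrite (amplitude_local hs); have [_ _ <-] := local_amplitudeP hs.
by rewrite /phi opprB addrC subrK.
Qed.

End amplitude_curve.

Lemma near_fst (A B : topologicalType) (a : A) (b : B) (P : A -> Prop) :
  (\forall x \near a, P x) -> \forall p \near (a, b), P p.1.
Proof. by move=> h; exact: (cvg_pr1 (@cvg_id _ (nbhs (a, b))) h). Qed.

Lemma near_snd (A B : topologicalType) (a : A) (b : B) (P : B -> Prop) :
  (\forall x \near b, P x) -> \forall p \near (a, b), P p.2.
Proof. by move=> h; exact: (cvg_pr2 (@cvg_id _ (nbhs (a, b))) h). Qed.

Lemma near_comp (A B : topologicalType) (f : A -> B) (a : A) (P : B -> Prop) :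
  {for a, continuous f} -> (\forall x \near f a, P x) -> \forall t \near a, P (f t).
Proof. by move=> cf h; exact: (cf _ h). Qed.

Lemma near_norm_lt (R : realType) (a b : R) : `|a| < b ->
  \forall x \near a, `|x| < b.
Proof.
move=> ab; have h : `|x| @[x --> a] --> `|a| by exact: cvR_norm cvg_id.
have := @cvgr_lt _ _ _ _ (fun e : R => `|e|) _ h b ab; exact.
Qed.

(** * Continuity in the amplitude *)

Section dependence_on_amplitude.
Context {R : realType}.
Notation mu := (@lebesgue_measure R).
Variables (g k0 : R).
Hypotheses (hg : 0 < g) (hk0 : 0 < k0).
Implicit Types (e t x : R).

Local Notation L := (pi / k0).
Local Notation X := (X g k0).
Local Notation Theta := (Theta g k0).
Local Notation vv := (vv g k0).
Local Notation dvv := (dvv g k0).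
Local Notation ddvv := (ddvv g k0).
Local Notation zz := (zz g k0).
Local Notation sq := (sq g k0).
Local Notation MM := (MM g k0).
Local Notation w := (w g k0).
Local Notation T := (Tm g k0).

Lemma w_cvg e0 t : `|e0| < 1 -> w p.1 p.2 @[p --> (e0, t)] --> w e0 t.
Proof.
move=> e01; have c1 := cvg_pr1 (@cvg_id _ (nbhs (e0, t))).
have c2 := cvg_pr2 (@cvg_id _ (nbhs (e0, t))).
apply: W_cvg => //.
- exact: Tm_gt0.
- exact: qe_gt0.
- exact: abs_ecos.
- exact: Tm_cvg.
- exact: qe_cvg.
- by cvg_arith.
Qed.

Lemma X_near e0 (eps : R) : `|e0| < 1 -> 0 < eps ->
  \forall e \near e0, forall t, `|t| <= 2 * pi -> `|X e t - X e0 t| <= eps.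
Proof.
move=> e01 eps0; have p0 : 0 < 2 * (pi : R) by rewrite mulr_gt0// pi_gt0.
have u := uniform_on_segment (divr_gt0 eps0 p0)
  (fun t (_ : t \in `[0, 2 * pi]%R) => w_cvg e01).
near=> e; have e1 : `|e| < 1 by near: e; exact: near_norm_lt.
have ue : {in `[0, 2 * pi]%R, forall t, `|w e t - w e0 t| < eps / (2 * pi)}.
  by near: e; exact: u.
have pos t : 0 <= t -> t <= 2 * pi -> `|X e t - X e0 t| <= eps.
  move=> t0 t2.
  have d x : x \in `[0, t]%R -> is_derive x 1 (X e \- X e0) (w e x - w e0 x).
    by move=> _; apply: is_deriveB; exact: dX.
  have b x : x \in `[0, t]%R -> `|w e x - w e0 x| <= eps / (2 * pi).
    rewrite in_itv/= => /andP[x0 xt]; apply/ltW/ue.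
    by rewrite in_itv/= x0 (le_trans xt).
  have := derive_mvt_le t0 d b.
  rewrite /= (X0 hg hk0 e1) (X0 hg hk0 e01) subr0 !subr0 => h.
  apply: (le_trans h); rewrite mulrAC ler_pdivrMr// ler_wpM2l//; exact: ltW.
move=> t; rewrite ler_norml => /andP[t1 t2].
have [t0|t0] := leP 0 t; first exact: pos.
have := pos (- t) ltac:(lra) ltac:(lra).
by rewrite (XN hg hk0 e1) (XN hg hk0 e01) -opprD normrN.
Unshelve. all: by end_near.
Qed.

Lemma Theta_mono e a b : `|e| < 1 -> (Theta e a < Theta e b) = (a < b).
Proof.
by move=> e1; rewrite -(X_lt hg hk0 e1) !(ThetaK hg hk0 e1).
Qed.

Lemma Theta_2L e : `|e| < 1 -> Theta e (2 * L) = 2 * pi.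
Proof.
move=> e1; have := ThetaD2L hg hk0 e1 0.
by rewrite (Theta0 hg hk0 e1) !add0r.
Qed.

(** Write Theta e x = Theta e0 (X e0 (Theta e x)). The argument of Theta e0 differs from x by X e0 -
    X e at Theta e x, which is small by [X_near], because the bound 2 L keeps the phase in
    [- 2 pi, 2 pi]. Joint continuity thus reduces to continuity of the single function
    [Theta e0]. *)
Lemma Theta_cvg e0 x0 : `|e0| < 1 -> `|x0| < 2 * L ->
  Theta p.1 p.2 @[p --> (e0, x0)] --> Theta e0 x0.
Proof.
move=> e01 x0L.
have sh : p.2 + (X e0 (Theta p.1 p.2) - p.2) @[p --> (e0, x0)] --> x0.
  rewrite -[x0 in X in _ --> X](addr0 x0); apply: cvR_D.
    exact: cvg_pr2 (@cvg_id _ (nbhs (e0, x0))).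
  apply/cvgr0Pnorm_le => eps eps0.
  have h1 : \forall p \near (e0, x0), `|p.1| < 1 /\
     forall t, `|t| <= 2 * pi -> `|X p.1 t - X e0 t| <= eps.
    apply: (near_fst x0 (P := fun e => `|e| < 1 /\
      forall t, `|t| <= 2 * pi -> `|X e t - X e0 t| <= eps)).
    by apply: filterI; [exact: near_norm_lt|exact: X_near].
  have h2 : \forall p \near (e0, x0), `|p.2| < 2 * L.
    exact: (near_snd e0 (near_norm_lt x0L)).
  apply: filterS2 h1 h2 => -[e x] /= [e1 he] xL.
  have := he (Theta e x); rewrite (ThetaK hg hk0 e1) distrC; apply.
  move: xL; rewrite ltr_norml ler_norml => /andP[x1 x2].
  rewrite -(Theta_2L e1) -(ThetaN hg hk0 e1) !ltW ?Theta_mono//.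
have := @cvg_comp _ _ _ _ (Theta e0) _ _ _ sh (Theta_continuous hg hk0 e01 (x := x0)).
apply: cvg_trans; apply: near_eq_cvg.
near=> p; rewrite /= addrC subrK (XK hg hk0 e01)//.
Unshelve. all: by end_near.
Qed.

Lemma L_lt_2L x : x \in `[- L, L]%R -> `|x| < 2 * L.
Proof.
have l0 := L_gt0 hk0; rewrite in_itv/= => /andP[x1 x2].
by rewrite ltr_norml; apply/andP; split; lra.
Qed.

Lemma zz_cvg e0 x0 : `|e0| < 1 -> `|x0| < 2 * L ->
  zz p.1 p.2 @[p --> (e0, x0)] --> zz e0 x0.
Proof.
move=> e01 xL; have c1 := cvg_pr1 (@cvg_id _ (nbhs (e0, x0))).
by have c3 := Theta_cvg e01 xL; rewrite /zz; cvg_arith.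
Qed.

Lemma vv_cvg e0 x0 : `|e0| < 1 -> `|x0| < 2 * L ->
  vv p.1 p.2 @[p --> (e0, x0)] --> vv e0 x0.
Proof.
move=> e01 xL; have c1 := cvg_pr1 (@cvg_id _ (nbhs (e0, x0))).
have c2 := Tm_cvg hg hk0 e01 c1; have c3 := zz_cvg e01 xL.
have t0 : T e0 != 0 by rewrite lt0r_neq0// Tm_gt0.
by rewrite /vv; cvg_arith.
Qed.

Lemma sq_cvg e0 x0 : `|e0| < 1 -> `|x0| < 2 * L ->
  sq p.1 p.2 @[p --> (e0, x0)] --> sq e0 x0.
Proof.
move=> e01 xL; have c1 := cvg_pr1 (@cvg_id _ (nbhs (e0, x0))).
have c2 := Tm_cvg hg hk0 e01 c1; have c3 := zz_cvg e01 xL.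
have c4 := qe_cvg hg hk0 e01 c1.
rewrite /sq; apply: cvR_sqrt; apply: Q_cvg => //.
- exact: Tm_gt0.
- exact: zz_gtN1.
Qed.

Lemma dvv_cvg e0 x0 : `|e0| < 1 -> `|x0| < 2 * L ->
  dvv p.1 p.2 @[p --> (e0, x0)] --> dvv e0 x0.
Proof.
move=> e01 xL; have c1 := cvg_pr1 (@cvg_id _ (nbhs (e0, x0))).
have c2 := Tm_cvg hg hk0 e01 c1; have c3 := Theta_cvg e01 xL.
have c4 := sq_cvg e01 xL.
have t0 : T e0 != 0 by rewrite lt0r_neq0// Tm_gt0.
by rewrite /dvv; cvg_arith.
Qed.

Lemma nonlin_vv_cvg e0 x0 : `|e0| < 1 -> `|x0| < 2 * L ->
  nonlin (vv p.1 p.2) @[p --> (e0, x0)] --> nonlin (vv e0 x0).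
Proof.
move=> e01 xL; have c1 := vv_cvg e01 xL.
have v1 := vv_gtN1 hg hk0 e01 x0.
have n1 : 2 + vv e0 x0 != 0 by rewrite lt0r_neq0//; lra.
have n2 : 0 < (1 + vv e0 x0) / (2 + vv e0 x0) by rewrite divr_gt0//; lra.
by rewrite /nonlin; cvg_arith.
Qed.

Lemma K_cvg e0 : `|e0| < 1 -> K k0 (vv e) @[e --> e0] --> K k0 (vv e0).
Proof.
move=> e01; rewrite /K; apply: cvR_M; first exact: cvg_cst.
apply: (@seg_int_continuous _ _ (fun e x => nonlin (vv e x))).
- exact: oppL_le_L.
- by move=> x /L_lt_2L xL; exact: nonlin_vv_cvg.
- apply: filterS (near_norm_lt e01) => e e1 x _.
  exact: nonlin_vv_continuous.
Qed.

Lemma MM_cvg e0 : `|e0| < 1 -> MM e @[e --> e0] --> MM e0.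
Proof.
move=> e01; have c1 := Tm_cvg hg hk0 e01 (@cvg_id _ (nbhs e0)).
have c2 := Mt_cvg hg hk0 e01 (@cvg_id _ (nbhs e0)).
have t0 : T e0 != 0 by rewrite lt0r_neq0// Tm_gt0.
by rewrite /MM; cvg_arith.
Qed.

Lemma ddvv_cvg e0 x0 : `|e0| < 1 -> `|x0| < 2 * L ->
  ddvv p.1 p.2 @[p --> (e0, x0)] --> ddvv e0 x0.
Proof.
move=> e01 xL; have c1 := vv_cvg e01 xL; have c2 := nonlin_vv_cvg e01 xL.
have c3 : MM p.1 @[p --> (e0, x0)] --> MM e0.
  exact: (cvg_comp _ _ (cvg_pr1 (@cvg_id _ (nbhs (e0, x0)))) (MM_cvg e01)).
have c4 : K k0 (vv p.1) @[p --> (e0, x0)] --> K k0 (vv e0).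
  exact: (cvg_comp _ _ (cvg_pr1 (@cvg_id _ (nbhs (e0, x0)))) (K_cvg e01)).
by rewrite /ddvv; cvg_arith.
Qed.

Lemma H2_norm_diff_near e0 (d : R) : `|e0| < 1 -> 0 < d ->
  \forall e \near e0,
    (H2_norm k0 (vv e \- vv e0)%R <= (Num.sqrt (6 * L) * d)%:E)%E.
Proof.
move=> e01 d0.
have u0 := uniform_on_segment d0 (fun x (h : x \in `[- L, L]%R) => vv_cvg e01 (L_lt_2L h)).
have u1 := uniform_on_segment d0 (fun x (h : x \in `[- L, L]%R) => dvv_cvg e01 (L_lt_2L h)).
have u2 := uniform_on_segment d0 (fun x (h : x \in `[- L, L]%R) => ddvv_cvg e01 (L_lt_2L h)).
apply: filterS (filterI (near_norm_lt e01) (filterI u0 (filterI u1 u2))) => e [e1 [v0 [v1 v2]]].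
apply: (@H2_norm_le _ k0 d (vv e \- vv e0) (dvv e \- dvv e0) (ddvv e \- ddvv e0)).
- exact: hk0.
- exact: ltW.
- by move=> x; apply: is_deriveB; exact: dvvP.
- by move=> x; apply: is_deriveB; exact: ddvvP.
- move=> x; apply: cvgB; exact: ddvv_continuous.
- by move=> x xL; split; apply: ltW; [exact: v0|exact: v1|exact: v2].
Qed.

Lemma H2_norm_ge0 (u : R -> R) : (0 <= H2_norm k0 u)%E.
Proof. exact: poweR_ge0. Qed.

Lemma H2_continuous (e : R -> R) s : `|e s| < 1 -> {for s, continuous e} ->
  H2_norm k0 (vv (e t) \- vv (e s)) @[t --> s] --> 0%E.
Proof.
move=> es ce; have l0 := L_gt0 hk0.
have c0 : 0 < Num.sqrt (6 * L) by rewrite sqrtr_gt0 mulr_gt0.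
have near (d : R) : 0 < d -> \forall t \near s, (H2_norm k0 (vv (e t) \- vv (e s))%R <= d%:E)%E.
  move=> d0; have := H2_norm_diff_near es (divr_gt0 d0 c0).
  have cd (c : R) : 0 < c -> c * (d / c) = d by move=> p; rewrite mulrCA divff ?mulr1 ?lt0r_neq0.
  rewrite (cd _ c0) => h.
  exact: (near_comp (P := fun a => (H2_norm k0 (vv a \- vv (e s))%R <= d%:E)%E) ce h).
have fin : \forall t \near s, H2_norm k0 (vv (e t) \- vv (e s)) \is a fin_num.
  apply: filterS (near 1 ltr01) => t ht.
  by rewrite ge0_fin_numE ?H2_norm_ge0//; apply: le_lt_trans ht _; rewrite ltry.
apply/fine_cvgP; split => //.
apply/cvgr0Pnorm_le => eps eps0; apply: filterS2 fin (near eps eps0) => t ft ht.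
rewrite /= ger0_norm ?fine_ge0 ?H2_norm_ge0//.
by rewrite -lee_fin fineK.
Qed.

End dependence_on_amplitude.

(** * Small amplitudes *)

Section scalar_estimates.
Context {R : realType}.
Implicit Types (x y v : R).

Lemma cos_lip x y : `|cos x - cos y| <= `|x - y|.
Proof.
wlog xy : x y / y <= x.
  move=> h; have [/h//|/ltW/h] := leP y x.
  by rewrite distrC [`|y - x|]distrC.
rewrite [`|x - y|]ger0_norm ?subr_ge0// -[leRHS]mul1r.
apply: (derive_mvt_le xy (df := fun t => - sin t)) => t _; first exact: is_derive_cos.
by rewrite normrN ler_norml sin_geN1 sin_le1.
Qed.

Lemma sin_lip x y : `|sin x - sin y| <= `|x - y|.
Proof.
wlog xy : x y / y <= x.
  move=> h; have [/h//|/ltW/h] := leP y x.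
  by rewrite distrC [`|y - x|]distrC.
rewrite [`|x - y|]ger0_norm ?subr_ge0// -[leRHS]mul1r.
apply: (derive_mvt_le xy (df := fun t => cos t)) => t _; first exact: is_derive_sin.
by rewrite ler_norml cos_geN1 cos_le1.
Qed.

Lemma nonlin_taylor v : `|v| <= 1 / 2 -> `|nonlin v - nonlin 0 - v / 4| <= 3 * v ^+ 2.
Proof.
move=> hv.
have d (t : R) : t \in `[0, 1]%R -> is_derive t 1 (fun t => nonlin (v * t) - v * t / 4)
    (v * (((1 + v * t) * (2 + v * t) ^+ 2)^-1 - 4^-1)).
  rewrite in_itv/= => /andP[t0 t1].
  have vt : `|v * t| <= 1 / 2.
    by rewrite normrM (ger0_norm t0); have := ler_wpM2l (normr_ge0 v) t1; lra.
  have h : -1 < v * t by move: vt; rewrite ler_norml => /andP[]; lra.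
  have h1 := is_derive_nonlin h.
  have h2 : is_derive t 1 (fun t => v * t) v by apply: is_derive_eq; rewrite /GRing.scale/=; ring.
  have h3 := is_derive1_comp (f := fun y : R => nonlin y) (g := fun t => v * t) (x := t).
  apply: is_derive_eq; rewrite /GRing.scale/=; ring.
have b (t : R) : t \in `[0, 1]%R ->
    `|v * (((1 + v * t) * (2 + v * t) ^+ 2)^-1 - 4^-1)| <= 3 * v ^+ 2.
  rewrite in_itv/= => /andP[t0 t1].
  have vt : `|v * t| <= `|v|.
    by rewrite normrM (ger0_norm t0); have := ler_wpM2l (normr_ge0 v) t1; lra.
  set y := v * t in vt *.
  have : `|y| <= 1 / 2 by lra.
  rewrite ler_norml => /andP[y1 y2].
  have p0 : 9 / 8 <= (1 + y) * (2 + y) ^+ 2.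
    have : (3 / 2) * (3 / 2) <= (2 + y) * (2 + y) by apply: ler_pM; lra.
    rewrite expr2 => q; have : 1 / 2 * (3 / 2 * (3 / 2)) <= (1 + y) * ((2 + y) * (2 + y)).
      by apply: ler_pM => //; lra.
    lra.
  have -> : v * (((1 + y) * (2 + y) ^+ 2)^-1 - 4^-1) =
     v * - y * (8 + 5 * y + y ^+ 2) / (4 * ((1 + y) * (2 + y) ^+ 2)).
    by field; rewrite !lt0r_neq0//; lra.
  have y20 : y ^+ 2 <= 1 / 4.
    have : 0 <= (1 / 2 - y) * (1 / 2 + y) by rewrite mulr_ge0//; lra.
    by rewrite expr2; lra.
  have y200 := sqr_ge0 y.
  have a0 : 0 <= 8 + 5 * y + y ^+ 2 by lra.
  have b0 : 0 < 4 * ((1 + y) * (2 + y) ^+ 2) by lra.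
  rewrite !normrM normrN normfV (gtr0_norm b0) (ger0_norm a0) ler_pdivrMr//.
  have vy : `|v| * `|y| <= v ^+ 2.
    by rewrite -(real_normK (num_real v)) expr2 ler_wpM2l.
  have vy0 : 0 <= `|v| * `|y| by rewrite mulr_ge0.
  apply: (@le_trans _ _ (v ^+ 2 * (27 / 2))); first by apply: ler_pM => //; lra.
  have := sqr_ge0 v => v0; have := ler_wpM2l v0 p0; lra.
have := derive_mvt_le ler01 d b.
rewrite /= mulr1 !mulr0 mul0r !subr0 mulr1; congr (`|_| <= _); ring.
Qed.

Lemma vv_estimate (e c c0 T H C1 : R) : `|e| <= 1 -> `|c| <= 1 ->
  `|c - c0| <= H * `|e| -> 1 <= T -> `|T - 1| <= C1 * e ^+ 2 ->
  `|(1 + e * c) / T - 1 - e * c0| <= (H + 2 * C1) * e ^+ 2.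
Proof.
move=> e1 c1 cc T1 Te; have Ti : T^-1 <= 1 by rewrite invf_le1//; lra.
have T0 : 0 < T^-1 by rewrite invr_gt0; lra.
have -> : (1 + e * c) / T - 1 - e * c0 = - (T - 1) * T^-1 * (1 + e * c) + e * (c - c0).
  by field; rewrite lt0r_neq0//; lra.
apply: le_trans (ler_normD _ _) _; rewrite !normrM normrN (gtr0_norm T0).
have h1 : `|1 + e * c| <= 2.
  apply: le_trans (ler_normD _ _) _; rewrite normr1 normrM.
  have := ler_pM (normr_ge0 _) (normr_ge0 _) e1 c1; lra.
have h2 : `|T - 1| / T * `|1 + e * c| <= C1 * e ^+ 2 * 1 * 2.
  by apply: ler_pM => //; [rewrite mulr_ge0// ltW|apply: ler_pM => //; exact: ltW].
have h3 : `|e| * `|c - c0| <= `|e| * (H * `|e|) by rewrite ler_wpM2l.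
have h4 : `|e| * (H * `|e|) = H * e ^+ 2 by rewrite -(real_normK (num_real e)); ring.
rewrite h4 in h3; lra.
Qed.

Lemma dvv_estimate (e s s0 q k T H D C1 : R) : `|e| <= 1 -> `|s| <= 1 -> 0 <= k -> 0 <= C1 ->
  `|s - s0| <= H * `|e| -> `|q - k| <= D * `|e| -> 1 <= T -> `|T - 1| <= C1 * e ^+ 2 ->
  0 <= D ->
  `|- (e * s * q) / T + e * k * s0| <= ((k + D) * C1 + D + k * H) * e ^+ 2.
Proof.
move=> e1 s1 k_ge0 C10 ss qk T1 Te D0; have Ti : T^-1 <= 1 by rewrite invf_le1//; lra.
have T0 : 0 < T^-1 by rewrite invr_gt0; lra.
have -> : - (e * s * q) / T + e * k * s0 =
   - e * (- (s * q * ((T - 1) * T^-1)) + s * (q - k) + k * (s - s0)).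
  by field; rewrite lt0r_neq0//; lra.
rewrite normrM normrN.
have q1 : `|q| <= k + D.
  have -> : q = k + (q - k) by ring.
  apply: le_trans (ler_normD _ _) _; rewrite (ger0_norm k_ge0).
  have := ler_wpM2l D0 e1; lra.
have h1 : `|s * q * ((T - 1) * T^-1)| <= (k + D) * C1 * `|e|.
  rewrite !normrM (gtr0_norm T0).
  have a1 : `|s| * `|q| <= 1 * (k + D) by apply: ler_pM.
  have a2 : `|T - 1| * T^-1 <= C1 * `|e| * 1.
    apply: ler_pM => //; first exact: ltW.
    apply: (le_trans Te); rewrite ler_wpM2l//.
    by rewrite -(real_normK (num_real e)) expr2 -[leRHS]mulr1 ler_wpM2l.
  have : `|s| * `|q| * (`|T - 1| * T^-1) <= 1 * (k + D) * (C1 * `|e| * 1).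
    by apply: ler_pM => //; rewrite mulr_ge0// ltW.
  lra.
have h2 : `|s * (q - k)| <= D * `|e|.
  by rewrite normrM -[leRHS]mul1r; apply: ler_pM.
have h3 : `|k * (s - s0)| <= k * H * `|e|.
  by rewrite normrM (ger0_norm k_ge0) -mulrA ler_wpM2l.
have h4 : `|- (s * q * ((T - 1) * T^-1)) + s * (q - k) + k * (s - s0)| <=
    ((k + D) * C1 + D + k * H) * `|e|.
  apply: le_trans (ler_normD _ _) _.
  apply: (le_trans (lerD (ler_normD _ _) (lexx _))); rewrite normrN; lra.
have h5 := ler_wpM2l (normr_ge0 e) h4.
by rewrite -(real_normK (num_real e)); clear -h5; lra.
Qed.

(** The bifurcation condition m = 4 g + 4 k^2 acts on the linear part: g v - m v / 4 = - k^2 v. Here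
    n and d stand for the nonlinearity and its mean, and v / 4 is the linearization of n - d. *)
Lemma ddvv_estimate (g k m v v0 n M d e C C3 Cn B : R) : 0 <= B ->
  m = 4 * g + 4 * k ^+ 2 -> `|v - v0| <= C * e ^+ 2 -> `|v| <= 1 ->
  `|M - m| <= C3 * e ^+ 2 -> `|M| <= B -> `|n - d - v / 4| <= Cn * e ^+ 2 ->
  `|g * v - M * n + M * d + k ^+ 2 * v0| <= (k ^+ 2 * C + C3 + B * Cn) * e ^+ 2.
Proof.
move=> B0 mE vv0 v1 Mm MB nd.
have -> : g * v - M * n + M * d + k ^+ 2 * v0 =
   - (k ^+ 2 * (v - v0)) - (M - m) * (v / 4) - M * (n - d - v / 4).
  by rewrite mE; field.
apply: le_trans (ler_normB _ _) _.
apply: (le_trans (lerD (ler_normB _ _) (lexx _))); rewrite normrN !(normrM _ (_ - _)).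
have k2 := sqr_ge0 k.
have h1 := ler_wpM2l k2 vv0; rewrite (ger0_norm k2).
have h2 : `|M - m| * `|v / 4| <= C3 * e ^+ 2 * 1.
  apply: ler_pM => //; rewrite normrM (gtr0_norm (x := 4^-1)) ?invr_gt0//.
  by have := normr_ge0 v; lra.
have h3 : `|M| * `|n - d - v / 4| <= B * (Cn * e ^+ 2) by apply: ler_pM.
rewrite (normrM (M - m)); lra.
Qed.

Lemma le_sum3 (a b c : R) : 0 <= a -> 0 <= b -> 0 <= c ->
  [/\ a <= a + b + c, b <= a + b + c & c <= a + b + c].
Proof. by move=> *; split; lra. Qed.

Lemma first_order_bound (a c C x : R) : 0 <= C -> 0 <= c -> 0 <= x -> x <= 1 ->
  `|a + c * x| <= C * x * x -> `|a| <= (c + C) * x.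
Proof.
move=> C0 c0 x0 x1 h; rewrite -(addrK (c * x) a).
apply: le_trans (ler_normB _ _) _; rewrite (ger0_norm (mulr_ge0 c0 x0)).
have := ler_wpM2l (mulr_ge0 C0 x0) x1; lra.
Qed.

End scalar_estimates.

Section small_amplitude.
Context {R : realType}.
Notation mu := (@lebesgue_measure R).
Variables (g k0 : R).
Hypotheses (hg : 0 < g) (hk0 : 0 < k0).
Implicit Types (e t x z : R).

Local Notation L := (pi / k0).
Local Notation Theta := (Theta g k0).
Local Notation vv := (vv g k0).
Local Notation dvv := (dvv g k0).
Local Notation ddvv := (ddvv g k0).
Local Notation zz := (zz g k0).
Local Notation sq := (sq g k0).
Local Notation MM := (MM g k0).
Local Notation T := (Tm g k0).
Local Notation q := (qe g k0).
Local Notation G := (4 * (g + k0 ^+ 2)).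

Lemma Q_slope_bound (a s z gq gk : R) : 0 <= s -> s <= 1 / 2 -> `|z| <= s ->
  0 <= gq -> gq <= gk -> gq / (1 - s) * (s - z) <= 4 * gk * s.
Proof.
move=> s0 s1; rewrite ler_norml => /andP[z1 z2] gq0 gqk.
have h : (1 - s)^-1 <= 2.
  by rewrite -[leRHS]invrK; apply: inv_le; [rewrite invr_gt0|lra].
have i0 : 0 < (1 - s)^-1 by rewrite invr_gt0; lra.
have h1 : gq / (1 - s) <= gk * 2 by apply: ler_pM => //; exact: ltW.
have : gq / (1 - s) * (s - z) <= gk * 2 * (2 * s).
  by apply: ler_pM => //; [rewrite mulr_ge0// ltW|lra|lra].
lra.
Qed.

Lemma Q_upper e z : `|e| <= 1 / 2 -> `|z| <= `|e| ->
  Q g e (T e) (q e) z <= q e + G * `|e|.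
Proof.
move=> e2 ze; have e1 : `|e| < 1 by lra.
have q0 := qe_gt0 hg hk0 e1; have qk := qe_le hg hk0 e1; have g0 := hg.
apply: le_trans (Q_ub hg e1 (Tm_gt0 hg hk0 e1) q0 ze) _; rewrite lerD2l.
by apply: Q_slope_bound => //; [rewrite addr_ge0// ltW|rewrite lerD2l].
Qed.

(** [Q_upper] bounds the half period from below by pi / sqrt(q + G |e|). Together with [qe_le] this
    pins q to k0^2 up to a multiple of |e|. *)
Lemma qe_lower e : `|e| <= 1 / 2 -> k0 ^+ 2 <= q e + G * `|e|.
Proof.
move=> e2; have e1 : `|e| < 1 by lra.
have q0 := qe_gt0 hg hk0 e1; have T0 := Tm_gt0 hg hk0 e1.
have G0 : 0 <= G * `|e| by rewrite mulr_ge0// mulr_ge0// addr_ge0 ?sqr_ge0// ltW.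
set m := q e + G * `|e|; have m0 : 0 < m by rewrite /m; lra.
have s0 : 0 < Num.sqrt m by rewrite sqrtr_gt0.
have h : (Num.sqrt m)^-1 * (pi - 0) <= L.
  rewrite -(P_qe hg hk0 e1) -seg_int_cst ?pi_ge0//; apply: seg_int_le.
  - by move=> x _; exact: cvg_cst.
  - by move=> x _; exact: Wcos_continuous.
  - move=> t _; rewrite /W; have ec := abs_ecos e t.
    have p := Q_gt0 hg e1 T0 q0 ec.
    by apply: inv_le; [rewrite sqrtr_gt0|apply: ler_wsqrtr; exact: Q_upper].
have p0 : 0 < (pi : R) by exact: pi_gt0.
rewrite subr0 mulrC ler_pM2l// in h.
have : k0 <= Num.sqrt m by rewrite -[k0]invrK -[leRHS]invrK; apply: inv_le; rewrite ?invr_gt0.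
move=> h1; have : k0 ^+ 2 <= Num.sqrt m ^+ 2.
  by apply: lerXn2r => //; rewrite nnegrE ltW.
by rewrite sqr_sqrtr// ltW.
Qed.

Lemma sq_near e x : `|e| <= 1 / 2 -> `|sq e x - k0| <= G / k0 * `|e|.
Proof.
move=> e2; have e1 : `|e| < 1 by lra.
have q0 := qe_gt0 hg hk0 e1; have T0 := Tm_gt0 hg hk0 e1.
have ze : `|zz e x| <= `|e| by exact: abs_ecos.
have u := Q_upper e2 ze; have l := Q_ge hg e1 T0 q0 ze.
have ql := qe_lower e2; have qu := qe_le hg hk0 e1.
have s0 := sq_gt0 hg hk0 e1 x.
have ss : sq e x ^+ 2 = Q g e (T e) (q e) (zz e x).
  by rewrite sqr_sqrtr// ltW//; exact: Q_gt0.
have d0 : 0 < sq e x + k0 by rewrite addr_gt0.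
have -> : sq e x - k0 = (sq e x ^+ 2 - k0 ^+ 2) / (sq e x + k0).
  by field; rewrite lt0r_neq0.
rewrite normrM normfV (gtr0_norm d0) mulrAC; apply: ler_pM => //.
- by rewrite invr_ge0 ltW.
- by rewrite ss ler_norml; apply/andP; split; lra.
- by apply: inv_le => //; rewrite lerDr ltW.
Qed.

Lemma Theta_near e x : `|e| <= 1 / 2 -> `|x| <= L ->
  `|Theta e x - k0 * x| <= G / k0 * L * `|e|.
Proof.
move=> e2 xL; have e1 : `|e| < 1 by lra.
have d (t : R) : t \in `[0, 1]%R ->
    is_derive t 1 (fun t => Theta e (x * t) - k0 * (x * t)) (x * (sq e (x * t) - k0)).
  move=> _; have h1 := dThetaE hg hk0 e1 (x * t).
  have h2 : is_derive t 1 (fun t => x * t) x.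
    by apply: is_derive_eq; rewrite /GRing.scale/=; ring.
  have h3 := @is_derive1_comp _ (Theta e) (fun t => x * t) t _ _ h1 h2.
  by apply: is_derive_eq; rewrite /GRing.scale/=; ring.
have b (t : R) : t \in `[0, 1]%R -> `|x * (sq e (x * t) - k0)| <= G / k0 * L * `|e|.
  move=> _; rewrite normrM (_ : G / k0 * L * `|e| = L * (G / k0 * `|e|)); last by ring.
  by apply: ler_pM => //; exact: sq_near.
have := derive_mvt_le ler01 d b.
by rewrite !mulr0 (Theta0 hg hk0 e1) !mulr1 !subr0 mulr1.
Qed.

(** [vv] has zero mean, so the linear term v / 4 can be subtracted under the integral without
    changing it. *)
Lemma K_near e (B : R) : `|e| < 1 -> (forall x, x \in `[- L, L]%R ->
    `|nonlin (vv e x) - nonlin 0 - vv e x / 4| <= B) ->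
  `|K k0 (vv e) - nonlin 0| <= B.
Proof.
move=> e1 hB; have k00 := hk0; have p0 : 0 < (pi : R) by exact: pi_gt0.
have oppL_le_L := oppL_le_L hk0.
have cn := nonlin_vv_continuous hg hk0 e1; have cv := vv_continuous hg hk0 e1.
have c1 : {in `[- L, L]%R, continuous (fun x => nonlin (vv e x))} by move=> x _; exact: cn.
have c2 : {in `[- L, L]%R, continuous (fun x => 4^-1 * vv e x)}.
  by move=> x _; apply: cvgM; [exact: cvg_cst|exact: cv].
have c3 : {in `[- L, L]%R, continuous (fun _ : R => nonlin (0 : R))}.
  by move=> x _; exact: cvg_cst.
have c4 : {in `[- L, L]%R, continuous (fun x => nonlin (vv e x) - nonlin 0)}.
  by move=> x xL; apply: cvgB; [exact: c1|exact: c3].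
have c5 : {in `[- L, L]%R, continuous (fun x => nonlin (vv e x) - nonlin 0 - 4^-1 * vv e x)}.
  by move=> x xL; apply: cvgB; [exact: c4|exact: c2].
have E : K k0 (vv e) - nonlin 0 = k0 / (2 * pi) *
    \int[mu]_(x in `[- L, L]) (nonlin (vv e x) - nonlin 0 - 4^-1 * vv e x).
  rewrite (seg_intB c4 c2) (seg_intB c1 c3) seg_intZl; last by move=> x _; exact: cv.
  rewrite (int_vv hg hk0 e1) mulr0 subr0 (seg_int_cst _ oppL_le_L) mulrBr.
  rewrite [X in _ = _ - X]mulrCA inv_period_mul ?mulr1// lt0r_neq0//.
have kp : 0 < k0 / (2 * pi) by rewrite divr_gt0 ?mulr_gt0.
rewrite E normrM (gtr0_norm kp).
have -> : B = k0 / (2 * pi) * (B * (L - - L)).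
  by rewrite mulrCA inv_period_mul ?mulr1// lt0r_neq0.
rewrite ler_wpM2l ?(ltW kp)//; apply: seg_int_norm_le => // x xL.
by rewrite [4^-1 * _]mulrC; exact: hB.
Qed.

Lemma small_amplitude : exists C r, [/\ 0 <= C, 0 < r, r < 1 & forall e x,
  `|e| < r -> x \in `[- L, L]%R ->
  [/\ `|vv e x - e * cos (k0 * x)| <= C * e ^+ 2,
      `|dvv e x + e * k0 * sin (k0 * x)| <= C * e ^+ 2 &
      `|ddvv e x + k0 ^+ 2 * (e * cos (k0 * x))| <= C * e ^+ 2]].
Proof.
have [C1 [r1 [C10 r10 r11 exps]]] := amplitude_expansion hg hk0.
pose D := G / k0; pose H := D * L.
have G0 : 0 <= G by rewrite mulr_ge0// addr_ge0 ?sqr_ge0// ltW.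
have D0 : 0 <= D by rewrite divr_ge0// ltW.
have H0 : 0 <= H by rewrite mulr_ge0// ltW// L_gt0.
pose Cv := H + 2 * C1; have Cv0 : 0 <= Cv by rewrite addr_ge0// mulr_ge0.
pose m := 4 * g + 4 * k0 ^+ 2.
pose C3 := curvature g k0 + C1.
have C30 : 0 <= C3 by rewrite addr_ge0// ltW// curvature_gt0.
pose B := 16 * (g + k0 ^+ 2).
have B0 : 0 <= B by rewrite mulr_ge0// addr_ge0 ?sqr_ge0// ltW.
pose Cn := 6 * (1 + Cv) ^+ 2; have Cn0 : 0 <= Cn by rewrite mulr_ge0// sqr_ge0.
pose Cd := (k0 + D) * C1 + D + k0 * H.
have Cd0 : 0 <= Cd.
  have k00 := ltW hk0; have := mulr_ge0 k00 H0; have := mulr_ge0 (addr_ge0 k00 D0) C10.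
  rewrite /Cd; lra.
pose Ce := k0 ^+ 2 * Cv + C3 + B * Cn.
have Ce0 : 0 <= Ce.
  by apply: addr_ge0; [apply: addr_ge0 => //; apply: mulr_ge0; rewrite ?sqr_ge0|exact: mulr_ge0].
pose r := Num.min r1 (Num.min (1 / 2) (1 / (2 * (1 + Cv)))).
have Cv1 : 0 < 2 * (1 + Cv) by lra.
have [Sv Sd Se] := le_sum3 Cv0 Cd0 Ce0.
exists (Cv + Cd + Ce), r; split.
- exact: (addr_ge0 (addr_ge0 Cv0 Cd0) Ce0).
- by rewrite !lt_min r10 !divr_gt0.
- by rewrite gt_min r11.
move=> e x; rewrite !lt_min => /and3P[er e2 ev] xL.
have e22 : `|e| <= 1 / 2 by exact: ltW.
have e1 : `|e| < 1 by clear -hg hk0 e2; lra.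
have n0 : `|0 : R| < r1 by rewrite normr0.
have [Te Me] := exps e 0 er n0.
have {}Me : `|MM e - m| <= C3 * e ^+ 2.
  move: Me; rewrite MM0// expr0n/= subr0 addr0 (ger0_norm (sqr_ge0 e)) => h.
  have e21 : e ^+ 2 <= 1.
    rewrite -(real_normK (num_real e)) -[leRHS](expr1n _ 2).
    by apply: lerXn2r; rewrite ?nnegrE// ltW.
  exact: first_order_bound C10 (ltW (curvature_gt0 hg hk0)) (sqr_ge0 e) e21 h.
have vest y : y \in `[- L, L]%R -> `|vv e y - e * cos (k0 * y)| <= Cv * e ^+ 2.
  rewrite in_itv/= => /andP[y1 y2]; have yL : `|y| <= L by rewrite ler_norml y1.
  apply: vv_estimate => //; [exact: ltW|exact: cos_max| |exact: Tm_ge1].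
  by apply: le_trans (cos_lip _ _) _; exact: Theta_near.
have vsmall y : y \in `[- L, L]%R -> `|vv e y| <= (1 + Cv) * `|e|.
  move=> /vest h.
  have -> : vv e y = (vv e y - e * cos (k0 * y)) + e * cos (k0 * y) by ring.
  apply: le_trans (ler_normD _ _) _.
  have h1 : `|e * cos (k0 * y)| <= `|e| * 1 by rewrite normrM ler_wpM2l ?cos_max.
  have h2 : Cv * e ^+ 2 <= Cv * `|e|.
    by rewrite ler_wpM2l// -(real_normK (num_real e)) expr2 -[leRHS]mulr1 ler_wpM2l// ltW.
  clear -hg hk0 h h1 h2; lra.
have nt y : y \in `[- L, L]%R ->
    `|nonlin (vv e y) - nonlin 0 - vv e y / 4| <= 3 * (1 + Cv) ^+ 2 * e ^+ 2.
  move=> /vsmall h; have h1 : (1 + Cv) * `|e| <= 1 / 2.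
    by move: ev; rewrite ltr_pdivlMr// => ev; clear -hg hk0 ev; lra.
  apply: le_trans (nonlin_taylor (le_trans h h1)) _; rewrite -mulrA ler_wpM2l//.
  rewrite -(real_normK (num_real (vv e y))) -(real_normK (num_real e)) -exprMn.
  by apply: lerXn2r; rewrite ?nnegrE// mulr_ge0// addr_ge0.
have Kn := K_near e1 nt; have ntx := nt x xL.
have Mle : `|MM e| <= B.
  by rewrite gtr0_norm ?MM_gt0//; exact: MM_le.
have vx := vest x xL.
have e20 := sqr_ge0 e.
have xa : `|x| <= L by move: xL; rewrite in_itv/= ler_norml.
split.
- by apply: (le_trans vx); rewrite ler_wpM2r.
- apply: (@le_trans _ _ (Cd * e ^+ 2)); last by rewrite ler_wpM2r.
  apply: dvv_estimate => //; [exact: ltW| |exact: ltW| | |exact: Tm_ge1].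
  + by rewrite ler_norml sin_geN1 sin_le1.
  + by apply: le_trans (sin_lip _ _) _; exact: Theta_near.
  + exact: sq_near.
- apply: (@le_trans _ _ (Ce * e ^+ 2)); last by rewrite ler_wpM2r.
  apply: ddvv_estimate => //.
  + apply/ltW; rewrite ltr_norml vv_gtN1// vv_lt1//.
  + have -> : nonlin (vv e x) - K k0 (vv e) - vv e x / 4 =
      (nonlin (vv e x) - nonlin 0 - vv e x / 4) - (K k0 (vv e) - nonlin 0) by ring.
    apply: le_trans (ler_normB _ _) _; rewrite /Cn; clear -hg hk0 ntx Kn; lra.
Qed.

End small_amplitude.

(** * The bifurcation curve *)

Section solution_properties.
Context {R : realType}.
Notation mu := (@lebesgue_measure R).
Variables (g k0 : R).
Hypotheses (hg : 0 < g) (hk0 : 0 < k0).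
Implicit Types (e s t x : R).

Local Notation L := (pi / k0).
Local Notation vv := (vv g k0).
Local Notation dvv := (dvv g k0).
Local Notation ddvv := (ddvv g k0).
Local Notation MM := (MM g k0).

Lemma vv_W2_per e p : `|e| < 1 -> 0 <= p -> W2_per p k0 (vv e).
Proof.
move=> e1 p0; apply: (W2_perI (du := dvv e) (ddu := ddvv e)).
- exact: p0.
- exact: dvvP.
- exact: ddvvP.
- exact: ddvv_continuous.
- exact: vv_periodic.
Qed.

Lemma vv_U e : `|e| < 1 -> U k0 (vv e).
Proof.
move=> e1; split.
- exact: vv_W2_per.
- exact: vvN.
- exact: int_vv.
- exact: vv_gtN1.
Qed.

Lemma vv_F_zero e : `|e| < 1 -> F_zero g k0 (vv e) (MM e).
Proof.
move=> e1.
have w := wderiv_ae (weak_derivative2 (dvvP hg hk0 e1) (ddvvP hg hk0 e1)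
  (ddvv_continuous hg hk0 e1)).
apply: filterS w; first exact: (ae_filter_ringOfSetsType mu).
by move=> x h; rewrite /F h /ddvv; ring.
Qed.

Lemma vv_W2_norm p : 1 <= p -> exists C : R, forall e, `|e| < 1 ->
  (W2_norm p k0 (vv e) <= C%:E)%E.
Proof.
move=> p1; have l0 := L_gt0 hk0; have p0 : 0 <= p by lra.
pose B := 1 + 64 * (g + k0 ^+ 2).
have B0 : 0 <= B by rewrite addr_ge0// mulr_ge0// addr_ge0 ?sqr_ge0// ltW.
exists ((2 * L * 1 `^ p + 2 * L * B `^ p + Cdd g k0 p `^ p * (7 * pi * (8 / k0))) `^ p^-1).
move=> e e1; apply: (W2_norm_le (du := dvv e) (ddu := ddvv e)).
- lra.
- exact: dvvP.
- exact: ddvvP.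
- exact: ddvv_continuous.
- rewrite !EFinD; apply: leeD; [apply: leeD|].
  + apply: int_powR_le => //; first exact: vv_continuous.
    move=> x _; apply/ltW; rewrite ltr_norml vv_gtN1// vv_lt1//.
  + apply: int_powR_le => //; first exact: dvv_continuous.
    by move=> x _; exact: dvv_bound.
  + exact: int_ddvv_powR.
Qed.

Lemma vv_at_L e : `|e| < 1 -> vv e L = (1 - e) / Tm g k0 e - 1.
Proof. by move=> e1; rewrite /vv /zz (ThetaL hg hk0 e1) cospi mulrN1. Qed.

Lemma vv_at_0 e : `|e| < 1 -> vv e 0 = (1 + e) / Tm g k0 e - 1.
Proof. by move=> e1; rewrite /vv /zz (Theta0 hg hk0 e1) cos0 mulr1. Qed.

Lemma vv_neq0 e : `|e| < 1 -> e != 0 -> vv e <> cst 0.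
Proof.
move=> e1 en h; have T0 := Tm_gt0 hg hk0 e1.
have Ti : (Tm g k0 e)^-1 != 0 by rewrite invr_neq0// lt0r_neq0.
have : (1 + e) / Tm g k0 e - 1 = (1 - e) / Tm g k0 e - 1.
  by rewrite -vv_at_0// -vv_at_L// h.
move=> /addIr /(mulIf Ti) E; move/eqP: en; apply; lra.
Qed.

Lemma vv0 : vv 0 = cst 0.
Proof.
apply/funext => x; rewrite /vv /zz mul0r addr0 Tm0// divr1 subrr.
by [].
Qed.

Lemma vv_L_le e : `|e| < 1 -> vv e L <= - e.
Proof.
move=> e1; have T1 := Tm_ge1 hg hk0 e1; have T0 := Tm_gt0 hg hk0 e1.
rewrite vv_at_L//; have e11 : 0 <= 1 - e by move: e1; rewrite ltr_norml => /andP[]; lra.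
have : (1 - e) / Tm g k0 e <= 1 - e by rewrite ler_pdivrMr// ler_peMr.
lra.
Qed.

(** Changes the parameter in [small_amplitude]: replacing e by s in the leading term costs |e - s|
    times 1, k0 or k0^2 in the function and its two derivatives. *)
Lemma vv_local_estimate : exists C r, [/\ 0 <= C, 0 < r, r < 1 & forall e s (C' : R),
  `|e| < r -> 0 <= C' -> `|e - s| <= C' * s ^+ 2 -> e ^+ 2 <= 2 * s ^+ 2 ->
  (H2_norm k0 (fun x => vv e x - s * cos (k0 * x))%R <=
   (Num.sqrt (6 * L) * (2 * C + (1 + k0 + k0 ^+ 2) * C') * s ^+ 2)%:E)%E].
Proof.
have [C [r [C0 r0 r1 H]]] := small_amplitude hg hk0.
exists C, r; split => // e s C' er C'0 es e2; have e1 : `|e| < 1 by lra.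
have k00 := hk0; have k20 := sqr_ge0 k0; have s20 := sqr_ge0 s.
have n0 : 0 <= 1 + k0 + k0 ^+ 2 by lra.
have Ce : C * e ^+ 2 <= 2 * C * s ^+ 2.
  by rewrite (_ : 2 * C * s ^+ 2 = C * (2 * s ^+ 2)) ?ler_wpM2l//; ring.
have bnd (a m f : R) : `|a| <= C * e ^+ 2 -> `|f| <= m -> m <= 1 + k0 + k0 ^+ 2 ->
    `|a + (e - s) * f| <= (2 * C + (1 + k0 + k0 ^+ 2) * C') * s ^+ 2.
  move=> ha hf hm; apply: le_trans (ler_normD _ _) _; rewrite normrM.
  have : `|e - s| * `|f| <= C' * s ^+ 2 * (1 + k0 + k0 ^+ 2).
    by apply: ler_pM => //; exact: le_trans hf hm.
  lra.
rewrite -[X in (_ <= X%:E)%E]mulrA.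
apply: (@H2_norm_le _ k0 _ _ (fun x => dvv e x + s * k0 * sin (k0 * x))
   (fun x => ddvv e x + k0 ^+ 2 * (s * cos (k0 * x)))).
- exact: hk0.
- by rewrite mulr_ge0// addr_ge0 ?mulr_ge0.
- move=> x; have h := dvvP hg hk0 e1 x.
  have hl : is_derive x 1 (fun x => k0 * x) k0.
    by apply: is_derive_eq; rewrite /GRing.scale/=; ring.
  have hc := @is_derive1_comp _ cos (fun x => k0 * x) x _ _ (is_derive_cos _) hl.
  by apply: is_derive_eq; rewrite /GRing.scale/=; ring.
- move=> x; have h := ddvvP hg hk0 e1 x.
  have hl : is_derive x 1 (fun x => k0 * x) k0.
    by apply: is_derive_eq; rewrite /GRing.scale/=; ring.
  have hc := @is_derive1_comp _ sin (fun x => k0 * x) x _ _ (is_derive_sin _) hl.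
  by apply: is_derive_eq; rewrite /GRing.scale/=; ring.
- move=> x; apply: cvgD; first exact: ddvv_continuous.
  by cvg_arith.
- move=> x xL; have [h0 h1 h2] := H e x er xL; split.
  + have -> : vv e x - s * cos (k0 * x) =
      (vv e x - e * cos (k0 * x)) + (e - s) * cos (k0 * x) by ring.
    by apply: (bnd _ 1) => //; [exact: cos_max|lra].
  + have -> : dvv e x + s * k0 * sin (k0 * x) =
      (dvv e x + e * k0 * sin (k0 * x)) + (e - s) * - (k0 * sin (k0 * x)) by ring.
    apply: (bnd _ k0) => //; last lra.
    rewrite normrN normrM (gtr0_norm hk0) -[leRHS]mulr1 ler_wpM2l ?(ltW hk0)//.
    by rewrite ler_norml sin_geN1 sin_le1.
  + have -> : ddvv e x + k0 ^+ 2 * (s * cos (k0 * x)) =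
      (ddvv e x + k0 ^+ 2 * (e * cos (k0 * x))) + (e - s) * - (k0 ^+ 2 * cos (k0 * x)) by ring.
    apply: (bnd _ (k0 ^+ 2)) => //; last lra.
    by rewrite normrN normrM (ger0_norm k20) -[leRHS]mulr1 ler_wpM2l// cos_max.
Qed.

End solution_properties.

(** * Derivatives of [M] at the bifurcation point, and the global statement *)

Section quadratic_germ.
Context {R : realType}.
Variables (M : R -> R) (m c s0 : R).
Hypotheses (s00 : 0 < s0) (ME : forall s, `|s| < s0 -> M s = m - c * s ^+ 2).

Lemma quadratic_derive (s : R) : `|s| < s0 -> is_derive s 1 M (- (2 * c * s)).
Proof.
move=> hs; apply: (@is_derive_quadratic _ M s _ `|c| (s0 - `|s|)); first by rewrite subr_gt0.
move=> y hy; have y0 : `|y| < s0 by have := lerB_dist y s; lra.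
rewrite !ME//.
have -> : m - c * y ^+ 2 - (m - c * s ^+ 2) - (y - s) * - (2 * c * s) =
  - (c * (y - s) ^+ 2) by ring.
by rewrite normrN normrM [`|(y - s) ^+ 2|]ger0_norm ?sqr_ge0.
Qed.

Lemma quadratic_derive1 (s : R) : `|s| < s0 -> derive1 M s = - (2 * c * s).
Proof. by move=> hs; have h := quadratic_derive hs; rewrite derive1E derive_val. Qed.

Lemma quadratic_derive2 : is_derive (0 : R) 1 (derive1 M) (- (2 * c)).
Proof.
apply: (@is_derive_quadratic _ _ _ _ 0 s0) => // y; rewrite subr0 => hy.
rewrite !quadratic_derive1 ?normr0// mul0r.
by rewrite (_ : _ - _ - _ = 0) ?normr0//; ring.
Qed.

End quadratic_germ.

Theorem theorem1p2 (R : realType) (g k0 : R) (hg : 0 < g) (hk0 : 0 < k0) :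
  exists (eps : R) (vloc : R -> R -> R) (Mloc : R -> R),
    subcritical_pitchfork g k0 eps vloc Mloc /\
    exists (v : R -> R -> R) (M : R -> R),
      (\forall s \near (0 : R), v s = vloc s /\ M s = Mloc s) /\
      continuous_curve k0 setT v M /\
      (forall s : R,
         F_zero g k0 (v s) (M s) /\
         periodic (fun x => 1 + v s x) (2 * pi / k0) /\
         stationary_solution g (M s) (fun x => 1 + v s x)) /\
      (forall p : R, 1 <= p ->
         exists C : R, forall s : R,
           W2_per p k0 (v s) /\ (W2_norm p k0 (v s) <= C%:E)%E) /\
      (forall s : R, s != 0 -> v s <> cst 0) /\
      (* each v s is continuous, so the inner infimum is a minimum *)
      inf (range (fun s : R => inf (v s @` `[- (pi / k0), pi / k0]))) = -1.
Proof.
have [C [r [C0 r0 r1 exps]]] := amplitude_expansion hg hk0.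
have c0 := curvature_gt0 hg hk0; set c := curvature g k0 in exps c0.
have expM e e' : `|e| < r -> `|e'| < r ->
    `|MM g k0 e - MM g k0 e' + c * (e ^+ 2 - e' ^+ 2)| <=
    C * (e ^+ 2 + e' ^+ 2) * `|e ^+ 2 - e' ^+ 2|.
  by move=> h h'; have [] := exps e e' h h'.
pose e := amplitude (MM g k0) c C r; pose s0 := s_max c C r.
have s00 : 0 < s0 by exact: s_max_gt0.
have e1 s : `|e s| < 1 by exact: (amplitude_lt1 c0 C0 r0 r1 expM).
have ce : continuous e by exact: (amplitude_continuous c0 C0 r0 r1 expM).
have esgn s : s != 0 -> e s != 0.
  move=> sn; have := amplitude_sign c0 C0 r0 r1 expM sn; rewrite -/(e s) => h.
  by apply/eqP => z; move: h; rewrite z mul0r ltxx.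
have ME s : `|s| < s0 -> MM g k0 (e s) = MM g k0 0 - c * s ^+ 2.
  by move=> /ltW; exact: (M_amplitude c0 C0 r0 r1 expM).
have esq s : `|s| < s0 -> e s ^+ 2 <= 2 * s ^+ 2.
  move=> /ltW hs; rewrite /e (amplitude_local _ hs).
  exact: (local_amplitude_sq c0 C0 r0 r1 expM hs).
have ecub s : `|s| < s0 -> `|e s - s| <= 4 * C / c * s ^+ 2.
  move=> /ltW hs; rewrite /e (amplitude_local _ hs).
  exact: (local_amplitude_cube c0 C0 r0 r1 expM hs).
have n0 : `|0 : R| < s0 by rewrite normr0.
have e0 : e 0 = 0.
  have := esq 0 n0; rewrite expr0n/= mulr0 => h.
  by apply/eqP; rewrite -sqrf_eq0; apply/eqP/le_anti; rewrite h sqr_ge0.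
pose v s := vv g k0 (e s); pose M s := MM g k0 (e s).
have curve A : continuous_curve k0 A v M.
  move=> s _; split.
  - exact: vv_U.
  - exact: (H2_continuous hg hk0 (e1 s) (ce s)).
  - exact: (@continuous_comp _ _ _ e (MM g k0) s (ce s) (MM_cvg hg hk0 (e1 s))).
have nz s : s != 0 -> v s <> cst 0 by move=> /esgn; exact: vv_neq0.
(* The global curve, restricted to |s| < s0, is its own local branch. *)
exists s0, v, M; split.
  split.
  - exact: s00.
  - split; first exact: curve.
    by move=> s _; exact: vv_F_zero.
  - split; first by rewrite /v e0 vv0.
    by rewrite /M e0 MM0.
  - split; last by move=> s _; exact: nz.
    have [C2 [r2 [C20 r20 r21 est]]] := vv_local_estimate hg hk0.
    have C'0 : 0 <= 4 * C / c by apply: divr_ge0; [exact: mulr_ge0|exact: ltW].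
    exists (Num.sqrt (6 * (pi / k0)) * (2 * C2 + (1 + k0 + k0 ^+ 2) * (4 * C / c))).
    have er : \forall s \near (0 : R), `|e s| < r2.
      apply: (near_comp (P := fun a => `|a| < r2) (ce 0)).
      by apply: near_norm_lt; rewrite e0 normr0.
    have sr : \forall s \near (0 : R), `|s| < s0 by exact: near_norm_lt.
    apply: filterS2 er sr => s h1 h2.
    exact: est h1 C'0 (ecub s h2) (esq s h2).
  - have D1 := quadratic_derive ME; have D2 := quadratic_derive2 s00 ME.
    split.
    + by move=> s hs; have [] := D1 s hs.
    + by rewrite (quadratic_derive1 ME)// mulr0 oppr0.
    + by have [] := D2.
    + have -> : derive1n 2 M 0 = derive1 (derive1 M) 0 by [].
      by rewrite derive1E derive_val oppr_lt0 mulr_gt0.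
exists v, M; split; first by apply: filterE.
split; first exact: curve.
split.
  move=> s; split; first exact: vv_F_zero.
  split; last exact: vv_stationary.
  by move=> x; congr (1 + _); exact: (vv_periodic hg hk0 (e1 s) x).
split.
  move=> p p1; have [B HB] := vv_W2_norm hg hk0 p1; exists B => s; split; last exact: HB.
  by apply: vv_W2_per => //; exact: le_trans p1.
split; first exact: nz.
have L0 := L_gt0 hk0.
have lb s : lbound (v s @` `[- (pi / k0), pi / k0]) (-1).
  by move=> _ [x _ <-]; apply/ltW; exact: vv_gtN1.
have ne s : v s @` `[- (pi / k0), pi / k0] !=set0.
  by exists (v s 0), 0 => //=; rewrite in_itv/= ltW//; lra.
have inner s : -1 <= inf (v s @` `[- (pi / k0), pi / k0]) by exact: lb_le_inf.
have lbr : lbound (range (fun s => inf (v s @` `[- (pi / k0), pi / k0]))) (-1).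
  by move=> _ [s _ <-].
apply/eqP; rewrite eq_le; apply/andP; split; last first.
  by apply: lb_le_inf => //; exists (inf (v 0 @` `[- (pi / k0), pi / k0])); exists 0.
(* Rupture: once the amplitude exceeds 1 - d, the film height at x = pi / k0 is below d. *)
apply/ler_addgt0Pl => d d0.
have [s hs] := amplitude_sup c0 C0 r0 r1 expM d0.
have h1 : inf (range (fun s => inf (v s @` `[- (pi / k0), pi / k0]))) <=
    inf (v s @` `[- (pi / k0), pi / k0]).
  by apply: ge_inf; [exists (-1)|exists s].
have h2 : inf (v s @` `[- (pi / k0), pi / k0]) <= v s (pi / k0).
  apply: ge_inf; first by exists (-1).
  by exists (pi / k0) => //=; rewrite in_itv/= lexx andbT; lra.
have h3 : v s (pi / k0) <= - e s by exact: vv_L_le.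
have h4 : 1 - d < e s by [].
lra.
Qed.
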